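(* Let $d\ge1$, let $K\subset\mathbb{C}^d$ be a regular compact set, and let $\{p_j\}_{j\ge1}$ be a sequence of polynomials such that $p_1\equiv1$, $\|p_j\|_K\le1$ for all $j$, and $\{p_1,\dots,p_{m_n}\}$ is a basis of $\mathcal{P}_n$ for every $n$. Let $B_n(z):=\sum_{j=1}^{m_n}|p_j(z)|^2$ and suppose that for any subsequence $Y\subset\mathbb{N}$ there are a further subsequence $Y_0\subset Y$ and a countable dense set of points $\{w_r\}$ in $\mathbb{C}^d$ such that $$\lim_{n\to\infty,\ n\in Y_0}\frac{1}{2n}\log B_n(w_r)=V_K(w_r),\qquad r=1,2,\dots$$ Let $\{a_j\}_{j\ge1}$ be a sequence of i.i.d. complex random variables satisfying $\mathbb{P}(|a_j|>e^{t})=o(1/t^d)$ as $t\to\infty$, and let $H_n(z):=\sum_{j=1}^{m_n}a_jp_j(z)$. Then, in probability, $$\frac1n\log|H_n|\to V_K\quad\text{in }L^1_{loc}(\mathbb{C}^d).$$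
   Context: $\mathcal{P}_n$ is the space of holomorphic polynomials of degree at most $n$ in $\mathbb{C}^d$, $m_n=\dim\mathcal{P}_n$, and $\|p\|_K=\sup_K|p|$. $L(\mathbb{C}^d)$ is the set of plurisubharmonic functions $u$ on $\mathbb{C}^d$ with $u(z)\le\log|z|+O(1)$ as $|z|\to\infty$. For a nonpluripolar compact set $K$, $V_K(z):=\sup\{u(z):u\in L(\mathbb{C}^d),\ u\le0\text{ on }K\}$; $K$ is regular if $V_K$ is continuous on $\mathbb{C}^d$. The random variables are defined on a probability space $(\Omega,\mathcal{H},\mathbb{P})$ and are nondegenerate (their distribution is not supported at a single point). Convergence in probability in $L^1_{loc}(\mathbb{C}^d)$ is convergence in probability with respect to the (metrizable) topology of $L^1_{loc}(\mathbb{C}^d)$ (on the event $H_n\equiv0$, $\log|H_n|\equiv-\infty$ counts as not close to $V_K$); equivalently, every sequence $Y\subset\mathbb{N}$ has a further subsequence $Y_2\subset Y$ along which the convergence in $L^1_{loc}(\mathbb{C}^d)$ holds almost surely. *)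

(* Defs.v *)
From HB Require Import structures.
From mathcomp Require Import all_boot all_order all_algebra.
(* The notations of [mpoly] clash with those of the analysis library;
   [{mpoly R[n]}] is written [mpoly n R], and [p.@[v]] is [meval v p]. *)
From mathcomp Require Import -(notations) mpoly.
From mathcomp Require Import finmap.
From mathcomp Require Import all_classical all_reals all_analysis.
From mathcomp Require Import complex.

Set Implicit Arguments.
Unset Strict Implicit.
Unset Printing Implicit Defensive.

Import Order.TTheory GRing.Theory Num.Theory.
Import numFieldNormedType.Exports.

Local Open Scope classical_set_scope.
Local Open Scope ring_scope.

(* The library equips abstract numeric fields with their norm topology, but
   not the concrete type [R[i]]. *)
HB.instance Definition _ (R : realType) := NormedModule.copy R[i] R[i]^o.

(* R-valued modulus (the norm [`|z|] of [R[i]] is [R[i]]-valued). *)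
Notation cabs := Normc.normc.

(* The Borel sigma-algebra of the complex numbers. *)
Notation borelC R := (g_sigma_algebraType (@open R[i])).

Section potential_theory.
Context {R : realType}.

Definition enorm d (z : 'rV[R[i]]_d) : R :=
  Num.sqrt (\sum_(i < d) cabs (z ord0 i) ^+ 2).

Definition upper_semicontinuous (X : topologicalType) (f : X -> \bar R) :=
  lower_semicontinuous (fun x => - f x)%E.

Definition circle_point (a : R[i]) (r t : R) : R[i] :=
  a + real_complex R r * Complex (cos t) (sin t).

(* The function identically -oo is allowed, so that the restriction of a
   plurisubharmonic function to a complex line is always subharmonic. *)
Definition subharmonic (v : R[i] -> \bar R) :=
  [/\ upper_semicontinuous v,
      forall z, (v z < +oo)%E &
      forall (a : R[i]) (r : R), 0 < r ->
        (v a <= ((2 * pi)^-1)%:E *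
           \int[lebesgue_measure]_(t in `[0%R, (2 * pi)%R]) v (circle_point a r t))%E].

Definition plurisubharmonic d (u : 'rV[R[i]]_d -> \bar R) :=
  [/\ upper_semicontinuous u,
      forall z, (u z < +oo)%E &
      forall a b : 'rV[R[i]]_d, subharmonic (fun l => u (a + l *: b))].

Definition pluripolar d (E : set 'rV[R[i]]_d) :=
  exists u : 'rV[R[i]]_d -> \bar R,
    [/\ plurisubharmonic u, exists z, u z != -oo%E &
        forall z, E z -> u z = -oo%E].

Definition lelong_class d (u : 'rV[R[i]]_d -> \bar R) :=
  plurisubharmonic u /\
  exists M c : R, forall z, M <= enorm z -> (u z <= (ln (enorm z) + c)%:E)%E.

Definition extremal_function d (K : set 'rV[R[i]]_d) (z : 'rV[R[i]]_d) : \bar R :=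
  ereal_sup [set u z | u in [set u : 'rV[R[i]]_d -> \bar R |
    lelong_class u /\ forall x, K x -> (u x <= 0)%E]].

Definition regular_set d (K : set 'rV[R[i]]_d) :=
  ~ pluripolar K /\ continuous (extremal_function K).

End potential_theory.

Section polynomials.
Context {R : realType}.

Definition peval d (q : mpoly d R[i]) (z : 'rV[R[i]]_d) : R[i] :=
  meval (fun i => z ord0 i) q.

(* [msize q] is the degree of [q] plus one, and [msize 0 = 0]. *)
Definition poly_space d n : set (mpoly d R[i]) :=
  [set q | (msize q <= n.+1)%N].
Arguments poly_space : clear implicits.

(* Number of monomials of degree at most [n], i.e. the dimension of
   [poly_space d n]: see [monomial_basis] below. *)
Definition poly_dim d n : nat := #|{: bmultinom d n.+1}|.

Definition basis_of_set (F : fieldType) (V : lmodType F) (S : set V) m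
    (e : 'I_m -> V) :=
  [/\ forall j, S (e j),
      forall c : 'I_m -> F, \sum_(j < m) c j *: e j = 0 -> forall j, c j = 0 &
      forall q, S q -> exists c : 'I_m -> F, q = \sum_(j < m) c j *: e j].

Lemma monomial_basis d n :
  basis_of_set (poly_space d n)
    (fun j : 'I_(poly_dim d n) => mpolyX R[i] (bmnm (enum_val j))).
Proof.
split=> [j|c c0 j|q qn].
- by rewrite /poly_space /= mmeasureX; exact: bmdeg.
- have /(congr1 (mcoeff (bmnm (enum_val j)))) := c0.
  rewrite mcoeff0 raddf_sum /= (bigD1 j) //= mcoeffZ mcoeffX eqxx mulr1.
  rewrite big1 ?addr0 // => k kj; rewrite mcoeffZ mcoeffX.
  by rewrite -bmeqP (inj_eq enum_val_inj) (negbTE kj) mulr0.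
- exists (fun j => mcoeff (bmnm (enum_val j)) q).
  rewrite [LHS](mpolywE qn) (reindex (@enum_val _ (mem predT))) //=.
  exact: onW_bij (enum_val_bij _).
Qed.

Definition supnorm d (K : set 'rV[R[i]]_d) (q : mpoly d R[i]) : \bar R :=
  ereal_sup [set (cabs (peval q z))%:E | z in K].

Definition sq_sum d (p : nat -> mpoly d R[i]) n (z : 'rV[R[i]]_d) : R :=
  \sum_(j < poly_dim d n) cabs (peval (p j) z) ^+ 2.

Definition poly_comb d (p : nat -> mpoly d R[i]) (c : nat -> R[i]) n
    (z : 'rV[R[i]]_d) : R[i] :=
  \sum_(j < poly_dim d n) c j * peval (p j) z.

End polynomials.
Arguments poly_space {R} d n.

Section product_sigma_finite.
Context d1 d2 (T1 : measurableType d1) (T2 : measurableType d2) {R : realType}.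
Variables (m1 : {sigma_finite_measure set T1 -> \bar R})
  (m2 : {sigma_finite_measure set T2 -> \bar R}).
Local Open Scope ereal_scope.

Lemma product_sigma_finite : sigma_finite setT (m1 \x m2).
Proof.
have /sigma_finiteP[F [TF ndF Foo]] := sigma_finiteT m1.
have /sigma_finiteP[G [TG ndG Goo]] := sigma_finiteT m2.
exists (fun n => F n `*` G n).
  rewrite -setXTT TF TG predeqE => -[x y]; split.
    move=> [/= [n _ Fnx] [k _ Gky]]; exists (maxn n k) => //; split.
    - by move: x Fnx; exact/subsetPset/ndF/leq_maxl.
    - by move: y Gky; exact/subsetPset/ndG/leq_maxr.
  by move=> [n _ []/= ? ?]; split; exists n.
move=> k; have [? ?] := Foo k; have [? ?] := Goo k.
split; first exact: measurableX.
by rewrite product_measure1E// lte_mul_pinfty// ge0_fin_numE.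
Qed.

(* A name for [m1 \x m2] carrying its sigma-finite structure, which the
   library does not make inferable for [\x] itself. *)
Definition product_measure : set (T1 * T2) -> \bar R := m1 \x m2.

HB.instance Definition _ := Measure.copy product_measure (m1 \x m2).
HB.instance Definition _ := Measure_isSigmaFinite.Build _ _ _ product_measure
  product_sigma_finite.

End product_sigma_finite.

Section tuple_measure.
Context d (T : measurableType d) {R : realType}.
Local Open Scope ereal_scope.

Definition tuple_cons n (x : T * n.-tuple T) : n.+1.-tuple T :=
  [tuple of x.1 :: x.2].

Lemma measurable_tuple_cons n : measurable_fun setT (@tuple_cons n).
Proof. exact: measurable_cons. Qed.

Section step.
Variables (mu : {sigma_finite_measure set T -> \bar R}) (n : nat)
  (nu : {sigma_finite_measure set (n.-tuple T) -> \bar R}).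

Definition tuple_measureS : set (n.+1.-tuple T) -> \bar R :=
  pushforward (mu \x nu) (@tuple_cons n).

Let tuple_measureS0 : tuple_measureS set0 = 0.
Proof. by rewrite /tuple_measureS /pushforward preimage_set0 measure0. Qed.

Let tuple_measureS_ge0 A : 0 <= tuple_measureS A.
Proof. exact: (measure_ge0 (mu \x nu)). Qed.

Let tuple_measureS_sigma_additive : semi_sigma_additive tuple_measureS.
Proof.
exact: (@measure_semi_sigma_additive _ _ _
  (measure_function_pushforward__canonical__measure_function_Measure
     (mu \x nu) (@measurable_tuple_cons n))).
Qed.

HB.instance Definition _ := isMeasure.Build _ _ _ tuple_measureS
  tuple_measureS0 tuple_measureS_ge0 tuple_measureS_sigma_additive.

Let tuple_measureS_sigma_finite : sigma_finite setT tuple_measureS.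
Proof.
have [F FT Fm] := product_sigma_finite mu nu.
pose uncons (t : n.+1.-tuple T) : T * n.-tuple T :=
  (thead t, [tuple of behead t]).
have unconsK : cancel (@tuple_cons n) uncons.
  by case=> x t; congr pair; apply: val_inj.
have muncons : measurable_fun setT uncons.
  apply/measurable_fun_pairP; split; first exact: measurable_tnth.
  exact: measurable_behead.
exists (fun k => uncons @^-1` F k).
  by rewrite -preimage_bigcup -FT preimage_setT.
move=> k; have [mF Foo] := Fm k; split.
  by rewrite -[X in measurable X]setTI; exact: muncons.
rewrite /tuple_measureS /pushforward (_ : _ @^-1` _ = F k) //.
by apply/seteqP; split=> x /=; rewrite unconsK.
Qed.

HB.instance Definition _ := Measure_isSigmaFinite.Build _ _ _ tuple_measureS
  tuple_measureS_sigma_finite.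

End step.

(* The n-fold product measure of [mu]. *)
Fixpoint tuple_measure (mu : {sigma_finite_measure set T -> \bar R}) n :
    {sigma_finite_measure set (n.-tuple T) -> \bar R} :=
  if n is m.+1 then tuple_measureS mu (tuple_measure mu m)
  else \d_([tuple of [::]] : 0.-tuple T).

End tuple_measure.

Section lebesgue_Cd.
Context {R : realType}.
Local Open Scope ereal_scope.

(* Lebesgue measure on (R^2)^d; [of_coords] identifies (R^2)^d with C^d. *)
Definition lebesgue_R2d d :=
  tuple_measure (product_measure (@lebesgue_measure R) (@lebesgue_measure R)) d.

Definition of_coords d (x : d.-tuple (R * R)) : 'rV[R[i]]_d :=
  \row_(i < d) Complex (tnth x i).1 (tnth x i).2.

Definition L1dist d (C : set 'rV[R[i]]_d) (f g : 'rV[R[i]]_d -> \bar R) : \bar R :=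
  \int[lebesgue_R2d d]_(x in @of_coords d @^-1` C)
    `|f (of_coords x) - g (of_coords x)|.

End lebesgue_Cd.

Section probability.
Context {R : realType} d0 (T : measurableType d0) (P : probability T R).
Local Open Scope ereal_scope.

Definition mutually_independent d1 (U : measurableType d1)
    (X : nat -> {RV P >-> U}) :=
  forall (J : {fset nat}) (B : nat -> set U), (forall j, measurable (B j)) ->
    P (\bigcap_(j in [set` J]) (X j @^-1` B j)) =
    \prod_(j <- J) P (X j @^-1` B j).

Definition identically_distributed d1 (U : measurableType d1)
    (X : nat -> {RV P >-> U}) :=
  forall (j k : nat) (B : set U), measurable B ->
    distribution P (X j) B = distribution P (X k) B.

Definition nondegenerate_rv d1 (U : measurableType d1) (X : {RV P >-> U}) :=
  forall c : U, distribution P X [set c] != 1.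

(* The sets [f | L1dist C f g < e], for [C] compact and [e > 0], form a basis
   of neighborhoods of [g] in the L^1_loc topology. *)
Definition cvg_in_probability_L1loc d (F : nat -> T -> 'rV[R[i]]_d -> \bar R)
    (g : 'rV[R[i]]_d -> \bar R) :=
  forall C : set 'rV[R[i]]_d, compact C -> forall e : R, (0 < e)%R ->
    P [set w | e%:E <= L1dist C (F n w) g] @[n --> \oo] --> 0.

End probability.

(* Main.v *)
Require Import Defs.
From HB Require Import structures.
From mathcomp Require Import all_boot all_order all_algebra.
From mathcomp Require Import -(notations) mpoly.
From mathcomp Require Import finmap.
From mathcomp Require Import all_classical all_reals all_analysis.
From mathcomp Require Import measurable_realfun complex.
From mathcomp Require Import ring lra zify.

Set Implicit Arguments.
Unset Strict Implicit.
Unset Printing Implicit Defensive.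

Import Order.TTheory GRing.Theory Num.Theory.
Import numFieldNormedType.Exports.

Local Open Scope classical_set_scope.
Local Open Scope ring_scope.

(** Write [v] for the extremal function [V_K], [H_n] for the random polynomial and
    [m_n] for [poly_dim d n].  The proof compares [ln |H_n| / n] with [v] from above
    everywhere and from below at one point of each small box, and lets
    subharmonicity do the rest.

    Preliminaries.  If a polynomial [q] of degree at most [n] is bounded by 1 on [K],
    then [ln (max 1 |q|) / n] is in the Lelong class, so that [|q| <= e ^ (n v)]; this
    rests on Jensen's inequality for polynomials of one variable ([trunc_submean]).
    The other consequence of Jensen's inequality is that a polynomial bounded on a
    small ball grows at most geometrically ([poly_growth]).  Applied to the basis
    near a point of [K], it shows with the hypothesis on [B_n] that [v] is finite,
    hence a continuous real function ([regular_extremal_finite]).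

    Upper bound.  By the tail hypothesis and a union bound over at most
    [(n + 1) ^ d] coefficients, with probability close to 1 all [|a_j|] with [j < m_n]
    are at most [e ^ (eta n)] ([coefficients_le_expR]).  Then
    [|H_n| <= m_n e ^ (eta n) e ^ (n v)], which is at most [e ^ (n (v + 2 eps))] for
    large [n].

    Lower bound on a box.  A nondegenerate random variable falls into any given
    ball of some fixed radius with probability at most [q < 1]
    ([nondegenerate_not_concentrated]).  If [|H_n|] is at most [e ^ (n (v - 3 eps))] on
    a box, then [L] linear forms in the coefficients are small, and these forms are
    triangular up to small errors.  Revealing the coefficients one after the other
    shows that this has probability at most [q ^ L] ([small_ball]), for a number [L]
    that is arbitrary.  Where [v] is small, the forms are functionals dual to the
    first [L] polynomials ([dual_functionals]).  Where [v] is bounded below, they are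
    evaluations, at suitable points of the box, normalised by basis elements of [L]
    different degrees that are nearly extremal there: evaluating at such a point
    makes the elements chosen in lower degrees exponentially smaller.  Nearly
    extremal elements exist in all large degrees, since otherwise the hypothesis on
    [B_n] would fail along a subsequence ([eventually_large_basis]).  Hence
    [rare_below_box].

    Conclusion.  If [|H_n| <= e ^ (n (v + 2 eps))] everywhere and
    [|H_n(z0)| >= e ^ (n (v(z0) - 3 eps))] at one point of a box, then [ln |H_n| / n]
    is close to [v] in [L^1] of the box.  This is Hartogs' lemma ([hartogs]), proved by
    averaging over the rotations [b |-> z0 + e ^ (i t) b], which preserve volume.  A
    compact set is covered by finitely many boxes on which [v] oscillates by at most
    [eps], and the total error is a multiple of [eps] that does not depend on the
    number of boxes ([L1dist_grid_bound]). *)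

Local Notation Re := complex.Re.
Local Notation Im := complex.Im.

(** * Means over circles *)
Section circle_mean.
Context {R : realType}.
Implicit Types (f g : R -> R).
Local Notation mu := (@lebesgue_measure R).

Definition circle_mean f : R :=
  (2 * pi)^-1 * \int[mu]_(t in `[0, 2 * pi]) f t.

Let pi2_gt0 : 0 < 2 * pi :> R.
Proof. by rewrite mulr_gt0 ?pi_gt0. Qed.

Lemma continuous_integrable f (a b : R) : continuous f ->
  mu.-integrable `[a, b] (EFin \o f).
Proof.
move=> cf; apply: continuous_compact_integrable; first exact: segment_compact.
exact: continuous_subspaceT.
Qed.

Lemma circle_meanE f : continuous f ->
  (((2 * pi)^-1)%:E * \int[mu]_(t in `[0%R, (2 * pi)%R]) (f t)%:E)%E =
  (circle_mean f)%:E.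
Proof.
move=> cf; rewrite /circle_mean /Rintegral EFinM fineK//.
apply: integrable_fin_num => //.
exact: (continuous_integrable 0 (2 * pi) cf).
Qed.

Lemma circle_mean_cst c : circle_mean (cst c) = c.
Proof.
rewrite /circle_mean Rintegral_cst//= lebesgue_measure_itv/= lte_fin pi2_gt0.
by rewrite -EFinD /= subr0 mulrCA mulVf ?mulr1// gt_eqF.
Qed.

Lemma circle_meanD f g : continuous f -> continuous g ->
  circle_mean (fun t => f t + g t) = circle_mean f + circle_mean g.
Proof.
move=> cf cg; rewrite /circle_mean RintegralD//; first by rewrite mulrDr.
- exact: continuous_integrable.
- exact: continuous_integrable.
Qed.

Lemma le_circle_mean f g : continuous f -> continuous g ->
  (forall t, f t <= g t) -> circle_mean f <= circle_mean g.
Proof.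
move=> cf cg fg; rewrite /circle_mean ler_wpM2l//.
  by rewrite invr_ge0 ltW.
by apply: le_Rintegral => //; exact: continuous_integrable.
Qed.

Lemma eq_circle_mean f g : f =1 g -> circle_mean f = circle_mean g.
Proof. by move=> fg; congr circle_mean; exact/funext. Qed.

(** Shifts and dilations of the variable are performed on a primitive, by the
    fundamental theorem of calculus.  The derivative is assumed on [-1 < y] to
    leave room around the end point 0. *)
Lemma affine_integral f (G : R -> R) (c e x : R) : continuous f ->
  0 < c -> 0 <= e -> 0 < x ->
  (forall y : R, -1 < y -> is_derive y 1 G (f y)) ->
  \int[mu]_(t in `[0, x]) f (c * t + e) = c^-1 * (G (c * x + e) - G e).
Proof.
move=> cf c0 e0 x0 dG.
have dH (y : R) : 0 <= y -> is_derive y 1 (fun t => c^-1 * G (c * t + e)) (f (c * y + e)).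
  move=> y0.
  have : is_derive (c * y + e) 1 G (f (c * y + e)).
    apply: dG; rewrite (@lt_le_trans _ _ 0)//.
    by rewrite addr_ge0// mulr_ge0// ltW.
  move=> dGy.
  have d1 : is_derive y 1 (fun t : R => c * t + e) c.
    apply: (@is_derive_eq _ _ _ (c \*: (@id R) + cst e)).
    by rewrite addr0 /GRing.scale/= mulr1.
  have d2 := @is_derive1_comp R G (fun t => c * t + e) y _ _ dGy d1.
  apply: (@is_derive_eq _ _ _ (c^-1 \*: (G \o (fun t => c * t + e)))).
  by rewrite /GRing.scale/= mulrCA mulVf ?mulr1// gt_eqF.
have cG (y : R) : 0 <= y -> {for y, continuous (fun t => c^-1 * G (c * t + e))}.
  move=> y0; apply: differentiable_continuous; apply/derivable1_diffP.
  by have [] := dH _ y0.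
have := @continuous_FTC2 R (fun t => f (c * t + e))
  (fun t => c^-1 * G (c * t + e)) 0 x x0.
rewrite /Rintegral => ->.
- by rewrite -EFinD/= mulr0 add0r mulrBr.
- apply: continuous_subspaceT => t.
  apply: (@continuous_comp _ _ _ (fun t => c * t + e) f); last exact: cf.
  apply: continuousD; last exact: cst_continuous.
  by apply: continuousM; [exact: cst_continuous|].
- split.
  + by move=> y; rewrite in_itv/= => /andP[/ltW /dH[]].
  + exact: cvg_at_right_filter (cG 0 _).
  + exact: cvg_at_left_filter (cG x (ltW _)).
- by move=> y; rewrite in_itv/= derive1E => /andP[/ltW /dH[]].
Qed.

Lemma primitive_exists f : continuous f ->
  exists G : R -> R, forall y : R, -1 < y -> is_derive y 1 G (f y).
Proof.
move=> cf; exists (fun x => \int[mu]_(t in `[-1, x]) f t) => y y1.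
have [] := @continuous_FTC1_closed R f (-1) y (y + 1) _ _ y1 (cf y).
- by rewrite ltrDl.
- exact: continuous_integrable.
by rewrite derive1E => d <-; exact: DeriveDef.
Qed.

(** Periodicity makes the increment of a primitive over one period independent of
    the starting point.  These two substitutions drive [jensen_integral]. *)
Lemma circle_mean_periodic f : continuous f ->
  (forall t, f (t + 2 * pi) = f t) ->
  circle_mean (fun t => f (t + pi)) = circle_mean f /\
  circle_mean (fun t => f (2 * t)) = circle_mean f.
Proof.
move=> cf per; have [G dG] := primitive_exists cf.
have pi0 : 0 < pi :> R := pi_gt0 R.
have I c e x c0 e0 x0 := @affine_integral f G c e x cf c0 e0 x0 dG.
have I1 (e x : R) : 0 <= e -> 0 < x ->
    \int[mu]_(t in `[0, x]) f (t + e) = G (x + e) - G e.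
  move=> e0 x0; have := I 1 e x ltr01 e0 x0.
  by rewrite !mul1r invr1 mul1r => <-; apply: eq_Rintegral => t _; rewrite mul1r.
have I0 (x : R) : 0 < x -> \int[mu]_(t in `[0, x]) f t = G x - G 0.
  move=> x0; have := I1 0 x (lexx _) x0; rewrite !addr0 => <-.
  by apply: eq_Rintegral => t _; rewrite addr0.
have P (x : R) : 0 < x -> G (x + 2 * pi) - G (2 * pi) = G x - G 0.
  move=> x0; rewrite -I1// ?(ltW pi2_gt0)// -I0//.
  by apply: eq_Rintegral => t _; rewrite per.
have P1 := P pi pi0; have P2 := P _ pi2_gt0.
rewrite /circle_mean; split; congr (_ * _).
  rewrite I1 ?ltW// I0//.
  have -> : 2 * pi + pi = pi + 2 * pi :> R by rewrite addrC.
  lra.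
have := I 2 0 (2 * pi) _ (lexx _) pi2_gt0; rewrite ltr0n => /(_ isT).
rewrite I0// !addr0.
have -> : 2 * (2 * pi) = 2 * pi + 2 * pi :> R by lra.
have -> : \int[mu]_(t in `[0%R, (2 * pi)%R]) f (2 * t + 0) =
          \int[mu]_(t in `[0%R, (2 * pi)%R]) f (2 * t).
  by apply: eq_Rintegral => t _; rewrite addr0.
move=> ->; lra.
Qed.

End circle_mean.

(** * The mean of a logarithm on a circle *)
Section jensen.
Context {R : realType}.

Lemma continuous_lnf (f : R -> R) : continuous f -> (forall t, 0 < f t) ->
  continuous (fun t => ln (f t)).
Proof.
by move=> cf f0 t; apply: (@continuous_comp _ _ _ f (@ln R)) (cf t) _; exact/continuous_ln/f0.
Qed.

Lemma continuous_trig (m x y : R) :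
  continuous (fun t : R => m + 2 * (x * cos t + y * sin t)).
Proof.
move=> t; apply: cvgD; first exact: cvg_cst.
apply: cvgM; first exact: cvg_cst.
apply: cvgD; (apply: cvgM; first exact: cvg_cst).
  exact: continuous_cos.
exact: continuous_sin.
Qed.

(** The squared modulus of [1 + w e ^ (i t)] for [w = x - i y]. *)
Let q (x y t : R) : R := 1 + (x ^+ 2 + y ^+ 2) + 2 * (x * cos t + y * sin t).

Let q_bound s x y t : 0 <= s -> s < 1 -> x ^+ 2 + y ^+ 2 <= s ^+ 2 ->
  (1 - s) ^+ 2 <= q x y t <= (1 + s) ^+ 2.
Proof.
move=> s0 s1 xys; rewrite /q.
set rho := Num.sqrt (x ^+ 2 + y ^+ 2).
have rho0 : 0 <= rho by exact: sqrtr_ge0.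
have rho2 : rho ^+ 2 = x ^+ 2 + y ^+ 2.
  by rewrite sqr_sqrtr// addr_ge0// sqr_ge0.
have rhos : rho <= s.
  by rewrite -(@ler_pXn2r _ 2)// ?nnegrE// rho2.
set u := x * cos t + y * sin t.
have urho : `|u| <= rho.
  rewrite -(@ler_pXn2r _ 2)// ?nnegrE// real_normK ?num_real// rho2 /u.
  have cs := cos2Dsin2 t.
  have -> : x ^+ 2 + y ^+ 2 = (x ^+ 2 + y ^+ 2) * (cos t ^+ 2 + sin t ^+ 2).
    by rewrite cs mulr1.
  have : 0 <= (x * sin t - y * cos t) ^+ 2 by exact: sqr_ge0.
  by nra.
move: urho; rewrite ler_norml => /andP[u1 u2].
rewrite -rho2; apply/andP; split; nra.
Qed.

(** The identity [(1 + u) (1 - u) = 1 - u ^ 2], for [u = w e ^ (i t)]; the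
    parameters on the right are those of [- w ^ 2]. *)
Let q_double x y t : q x y t * q x y (t + pi) =
  q (y ^+ 2 - x ^+ 2) (- 2 * (x * y)) (2 * t).
Proof.
rewrite /q cosDpi sinDpi.
have -> : cos (2 * t) = cos t ^+ 2 - sin t ^+ 2.
  by rewrite mulr_natl mulr2n cosD -!expr2.
have -> : sin (2 * t) = 2 * (cos t * sin t).
  by rewrite mulr_natl mulr2n sinD; ring.
have cs : sin t ^+ 2 = 1 - cos t ^+ 2 by have := cos2Dsin2 t; lra.
transitivity ((1 + (x ^+ 2 + y ^+ 2)) ^+ 2 -
   4 * (x ^+ 2 * cos t ^+ 2 + y ^+ 2 * sin t ^+ 2 + 2 * x * y * (cos t * sin t))).
  by ring.
by rewrite cs; ring.
Qed.

(** Let [I(w)] be this mean, for [w = x - i y].  Since [|1 + w e ^ (i t)|] times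
    its value at [t + pi] is [|1 - w ^ 2 e ^ (2 i t)|], one has
    [2 I(w) = I(- w ^ 2)].  As [|I|] is bounded by some [M] on each smaller disc,
    which is stable under squaring, it is bounded by [M / 2 ^ k] for all [k]. *)
Lemma jensen_integral x y : x ^+ 2 + y ^+ 2 < 1 ->
  circle_mean (fun t => ln (q x y t)) = 0.
Proof.
move=> xy1; set s := Num.sqrt (x ^+ 2 + y ^+ 2).
have s0 : 0 <= s by exact: sqrtr_ge0.
have s2 : s ^+ 2 = x ^+ 2 + y ^+ 2 by rewrite sqr_sqrtr// addr_ge0// sqr_ge0.
have s1 : s < 1 by rewrite -(@ltr_pXn2r _ 2)// ?nnegrE// s2 expr1n.
pose M := - 2 * ln (1 - s).
have M0 : 0 <= M.
  rewrite /M mulNr oppr_ge0 mulr_ge0_le0// ln_le0// gerBl//.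
have lnq_cont x' y' : x' ^+ 2 + y' ^+ 2 <= s ^+ 2 ->
    continuous (fun t => ln (q x' y' t)).
  move=> xys; apply: continuous_lnf; first exact: continuous_trig.
  move=> t; have /andP[+ _] := q_bound t s0 s1 xys.
  by apply: lt_le_trans; rewrite exprn_gt0// subr_gt0.
have bound k : forall x' y' : R, x' ^+ 2 + y' ^+ 2 <= s ^+ 2 ->
    `|circle_mean (fun t => ln (q x' y' t))| <= M / 2 ^+ k.
  elim: k => [|k IH] x' y' xys.
    have B t : - M <= ln (q x' y' t) <= M.
      have /andP[q1 q2] := q_bound t s0 s1 xys.
      have s1' : 0 < (1 - s) ^+ 2 by rewrite exprn_gt0// subr_gt0.
      have q0 := lt_le_trans s1' q1.
      have E : ln ((1 - s) ^+ 2) = - M.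
        by rewrite lnXn ?subr_gt0// /M mulNr opprK mulr_natl.
      apply/andP; split; first by rewrite -E ler_ln// posrE.
      rewrite -[M]opprK -E -lnV ?posrE// ler_ln ?posrE ?invr_gt0//.
      apply: (le_trans q2).
      rewrite -[leRHS]mul1r ler_pdivlMr// -exprMn -[leRHS](expr1n _ 2).
      rewrite ler_pXn2r ?nnegrE//; nra.
    have cl := lnq_cont _ _ xys.
    rewrite expr0 divr1 ler_norml -{1}[- M]circle_mean_cst -[X in _ <= _ <= X]circle_mean_cst.
    apply/andP; split; apply: le_circle_mean => //; try (by move=> ?; exact: cst_continuous);
      by move=> t; have /andP[] := B t.
  have xys' : (y' ^+ 2 - x' ^+ 2) ^+ 2 + (- 2 * (x' * y')) ^+ 2 <= s ^+ 2.
    have -> : (y' ^+ 2 - x' ^+ 2) ^+ 2 + (- 2 * (x' * y')) ^+ 2 =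
       (x' ^+ 2 + y' ^+ 2) ^+ 2 by ring.
    rewrite expr2; have := sqr_ge0 x'; have := sqr_ge0 y'.
    move=> ? ?; nra.
  have c1 := lnq_cont _ _ xys; have c2 := lnq_cont _ _ xys'.
  have per x0 y0 t : ln (q x0 y0 (t + 2 * pi)) = ln (q x0 y0 t).
    by rewrite /q !mulr_natl cosD2pi sinD2pi.
  have [p1 _] := circle_mean_periodic c1 (per x' y').
  have [_ p2] := circle_mean_periodic c2 (per _ _).
  have c1' : continuous (fun t : R => ln (q x' y' (t + pi))).
    move=> t; apply: (@continuous_comp _ _ _ (fun t : R => t + pi) (fun t => ln (q x' y' t))); last exact: c1.
    by apply: continuousD => //; exact: cst_continuous.
  have E : 2 * circle_mean (fun t => ln (q x' y' t)) =
      circle_mean (fun t => ln (q (y' ^+ 2 - x' ^+ 2) (- 2 * (x' * y')) t)).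
    rewrite -p2 mulr_natl mulr2n -{2}p1 -circle_meanD//.
    apply: eq_circle_mean => t.
    have qpos t' : 0 < q x' y' t'.
      have /andP[+ _] := q_bound t' s0 s1 xys.
      by apply: lt_le_trans; rewrite exprn_gt0// subr_gt0.
    by rewrite -q_double lnM// posrE.
  have := IH _ _ xys'; rewrite -E normrM gtr0_norm// => H.
  by rewrite exprS invfM mulrCA ler_pdivlMl.
apply/eqP; rewrite -normr_eq0 eq_le normr_ge0 andbT.
apply/ler_addgt0Pl => e e0; rewrite addr0.
have [k Hk] : exists k, M / 2 ^+ k <= e.
  exists (Num.truncn (M / e)).+1.
  rewrite ler_pdivrMr ?exprn_gt0// -ler_pdivrMl// mulrC.
  apply: (le_trans (ltW (truncnS_gt _))).
  by rewrite -natrX ler_nat ltnW// ltn_expl.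
by apply: le_trans Hk; apply: bound; rewrite s2.
Qed.

(** The integrand is the logarithm of [C |1 + w e ^ (i t)| ^ 2], where [|w| < 1]
    and [C] is the larger root of a quadratic polynomial; its mean is thus [ln C].
    The polynomial is not positive at [r ^ 2] and at [b1 ^ 2 + b2 ^ 2], which are
    therefore at most [C].  The term [k] keeps the integrand away from the
    singularity of the logarithm. *)
Lemma le_mean_ln_factor (b1 b2 r k m : R) : 0 < r -> 0 < k -> 0 < m ->
  m <= r ^+ 2 \/ m <= b1 ^+ 2 + b2 ^+ 2 ->
  ln m <= circle_mean (fun t =>
    ln (b1 ^+ 2 + b2 ^+ 2 + r ^+ 2 + k + 2 * (r * b1 * cos t + r * b2 * sin t))).
Proof.
move=> r0 k0 m0 mrb.
set B := b1 ^+ 2 + b2 ^+ 2; have B0 : 0 <= B by rewrite addr_ge0 ?sqr_ge0.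
set A := B + r ^+ 2 + k.
have r20 : 0 < r ^+ 2 by rewrite exprn_gt0.
have A0 : 0 < A by rewrite /A; lra.
set D := A ^+ 2 - 4 * (r ^+ 2 * B).
have D0 : 0 < D.
  have -> : D = (B - r ^+ 2) ^+ 2 + k * (2 * B + 2 * r ^+ 2 + k).
    by rewrite /D /A; ring.
  by rewrite ltr_wpDl ?sqr_ge0// mulr_gt0//; lra.
set S := Num.sqrt D.
have S0 : 0 < S by rewrite sqrtr_gt0.
have S2 : S ^+ 2 = D by rewrite sqr_sqrtr// ltW.
(* The larger root of [C ^ 2 - A C + r ^ 2 B = 0]. *)
set C := (A + S) / 2.
have C0 : 0 < C by rewrite /C; lra.
have CE : C ^+ 2 + r ^+ 2 * B = A * C.
  have : 4 * C ^+ 2 = A ^+ 2 + 2 * A * S + S ^+ 2 by rewrite /C; field.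
  rewrite S2 /D => C2.
  have : 4 * (A * C) = 2 * A ^+ 2 + 2 * A * S by rewrite /C; field.
  lra.
have mC : m <= C.
  have sq z : z ^+ 2 - A * z + r ^+ 2 * B <= 0 -> z <= C.
    move=> zA; rewrite /C -subr_ge0; apply/negP => /negP; rewrite -ltNge => H.
    have : S ^+ 2 < (2 * z - A) ^+ 2 by rewrite ltr_pXn2r ?nnegrE//; lra.
    by rewrite S2 /D; lra.
  case: mrb => /le_trans; apply; apply: sq; rewrite /A; last first.
    have -> : B ^+ 2 - (B + r ^+ 2 + k) * B + r ^+ 2 * B = - (k * B) by ring.
    by rewrite oppr_le0 mulr_ge0// ltW.
  have -> : (r ^+ 2) ^+ 2 - (B + r ^+ 2 + k) * r ^+ 2 + r ^+ 2 * B =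
    - (k * r ^+ 2) by ring.
  by rewrite oppr_le0 mulr_ge0// ltW.
have Cn0 : C != 0 by rewrite gt_eqF.
set x := r * b1 / C; set y := r * b2 / C.
have xyE : x ^+ 2 + y ^+ 2 = r ^+ 2 * B / C ^+ 2 by rewrite /x /y /B; field.
have xy1 : x ^+ 2 + y ^+ 2 < 1.
  rewrite xyE ltr_pdivrMr ?exprn_gt0// mul1r.
  have : A * A < A * (2 * C) by rewrite ltr_pM2l// /C; lra.
  have : 4 * (r ^+ 2 * B) < A ^+ 2 by rewrite -subr_gt0.
  by rewrite expr2; lra.
have AE : A = C * (1 + (x ^+ 2 + y ^+ 2)).
  by apply: (mulIf Cn0); rewrite -CE xyE; field.
have E t : ln (A + 2 * (r * b1 * cos t + r * b2 * sin t)) = ln C + ln (q x y t).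
  have q0 : 0 < q x y t.
    have x0 : 0 <= x ^+ 2 + y ^+ 2 by rewrite addr_ge0 ?sqr_ge0.
    have := @q_bound (Num.sqrt (x ^+ 2 + y ^+ 2)) x y t (sqrtr_ge0 _).
    rewrite -[X in _ < X -> _](@sqrtr1 R) ltr_sqrt ?ltr01// => /(_ xy1).
    rewrite sqr_sqrtr// => /(_ (lexx _)) /andP[+ _].
    apply: lt_le_trans; rewrite exprn_gt0// subr_gt0 -[X in _ < X](@sqrtr1 R).
    by rewrite ltr_sqrt.
  rewrite -lnM ?posrE//; congr ln; rewrite /q [RHS]mulrDr -AE; congr (_ + _).
  by rewrite /x /y; field.
rewrite (eq_circle_mean E) circle_meanD; first last.
- move=> t; apply: continuous_lnf; first exact: continuous_trig.
  move=> t'; have := E t'.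
  have x0 : 0 <= x ^+ 2 + y ^+ 2 by rewrite addr_ge0 ?sqr_ge0.
  have := @q_bound (Num.sqrt (x ^+ 2 + y ^+ 2)) x y t' (sqrtr_ge0 _).
  rewrite -[X in _ < X -> _](@sqrtr1 R) ltr_sqrt ?ltr01// => /(_ xy1).
  rewrite sqr_sqrtr// => /(_ (lexx _)) /andP[+ _] _.
  apply: lt_le_trans; rewrite exprn_gt0// subr_gt0 -[X in _ < X](@sqrtr1 R).
  by rewrite ltr_sqrt.
- by move=> t; exact: cst_continuous.
rewrite circle_mean_cst jensen_integral// addr0.
by rewrite ler_ln ?posrE.
Qed.

End jensen.

(** * Moduli, and Jensen's inequality for products *)
Section complex_modulus.
Context {R : realType}.
Implicit Types z : R[i].

Lemma cabs_ge0 z : 0 <= cabs z.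
Proof. by case: z => x y; exact: sqrtr_ge0. Qed.

Lemma sqr_cabs z : cabs z ^+ 2 = Re z ^+ 2 + Im z ^+ 2.
Proof. by case: z => x y /=; rewrite sqr_sqrtr// addr_ge0 ?sqr_ge0. Qed.

Lemma normr_cabs z : `|z| = (cabs z)%:C%C.
Proof. by rewrite normc_def; case: z. Qed.

Lemma cabs_eq0 z : (cabs z == 0) = (z == 0).
Proof. by apply/eqP/eqP => [/Normc.eq0_normc//|->]; exact: Normc.normc0. Qed.

Lemma cabs_gt0 z : (0 < cabs z) = (z != 0).
Proof. by rewrite lt_neqAle cabs_ge0 andbT eq_sym cabs_eq0. Qed.

Lemma cabsD z z' : cabs (z + z') <= cabs z + cabs z'.
Proof. exact: le_normcD. Qed.

Lemma cabsN z : cabs (- z) = cabs z.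
Proof. exact: normcN. Qed.

Lemma cabsB z z' : cabs (z - z') = cabs (z' - z).
Proof. by rewrite -cabsN opprB. Qed.

Lemma cabsM z z' : cabs (z * z') = cabs z * cabs z'.
Proof. exact: Normc.normcM. Qed.

Lemma cabsX z n : cabs (z ^+ n) = cabs z ^+ n.
Proof.
elim: n => [|n IH]; first by rewrite !expr0 Normc.normc1.
by rewrite !exprS cabsM IH.
Qed.

Lemma cabs_sum (I : Type) (s : seq I) (P : pred I) (F : I -> R[i]) :
  cabs (\sum_(i <- s | P i) F i) <= \sum_(i <- s | P i) cabs (F i).
Proof.
elim/big_ind2 : _ => //; first by rewrite Normc.normc0.
by move=> x x' y y' xx' yy'; apply: (le_trans (cabsD _ _)); exact: lerD.
Qed.

Lemma cabs_prod (I : Type) (s : seq I) (P : pred I) (F : I -> R[i]) :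
  cabs (\prod_(i <- s | P i) F i) = \prod_(i <- s | P i) cabs (F i).
Proof.
elim/big_ind2 : _ => //; first by rewrite Normc.normc1.
by move=> x x' y y' <- <-; rewrite cabsM.
Qed.

Lemma Re_le_cabs z : `|Re z| <= cabs z.
Proof.
rewrite -(@ler_pXn2r _ 2)// ?nnegrE ?cabs_ge0// real_normK ?num_real//.
by rewrite sqr_cabs lerDl sqr_ge0.
Qed.

Lemma Im_le_cabs z : `|Im z| <= cabs z.
Proof.
rewrite -(@ler_pXn2r _ 2)// ?nnegrE ?cabs_ge0// real_normK ?num_real//.
by rewrite sqr_cabs lerDr sqr_ge0.
Qed.

Lemma cabs_le_ReIm z : cabs z <= `|Re z| + `|Im z|.
Proof.
rewrite -(@ler_pXn2r _ 2)// ?nnegrE ?cabs_ge0 ?addr_ge0// sqr_cabs sqrrD.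
by rewrite !real_normK ?num_real// lerD2r lerDl mulrn_wge0// mulr_ge0.
Qed.

Lemma sqr_cabs_circle_point (a z : R[i]) (r t : R) :
  cabs (circle_point a r t - z) ^+ 2 =
  Re (a - z) ^+ 2 + Im (a - z) ^+ 2 + r ^+ 2 +
    2 * (r * Re (a - z) * cos t + r * Im (a - z) * sin t).
Proof.
rewrite sqr_cabs; case: a => a1 a2; case: z => z1 z2 /=.
have := cos2Dsin2 t; set c := cos t; set s := sin t => cs.
apply/eqP; rewrite -subr_eq0; apply/eqP.
rewrite (_ : _ - _ = r ^+ 2 * (c ^+ 2 + s ^+ 2 - 1)); last by ring.
by rewrite cs subrr mulr0.
Qed.

Lemma cabs_real (x : R) : cabs x%:C%C = `|x|.
Proof. by rewrite /= expr0n/= addr0 sqrtr_sqr. Qed.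

Lemma circle_point_bound (a : R[i]) (r t : R) : 0 <= r ->
  cabs (circle_point a r t - a) = r.
Proof.
move=> r0; apply/eqP; rewrite -(@eqrXn2 _ 2)// ?cabs_ge0//.
by rewrite sqr_cabs_circle_point subrr/= !(mulr0, mul0r, expr0n, add0r, addr0).
Qed.

End complex_modulus.

Section jensen_polynomial.
Context {R : realType}.

(** The bound [k0] does not depend on the list [xs], which varies with the point
    of the circle in [jensen_prod]. *)
Lemma prod_perturb (D : R) n : 0 <= D -> forall e, 0 < e ->
  exists2 k0, 0 < k0 & forall k, 0 < k -> k <= k0 ->
  forall xs : seq R, size xs = n -> all (fun x => 0 <= x <= D) xs ->
  \prod_(x <- xs) (x + k) <= \prod_(x <- xs) x + e.
Proof.
move=> D0; elim: n => [|n IH] e e0.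
  by exists 1 => // k _ _ [|//] _ _; rewrite !big_nil lerDl ltW.
have D1 : 0 < D + 1 by rewrite ltr_wpDl.
pose e' := e / (2 * (D + 1)).
have e'0 : 0 < e' by rewrite divr_gt0// mulr_gt0.
have [k0 k00 H] := IH _ e'0.
have Dn : 0 < D ^+ n + e' by rewrite ltr_wpDl// exprn_ge0.
exists (Num.min k0 (e / (2 * (D ^+ n + e')))).
  by rewrite lt_min k00 divr_gt0// mulr_gt0.
move=> k kp; rewrite le_min => /andP[kk0 ke] [//|x xs] [sz] /= /andP[/andP[x0 xD] xsD].
rewrite !big_cons.
have {}H := H k kp kk0 xs sz xsD.
have P0 : 0 <= \prod_(x <- xs) x.
  by rewrite big_seq; apply: prodr_ge0 => y /(allP xsD)/andP[].
have PD : \prod_(x <- xs) x <= D ^+ n.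
  have <- : size xs = n by case: sz.
  elim: (xs) xsD => [|y ys IHy] /=; first by rewrite big_nil expr0.
  move=> /andP[/andP[y0 yD] ysD]; rewrite big_cons exprS ler_pM ?IHy//.
  by rewrite big_seq; apply: prodr_ge0 => w /(allP ysD)/andP[].
apply: (@le_trans _ _ ((x + k) * (\prod_(x <- xs) x + e'))).
  by rewrite ler_wpM2l// addr_ge0// ltW.
set P := \prod_(x <- xs) x in P0 PD *.
rewrite ler_pdivlMr ?mulr_gt0// in ke.
have e'E : e' * (2 * (D + 1)) = e by rewrite /e' mulfVK// gt_eqF// mulr_gt0.
nra.
Qed.

Lemma continuous_sqr_cabs_circle (a z : R[i]) (r : R) :
  continuous (fun t => cabs (circle_point a r t - z) ^+ 2).
Proof.
under eq_fun do rewrite sqr_cabs_circle_point.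
exact: continuous_trig.
Qed.

Lemma continuous_prod_seq (I : Type) (s : seq I) (F : I -> R -> R) :
  (forall i, continuous (F i)) -> continuous (fun t => \prod_(i <- s) F i t).
Proof.
move=> cF; elim: s => [|i s IH].
  by under eq_fun do rewrite big_nil; move=> t; exact: cst_continuous.
by under eq_fun do rewrite big_cons; move=> t; apply: cvgM; [exact: cF|exact: IH].
Qed.

Lemma circle_mean_sum (I : Type) (s : seq I) (F : I -> R -> R) :
  (forall i, continuous (F i)) ->
  continuous (fun t => \sum_(i <- s) F i t) /\
  circle_mean (fun t => \sum_(i <- s) F i t) = \sum_(i <- s) circle_mean (F i).
Proof.
move=> cF; elim: s => [|i s [IH1 IH2]].
  under eq_fun do rewrite big_nil; rewrite big_nil; split.
    by move=> t; exact: cst_continuous.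
  exact: circle_mean_cst.
under eq_fun do rewrite big_cons; rewrite big_cons; split.
  by move=> t; apply: cvgD; [exact: cF|exact: IH1].
by rewrite circle_meanD// IH2.
Qed.

(** The truncation at [d] makes the integrand continuous.  It is compared with the
    product of the [|l - z| ^ 2 + k], which has no zero on the circle and whose
    logarithm has a computable mean, as [k] tends to 0. *)
Lemma jensen_prod (c r d : R) (a : R[i]) (zs : seq R[i]) :
  0 < c -> 0 < r -> 0 < d ->
  ln c + \sum_(z <- zs) ln (Num.max (r ^+ 2) (cabs (a - z) ^+ 2)) <=
  circle_mean (fun t =>
    ln (Num.max (c * \prod_(z <- zs) cabs (circle_point a r t - z) ^+ 2) d)).
Proof.
move=> c0 r0 d0; pose F t := Num.max (c * \prod_(z <- zs) cabs (circle_point a r t - z) ^+ 2) d.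
rewrite -/(F _).
have cF : continuous (fun t => ln (F t)).
  apply: continuous_lnf; last by move=> t; rewrite lt_max d0 orbT.
  move=> t; apply: (@continuous_max _ _ (fun t => c * _) (cst d)).
    apply: cvgM; first exact: cvg_cst.
    by apply: continuous_prod_seq => z; exact: continuous_sqr_cabs_circle.
  exact: cst_continuous.
pose D := \sum_(z <- zs) (r + cabs (a - z)) ^+ 2.
have D0 : 0 <= D by apply: sumr_ge0 => z _; rewrite sqr_ge0.
have xD t : all (fun x => 0 <= x <= D) [seq cabs (circle_point a r t - z) ^+ 2 | z <- zs].
  apply/allP => _ /mapP[z zzs ->]; rewrite sqr_ge0/=.
  rewrite /D (big_rem z)//=; apply: (@le_trans _ _ ((r + cabs (a - z)) ^+ 2)).
    rewrite ler_pXn2r ?nnegrE ?cabs_ge0 ?addr_ge0 ?cabs_ge0 ?(ltW r0)//.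
    have := cabsD (circle_point a r t - a) (a - z).
    by rewrite (circle_point_bound a t (ltW r0)) addrA subrK.
  by rewrite lerDl sumr_ge0// => w _; exact: sqr_ge0.
apply/ler_addgt0Pr => e e0.
have ed0 : 0 < e * d / c by rewrite divr_gt0// mulr_gt0.
have [k k0 Hk] := prod_perturb (size zs) D0 ed0.
have {}Hk t : c * \prod_(z <- zs) (cabs (circle_point a r t - z) ^+ 2 + k) <=
    F t * (1 + e).
  have := Hk k k0 (lexx _) [seq cabs (circle_point a r t - z) ^+ 2 | z <- zs].
  rewrite size_map => /(_ erefl (xD t)); rewrite !big_map => H.
  rewrite -(ler_pM2l c0) in H; apply: (le_trans H); rewrite mulrDr.
  rewrite mulrC [c * (_ / _)]mulrC mulfVK ?gt_eqF// mulrC [leRHS]mulrDr mulr1.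
  rewrite lerD ?le_max ?lexx// mulrC ler_pM2r// /F le_max lexx orbT//.
pose G z t := ln (cabs (circle_point a r t - z) ^+ 2 + k).
have cG z : continuous (G z).
  apply: continuous_lnf; last by move=> t; rewrite ltr_wpDl ?sqr_ge0.
  move=> t; apply: cvgD; last exact: cvg_cst.
  exact: continuous_sqr_cabs_circle.
have [cS mS] := circle_mean_sum zs cG.
apply: (@le_trans _ _ (ln c + circle_mean (fun t => \sum_(z <- zs) G z t))).
  rewrite lerD2l mS ler_sum// => z _; rewrite /G.
  have -> : (fun t => ln (cabs (circle_point a r t - z) ^+ 2 + k)) =
    (fun t => ln (Re (a - z) ^+ 2 + Im (a - z) ^+ 2 + r ^+ 2 + k +
      2 * (r * Re (a - z) * cos t + r * Im (a - z) * sin t))).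
    by apply/funext => t; rewrite sqr_cabs_circle_point addrAC.
  apply: le_mean_ln_factor => //; first by rewrite lt_max exprn_gt0.
  by rewrite -sqr_cabs; case: (leP (r ^+ 2)) => _; [right|left].
rewrite -[X in X + _](@circle_mean_cst R) -[X in _ <= _ + X](@circle_mean_cst R).
have cc (x : R) : continuous (cst x : R -> R) by move=> t; exact: cst_continuous.
rewrite -!circle_meanD//; apply: le_circle_mean.
- by move=> t; apply: cvgD; [exact: cvg_cst|exact: cS].
- by move=> t; apply: cvgD; [exact: cF|exact: cvg_cst].
move=> t /=.
have F0 : 0 < F t by rewrite lt_max d0 orbT.
have pk z : 0 < cabs (circle_point a r t - z) ^+ 2 + k by rewrite ltr_wpDl ?sqr_ge0.
apply: (@le_trans _ _ (ln (F t * (1 + e)))); last first.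
  rewrite lnM ?posrE ?addr_gt0// lerD2l le_ln1Dx//.
  by rewrite (lt_trans _ e0)// oppr_lt0.
apply: (@le_trans _ _ (ln (c * \prod_(z <- zs) (cabs (circle_point a r t - z) ^+ 2 + k)))).
  rewrite lnM ?posrE//; last by apply: prodr_gt0.
  rewrite lerD2l; elim: (zs) => [|z s IH]; first by rewrite !big_nil ln1.
  by rewrite !big_cons lnM ?posrE ?prodr_gt0// lerD2l.
by rewrite ler_ln ?posrE// ?mulr_gt0 ?addr_gt0 ?prodr_gt0.
Qed.

End jensen_polynomial.

(** * Polynomials in one variable *)
Section polynomial_modulus.
Context {R : realType}.
Implicit Types q : {poly R[i]}.

Lemma cabs_factor q : q != 0 -> exists2 zs : seq R[i],
  (size zs).+1 = size q &
  forall l, cabs q.[l] ^+ 2 =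
    cabs (lead_coef q) ^+ 2 * \prod_(z <- zs) cabs (l - z) ^+ 2.
Proof.
move=> q0; have [zs qE] := closed_field_poly_normal q.
exists zs.
  rewrite [in RHS]qE size_scale ?lead_coef_eq0// size_prod_XsubC//.
move=> l; rewrite {1}qE hornerZ cabsM exprMn; congr (_ * _).
rewrite horner_prod cabs_prod -prodrXl; apply: eq_bigr => z _.
by rewrite !hornerE.
Qed.

Lemma continuous_trunc_circle q (a : R[i]) (r d : R) : 0 < d ->
  continuous (fun t => ln (Num.max d (cabs q.[circle_point a r t]))).
Proof.
move=> d0; apply: continuous_lnf; last by move=> t; rewrite lt_max d0.
have cq : continuous (fun t => cabs q.[circle_point a r t] ^+ 2).
  have [->|q0] := eqVneq q 0.
    by under eq_fun do rewrite horner0 Normc.normc0; move=> t; exact: cst_continuous.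
  have [zs _ E] := cabs_factor q0.
  under eq_fun do rewrite E.
  move=> t; apply: cvgM; first exact: cvg_cst.
  by apply: continuous_prod_seq => z; exact: continuous_sqr_cabs_circle.
move=> t; apply: (@continuous_max _ _ (cst d) (fun t => cabs q.[circle_point a r t])); first exact: cst_continuous.
have -> : (fun t => cabs q.[circle_point a r t]) =
    (fun t => Num.sqrt (cabs q.[circle_point a r t] ^+ 2)).
  by apply/funext => s; rewrite sqrtr_sqr ger0_norm ?cabs_ge0.
apply: (@continuous_comp _ _ _ (fun t => cabs q.[circle_point a r t] ^+ 2) Num.sqrt); first exact: cq.
exact: sqrt_continuous.
Qed.

(** The factorisation is part of the conclusion because the same roots are
    compared with [q.[a]] in [trunc_submean] and with [q.[l]] in [poly_growth]. *)
Lemma poly_jensen q (a : R[i]) (r d : R) : q != 0 -> 0 < r -> 0 < d ->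
  exists2 zs : seq R[i], (size zs).+1 = size q &
  (forall l, cabs q.[l] ^+ 2 =
    cabs (lead_coef q) ^+ 2 * \prod_(z <- zs) cabs (l - z) ^+ 2) /\
  ln (cabs (lead_coef q) ^+ 2 *
      \prod_(z <- zs) Num.max (r ^+ 2) (cabs (a - z) ^+ 2)) <=
  2 * circle_mean (fun t => ln (Num.max d (cabs q.[circle_point a r t]))).
Proof.
move=> q0 r0 d0; have [zs zsq E] := cabs_factor q0.
exists zs => //; split=> //.
have c0 : 0 < cabs (lead_coef q) ^+ 2.
  by rewrite exprn_gt0// cabs_gt0 lead_coef_eq0.
have d20 : 0 < d ^+ 2 by rewrite exprn_gt0.
have := jensen_prod a zs c0 r0 d20.
have -> : ln (cabs (lead_coef q) ^+ 2) +
    \sum_(z <- zs) ln (Num.max (r ^+ 2) (cabs (a - z) ^+ 2)) =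
    ln (cabs (lead_coef q) ^+ 2 *
      \prod_(z <- zs) Num.max (r ^+ 2) (cabs (a - z) ^+ 2)).
  have mx z : 0 < Num.max (r ^+ 2) (cabs (a - z) ^+ 2) by rewrite lt_max exprn_gt0.
  rewrite [RHS]lnM ?posrE ?prodr_gt0//; congr (_ + _).
  elim: (zs) => [|z s IH]; first by rewrite !big_nil ln1.
  by rewrite !big_cons [RHS]lnM ?posrE ?prodr_gt0// IH.
move=> /le_trans; apply.
have cT := @continuous_trunc_circle q a r _ d0.
rewrite mulr_natl mulr2n -circle_meanD// le_eqVlt; apply/orP; left; apply/eqP.
apply: eq_circle_mean => t; rewrite -E.
have m0 : 0 < Num.max d (cabs q.[circle_point a r t]) by rewrite lt_max d0.
rewrite -lnM ?posrE// -expr2; congr ln.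
rewrite [in RHS]maxC; case: (leP (cabs q.[circle_point a r t]) d) => h.
  by rewrite max_r// ler_pXn2r ?nnegrE ?cabs_ge0 ?(ltW d0).
by rewrite max_l// ler_pXn2r ?nnegrE ?cabs_ge0 ?(ltW d0) ?(ltW h).
Qed.

(** Only the case [d < |q.[a]|] is not obvious; there it follows from Jensen's
    inequality, since each [|a - z|] is at most [max r |a - z|]. *)
Lemma trunc_submean q (a : R[i]) (r d : R) : 0 < r -> 0 < d ->
  ln (Num.max d (cabs q.[a])) <=
  circle_mean (fun t => ln (Num.max d (cabs q.[circle_point a r t]))).
Proof.
move=> r0 d0; have cT := @continuous_trunc_circle q a r _ d0.
have [h|h] := leP (cabs q.[a]) d.
  rewrite -[leLHS]circle_mean_cst; apply: le_circle_mean => //.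
    by move=> t; exact: cst_continuous.
  by move=> t; rewrite ler_ln ?posrE ?le_max ?lexx ?lt_max ?d0.

have qa0 : 0 < cabs q.[a] by exact: lt_trans h.
have q0 : q != 0.
  by apply: contraTN qa0 => /eqP ->; rewrite horner0 Normc.normc0 ltxx.
have [zs _ [E H]] := poly_jensen a q0 r0 d0.
rewrite -(ler_pM2l (_ : 0 < 2))//; apply: le_trans H.
rewrite mulr_natl -lnXn// ler_ln ?posrE ?exprn_gt0//.
- rewrite E ler_wpM2l ?sqr_ge0//; apply: ler_prod => z _.
  by rewrite sqr_ge0 le_max lexx orbT.
- rewrite mulr_gt0 ?exprn_gt0 ?cabs_gt0 ?lead_coef_eq0// prodr_gt0// => z _.
  by rewrite lt_max exprn_gt0.
Qed.

(** By Jensen's inequality on the unit circle, [M] bounds the product of the moduli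
    of the leading coefficient and of the [max 1 |z|], for [z] ranging over the
    roots; and [|l - z|] is at most [(1 + |l|) * max 1 |z|]. *)
Lemma poly_growth q n (M : R) (l : R[i]) : (size q <= n.+1)%N -> 0 < M ->
  (forall x, cabs x = 1 -> cabs q.[x] <= M) ->
  cabs q.[l] <= M * (1 + cabs l) ^+ n.
Proof.
move=> qn M0 qM.
have l1 : 1 <= 1 + cabs l by rewrite lerDl cabs_ge0.
have [->|q0] := eqVneq q 0.
  by rewrite horner0 Normc.normc0 mulr_ge0 ?(ltW M0)// exprn_ge0// (le_trans _ l1).
have [zs zsq [E H]] := poly_jensen 0 q0 ltr01 M0.
set c := cabs (lead_coef q) ^+ 2 in E H.
have c0 : 0 < c by rewrite exprn_gt0// cabs_gt0 lead_coef_eq0.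
set Pi := \prod_(z <- zs) _ in H.
have Pi0 : 0 < Pi by apply: prodr_gt0 => z _; rewrite lt_max expr1n ltr01.
have {}H : c * Pi <= M ^+ 2.
  rewrite -ler_ln ?posrE ?(mulr_gt0 c0 Pi0) ?(exprn_gt0 2 M0)//.
  apply: (le_trans H).
  rewrite lnXn// -[leRHS]mulr_natl ler_pM2l// -[leRHS]circle_mean_cst.
  apply: le_circle_mean; first exact: continuous_trunc_circle.
    by move=> t; exact: cst_continuous.
  move=> t; rewrite ler_ln ?posrE ?lt_max ?M0// ge_max lexx/=.
  apply: qM.
  by have := circle_point_bound (0 : R[i]) t (@ler01 R); rewrite subr0.
rewrite -(@ler_pXn2r _ 2)// ?nnegrE ?cabs_ge0//; last first.
  by rewrite mulr_ge0 ?(ltW M0)// exprn_ge0// (le_trans _ l1).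
rewrite E exprMn.
have H2 : \prod_(z <- zs) cabs (l - z) ^+ 2 <= Pi * ((1 + cabs l) ^+ 2) ^+ size zs.
  rewrite /Pi; elim: (zs) => [|z s IH]; first by rewrite !big_nil mulr1.
  have -> : ((1 + cabs l) ^+ 2) ^+ size (z :: s) =
    (1 + cabs l) ^+ 2 * ((1 + cabs l) ^+ 2) ^+ size s by exact: exprS.
  rewrite !big_cons mulrACA ler_pM ?sqr_ge0//.
    by apply: prodr_ge0 => w _; exact: sqr_ge0.
  have lz : cabs (l - z) <= cabs l + cabs z by rewrite -(cabsN z) cabsD.
  have z0 := cabs_ge0 z; have l0 := cabs_ge0 l.
  rewrite sub0r cabsN expr1n.
  case: (leP 1 (cabs z ^+ 2)) => z1.
    have z1' : 1 <= cabs z by rewrite -(@ler_pXn2r _ 2)// ?nnegrE// expr1n.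
    rewrite -exprMn ler_pXn2r ?nnegrE ?cabs_ge0 ?mulr_ge0 ?addr_ge0//; nra.
  have z1' : cabs z < 1 by rewrite -(@ltr_pXn2r _ 2)// ?nnegrE// expr1n.
  rewrite mul1r ler_pXn2r ?nnegrE ?cabs_ge0 ?addr_ge0//; lra.
apply: (@le_trans _ _ (c * Pi * ((1 + cabs l) ^+ 2) ^+ size zs)).
  by rewrite -mulrA ler_pM2l.
apply: ler_pM => //.
- by rewrite mulr_ge0// ltW.
- by rewrite !exprn_ge0// (le_trans _ l1).
rewrite exprAC ler_pXn2r ?nnegrE ?exprn_ge0 ?(le_trans _ l1)//.
by rewrite ler_weXn2l// -ltnS zsq.
Qed.

End polynomial_modulus.

(** * Topology of C^d and polynomials on complex lines *)
Section topology_Cd.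
Context {R : realType}.

Lemma ltc_cabs (z : R[i]) (r : R) : (`|z| < r%:C%C) = (cabs z < r).
Proof. by rewrite normr_cabs ltcR. Qed.

Lemma nbhs_C (x : R[i]) (P : set R[i]) :
  nbhs x P <-> exists2 rho : R, 0 < rho &
    forall y, cabs (y - x) < rho -> P y.
Proof.
split=> [/nbhs_ballP[e /= e0 eP]|[rho rho0 rhoP]].
  have eE : e = (complex.Re e)%:C%C.
    by move: e0; case: e {eP} => e1 e2; rewrite ltcE/= => /andP[/eqP -> _].
  move: e0; rewrite eE ltcR => e0; exists (complex.Re e) => // y yx; apply: eP.
  by rewrite -ball_normE/= eE distrC ltc_cabs.
apply/nbhs_ballP; exists rho%:C%C => /=; first by rewrite ltcR.
by move=> y; rewrite -ball_normE/= distrC ltc_cabs; exact: rhoP.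
Qed.

Lemma nbhs_Cd d (x : 'rV[R[i]]_d) (P : set 'rV[R[i]]_d) :
  nbhs x P <-> exists2 rho : R, 0 < rho &
    forall y : 'rV_d, (forall i, cabs (y ord0 i - x ord0 i) < rho) -> P y.
Proof.
split=> [/nbhs_ballP[e /= e0 eP]|[rho rho0 rhoP]].
  have eE : e = (complex.Re e)%:C%C.
    by move: e0; case: e {eP} => e1 e2; rewrite ltcE/= => /andP[/eqP -> _].
  have e0' := e0; move: e0'; rewrite eE ltcR => e0'.
  exists (complex.Re e) => // y yx; apply: eP; split=> // i j.
  by rewrite -ball_normE/= eE distrC ltc_cabs (ord1 i).
apply/nbhs_ballP; exists rho%:C%C => /=; first by rewrite ltcR.
move=> y [_ yx]; apply: rhoP => i.
by have := yx ord0 i; rewrite -ball_normE/= distrC ltc_cabs.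
Qed.

Lemma continuous_cabs : continuous (fun z : R[i] => cabs z).
Proof.
move=> z P /nbhs_ballP[e /= e0 eP]; apply/nbhs_C; exists e => // y yz.
apply: eP; rewrite -ball_normE/= distrC.
apply: le_lt_trans yz.
have h1 := cabsD (y - z) z; rewrite subrK in h1.
have h2 := cabsD (z - y) y; rewrite subrK (cabsB z y) in h2.
by rewrite ler_norml; lra.
Qed.

Lemma continuous_coord d (i : 'I_d) :
  continuous (fun z : 'rV[R[i]]_d => z ord0 i).
Proof.
move=> z P /nbhs_C[rho rho0 rhoP]; apply/nbhs_Cd; exists rho => // y yz.
exact: rhoP.
Qed.

Lemma continuous_line d (a b : 'rV[R[i]]_d) :
  continuous (fun l : R[i] => a + l *: b).
Proof.
move=> l P /nbhs_Cd[rho rho0 rhoP]; apply/nbhs_C.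
pose M := 1 + \sum_(i < d) cabs (b ord0 i).
have bM i : cabs (b ord0 i) <= M.
  rewrite /M (bigD1 i)//= addrCA lerDl addr_ge0// sumr_ge0// => j _.
  exact: cabs_ge0.
have M0 : 0 < M by rewrite ltr_pwDl// sumr_ge0// => j _; exact: cabs_ge0.
exists (rho / M); first by rewrite divr_gt0.
move=> y; rewrite ltr_pdivlMr// => yl; apply: rhoP => i.
rewrite !mxE opprD addrACA subrr add0r -mulrBl cabsM.
by apply: le_lt_trans yl; rewrite ler_wpM2l ?cabs_ge0.
Qed.

Lemma continuous_addC (T : topologicalType) (f g : T -> R[i]) :
  continuous f -> continuous g -> continuous (fun z => f z + g z).
Proof. by move=> cf cg z; apply: (@cvgD R[i] R[i]); [exact: cf|exact: cg]. Qed.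

Lemma continuous_mulC (T : topologicalType) (f g : T -> R[i]) :
  continuous f -> continuous g -> continuous (fun z => f z * g z).
Proof. by move=> cf cg z; apply: (@cvgM R[i]); [exact: cf|exact: cg]. Qed.

Lemma continuous_sumC (T : topologicalType) (I : Type) (s : seq I)
  (F : I -> T -> R[i]) : (forall i, continuous (F i)) ->
  continuous (fun z => \sum_(i <- s) F i z).
Proof.
move=> cF; elim: s => [|i s IH].
  by under eq_fun do rewrite big_nil; move=> z; exact: cst_continuous.
under eq_fun do rewrite big_cons; exact: (continuous_addC (cF i) IH).
Qed.

Lemma continuous_prodC (T : topologicalType) (I : Type) (s : seq I)
  (F : I -> T -> R[i]) : (forall i, continuous (F i)) ->
  continuous (fun z => \prod_(i <- s) F i z).
Proof.
move=> cF; elim: s => [|i s IH].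
  by under eq_fun do rewrite big_nil; move=> z; exact: cst_continuous.
under eq_fun do rewrite big_cons; exact: (continuous_mulC (cF i) IH).
Qed.

Lemma continuous_expC (T : topologicalType) (f : T -> R[i]) n :
  continuous f -> continuous (fun z => f z ^+ n).
Proof.
move=> cf; elim: n => [|n IH].
  by under eq_fun do rewrite expr0; move=> z; exact: cst_continuous.
under eq_fun do rewrite exprS; exact: (continuous_mulC cf IH).
Qed.

Lemma continuous_peval d (q : mpoly d R[i]) : continuous (peval q).
Proof.
have -> : peval q = fun z : 'rV[R[i]]_d =>
    \sum_(m <- msupp q) (mcoeff m q : R[i]) * \prod_(i < d) z ord0 i ^+ m i.
  by apply/funext => z; rewrite /peval mevalE.
have cp m : continuous (fun z : 'rV[R[i]]_d => \prod_(i < d) z ord0 i ^+ m i).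
  by apply: continuous_prodC => i; exact: (continuous_expC (@continuous_coord d i)).
have cm (m : multinom d) : continuous (fun z : 'rV[R[i]]_d => (mcoeff m q : R[i]) * \prod_(i < d) z ord0 i ^+ m i).
  apply: (continuous_mulC _ (cp m)) => z; exact: cst_continuous.
exact: (continuous_sumC cm).
Qed.

Lemma continuous_trunc d (q : mpoly d R[i]) (e : R) : 0 < e ->
  continuous (fun z => ln (Num.max e (cabs (peval q z)))).
Proof.
move=> e0 z; apply: (@continuous_comp _ _ R^o (fun z => Num.max e (cabs (peval q z))) (@ln R)).
  apply: (@continuous_max _ _ (cst e) (fun z => cabs (peval q z))).
    exact: cst_continuous.
  apply: (@continuous_comp _ _ _ (peval q) (fun z => cabs z)).
    exact: continuous_peval.
  exact: continuous_cabs.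
by apply: continuous_ln; rewrite lt_max e0.
Qed.

End topology_Cd.

Section polynomials_on_lines.
Context {R : realType}.

(** Facts about several variables are reduced to one variable by restriction to
    complex lines. *)
Lemma line_poly d (q : mpoly d R[i]) (a b : 'rV[R[i]]_d) :
  exists2 Q : {poly R[i]}, (size Q <= msize q)%N &
    forall l, Q.[l] = peval q (a + l *: b).
Proof.
pose F i : {poly R[i]} := (a ord0 i)%:P + (b ord0 i)%:P * 'X.
exists (\sum_(m <- msupp q) (mcoeff m q)%:P * \prod_(i < d) F i ^+ m i).
  rewrite big_seq; apply: (leq_trans (size_sum _ _ _)).
  apply/bigmax_leqP_seq => m mq _.
  apply: leq_trans (msize_mdeg_lt mq).
  apply: (leq_trans (size_polyMleq _ _)).
  have c0 : mcoeff m q != 0 by rewrite -mcoeff_msupp.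
  rewrite size_polyC c0 add1n /= mdegE.
  elim/big_ind2 : _ => [|x k y k' xk yk|i _]; first by rewrite size_poly1.
  - apply: (leq_trans (size_polyMleq _ _)).
    by move: xk yk; clear; move: (size k) (size k') => u v; lia.
  - apply: (leq_trans (size_poly_exp_leq _ _)); rewrite ltnS.
    have : (size (F i) <= 2)%N.
      apply: (leq_trans (size_polyD _ _)); rewrite geq_max.
      rewrite (leq_trans (size_polyC_leq1 _))//=.
      apply: (leq_trans (size_polyMleq _ _)); rewrite size_polyX.
      by have := size_polyC_leq1 (b ord0 i); lia.
    by case: (size _) => [|[|[|]]]//= _; rewrite ?mul1n.
move=> l; rewrite /peval mevalE horner_sum; apply: eq_bigr => m _.
rewrite hornerM hornerC horner_prod; congr (_ * _); apply: eq_bigr => i _.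
by rewrite horner_exp /F !hornerE !mxE [l * _]mulrC.
Qed.

Lemma peval_growth d (q : mpoly d R[i]) n : (msize q <= n.+1)%N ->
  exists2 C : R, 0 < C & forall z, 1 <= enorm z ->
    cabs (peval q z) <= C * enorm z ^+ n.
Proof.
move=> qn; exists (1 + \sum_(m <- msupp q) cabs (mcoeff m q)).
  by rewrite ltr_pwDl// sumr_ge0// => m _; exact: cabs_ge0.
move=> z z1; rewrite mulrDl mul1r -[leLHS]add0r lerD//.
  by rewrite exprn_ge0// (le_trans _ z1).
rewrite /peval mevalE (le_trans (cabs_sum _ _ _))// mulr_suml.
rewrite big_seq [leRHS]big_seq; apply: ler_sum => m mq.
rewrite cabsM ler_wpM2l ?cabs_ge0// cabs_prod.
apply: (@le_trans _ _ (enorm z ^+ mdeg m)).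
  rewrite mdegE expr_sum.
  apply: ler_prod => i _; rewrite cabs_ge0/= cabsX.
  rewrite lerXn2r ?nnegrE ?cabs_ge0 ?sqrtr_ge0//.
  rewrite -(@ler_pXn2r _ 2)// ?nnegrE ?cabs_ge0 ?sqrtr_ge0//.
  rewrite /enorm sqr_sqrtr; last by apply: sumr_ge0 => j _; rewrite sqr_ge0.
  by rewrite (bigD1 i)//= lerDl sumr_ge0// => j _; rewrite sqr_ge0.
by rewrite ler_weXn2l// -ltnS (leq_trans (msize_mdeg_lt mq)).
Qed.

End polynomials_on_lines.

(** * The extremal function of a regular set *)
Section extremal.
Context {R : realType}.

Definition log_plus d n (q : mpoly d R[i]) (z : 'rV[R[i]]_d) : R :=
  n%:R^-1 * ln (Num.max 1 (cabs (peval q z))).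

Lemma continuous_usc (T : topologicalType) (f : T -> R) : continuous f ->
  upper_semicontinuous (fun z => (f z)%:E).
Proof.
move=> cf x a; rewrite -EFinN lte_fin => ax.
exists [set y | a < - f y]; last by move=> y /=; rewrite lte_fin.
have : f y @[y --> x] --> f x by exact: cf.
move=> /(_ [set u | a < - u]); apply.
have : nbhs (f x) [set u | u < - a].
  by apply: open_nbhs_nbhs; split; [exact: open_lt|rewrite /= ltrNr].
by apply: filterS => u /=; rewrite ltrNr.
Qed.

Lemma continuous_scaleR (T : topologicalType) (c : R) (f : T -> R) :
  continuous f -> continuous (fun z => c * f z).
Proof. by move=> cf z; apply: (@cvgM R); [exact: cvg_cst|exact: cf]. Qed.

Lemma continuous_log_plus d n (q : mpoly d R[i]) : continuous (log_plus n q).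
Proof.
have h := @continuous_trunc R d q 1 ltr01.
exact: (@continuous_scaleR _ n%:R^-1 (fun z => ln (Num.max 1 (cabs (peval q z)))) h).
Qed.

Lemma log_plus_ge0 d n (q : mpoly d R[i]) z : 0 <= log_plus n q z.
Proof. by rewrite mulr_ge0 ?invr_ge0// ln_ge0// le_max lexx. Qed.

(** The mean value inequality along complex lines comes from [trunc_submean]. *)
Lemma lelong_log_plus d n (q : mpoly d R[i]) : (0 < n)%N ->
  (msize q <= n.+1)%N -> lelong_class (fun z => (log_plus n q z)%:E).
Proof.
move=> n0 qn.
have n0' : 0 < n%:R^-1 :> R by rewrite invr_gt0 ltr0n.
split.
  split.
  - exact/continuous_usc/continuous_log_plus.
  - by move=> z; rewrite ltry.
  move=> a b; split.
  - have cl : continuous (fun l : R[i] => log_plus n q (a + l *: b)).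
      move=> l; apply: (@continuous_comp _ _ _ (fun l : R[i] => a + l *: b) (log_plus n q)).
        exact: continuous_line.
      exact: continuous_log_plus.
    exact: continuous_usc cl.
  - by move=> z; rewrite ltry.
  move=> c r r0; have [Q _ QE] := line_poly q a b.
  have E l : log_plus n q (a + l *: b) = n%:R^-1 * ln (Num.max 1 (cabs Q.[l])).
    by rewrite /log_plus QE.
  have cQ := @continuous_trunc_circle _ Q c r 1 ltr01.
  under eq_integral do rewrite E.
  rewrite circle_meanE; last exact: continuous_scaleR.
  rewrite lee_fin E /circle_mean RintegralZl//=; last exact: continuous_integrable.
  by rewrite mulrCA ler_pM2l//; exact: trunc_submean.
have [C C0 qC] := peval_growth qn.
exists 1, (n%:R^-1 * `|ln C|) => z z1; rewrite lee_fin.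
have z0 : 0 < enorm z by exact: lt_le_trans z1.
have -> : ln (enorm z) = n%:R^-1 * ln (enorm z ^+ n).
  by rewrite lnXn// mulrnAr -mulrnAl -[n%:R^-1 *+ n]mulr_natr mulVf ?mul1r// pnatr_eq0 -lt0n.
rewrite -mulrDr ler_pM2l//.
have zn1 : 1 <= enorm z ^+ n by exact: exprn_ege1.
have lz0 : 0 <= ln (enorm z ^+ n) by exact: ln_ge0.
have [h|h] := leP (cabs (peval q z)) 1.
  by rewrite ln1 addr_ge0.
apply: (@le_trans _ _ (ln (C * enorm z ^+ n))).
  by rewrite ler_ln ?posrE ?(lt_trans ltr01 h) ?mulr_gt0 ?exprn_gt0// qC.
rewrite lnM ?posrE ?exprn_gt0// addrC lerD2l; exact: ler_norm.
Qed.

Lemma log_plus_le_extremal d (K : set 'rV[R[i]]_d) n q z : (0 < n)%N ->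
  (msize q <= n.+1)%N -> (supnorm K q <= 1)%E ->
  ((log_plus n q z)%:E <= extremal_function K z)%E.
Proof.
move=> n0 qn qK; apply: ereal_sup_ubound; exists (fun z => (log_plus n q z)%:E) => //.
split; first exact: lelong_log_plus.
move=> x Kx; rewrite lee_fin /log_plus max_l ?ln1 ?mulr0//.
rewrite -lee_fin; apply: le_trans qK; apply: ereal_sup_ubound.
by exists x.
Qed.

Lemma supnorm1 d (K : set 'rV[R[i]]_d) : (supnorm K (1%R : mpoly d R[i]) <= 1)%E.
Proof.
by apply: ge_ereal_sup => _ [x _ <-]; rewrite lee_fin /peval meval1 Normc.normc1.
Qed.

Lemma extremal_ge0 d (K : set 'rV[R[i]]_d) z : (0 <= extremal_function K z)%E.
Proof.
have := @log_plus_le_extremal d K 1 (1 : mpoly d R[i]) z isT _ (supnorm1 K).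
rewrite msize1 => /(_ isT); apply: le_trans.
by rewrite lee_fin log_plus_ge0.
Qed.

Lemma extremal_le0 d (K : set 'rV[R[i]]_d) z : K z -> (extremal_function K z <= 0)%E.
Proof. by move=> Kz; apply: ge_ereal_sup => _ [u [_ uK] <-]; exact: uK. Qed.

Lemma regular_nonempty d (K : set 'rV[R[i]]_d) : ~ pluripolar K -> exists x, K x.
Proof.
move=> nK; apply: contrapT => K0; apply: nK.
have m1 : (msize (1 : mpoly d R[i]) <= 2)%N by rewrite msize1.
have [lel _] := lelong_log_plus (isT : 0 < 1)%N m1.
exists (fun z => (log_plus 1 1 z)%:E); split=> //; first by exists 0.
by move=> z Kz; exfalso; apply: K0; exists z.
Qed.

Lemma dense_nbhs (T : topologicalType) (S : set T) (x : T) (P : set T) :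
  dense S -> nbhs x P -> exists2 y, S y & P y.
Proof.
rewrite nbhsE => dS [U [oU Ux] UP].
have [y [Uy Sy]] := dS U (ex_intro _ x Ux) oU.
by exists y => //; exact: UP.
Qed.

Lemma poly_dim_le d n : (poly_dim d n <= n.+1 ^ d)%N.
Proof.
rewrite /poly_dim -[X in (_ <= X ^ _)%N]card_ord -[X in (_ <= _ ^ X)%N]card_ord -card_ffun.
pose f (m : bmultinom d n.+1) : {ffun 'I_d -> 'I_n.+1} := [ffun i => inord (bmnm m i)].
apply: (@leq_card _ _ f) => m m' mm'; apply/val_inj/mnmP => i.
have b (k : bmultinom d n.+1) : (bmnm k i < n.+1)%N.
  by apply: leq_ltn_trans (bmdeg k); rewrite mdegE (bigD1 i)//= leq_addr.
have := congr1 (fun g : {ffun 'I_d -> 'I_n.+1} => (g i : nat)) mm'.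
by rewrite !ffunE !inordK// b.
Qed.

(** Near a point of [K] the extremal function is at most 1, hence polynomials
    of degree [n] bounded by 1 on [K] are there at most [e ^ n], and they grow
    at most geometrically with [n] at any other point. *)
Lemma poly_geometric_bound d (K : set 'rV[R[i]]_d) :
  regular_set K -> exists2 F : 'rV[R[i]]_d -> R,
    (exists (x0 : 'rV[R[i]]_d) (c : R), [/\ 0 < c & forall z, F z = expR 1 * (1 + c * (1 + \sum_(i < d) cabs (z ord0 i - x0 ord0 i)))]) &
    forall n q z, (0 < n)%N -> (msize q <= n.+1)%N -> (supnorm K q <= 1)%E ->
      cabs (peval q z) <= F z ^+ n.
Proof.
move=> [nK cV]; have [x Kx] := regular_nonempty nK.
have : nbhs (extremal_function K x) [set y : \bar R | (y < 1)%E].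
  by apply: open_nbhs_nbhs; split; [exact: open_ereal_lt_ereal|rewrite /= (le_lt_trans (extremal_le0 Kx))// lte01].
move=> /cV /nbhs_Cd[rho rho0 rhoV].
pose D (z : 'rV[R[i]]_d) := 1 + \sum_(i < d) cabs (z ord0 i - x ord0 i).
have D1 z : 1 <= D z by rewrite lerDl sumr_ge0// => i _; exact: cabs_ge0.
have c0 : 0 < 2 / rho by rewrite divr_gt0.
exists (fun z => expR 1 * (1 + 2 / rho * D z)); first by exists x, (2 / rho).
move=> n q z n0 qn qK.
have D0 : 0 < D z by exact: lt_le_trans (D1 z).
pose t : R := rho / (2 * D z).
have t0 : 0 < t by rewrite divr_gt0// mulr_gt0.
have [Q Qn QE] := line_poly q x ((t%:C%C : R[i]) *: (z - x)).
have QM l : cabs l = 1 -> cabs Q.[l] <= expR 1 ^+ n.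
  move=> l1; rewrite QE; set y := x + _.
  have /ltW yV : (extremal_function K y < 1)%E.
    apply: rhoV => i.
    have -> : y ord0 i - x ord0 i = l * (t%:C%C * (z ord0 i - x ord0 i)).
      by rewrite /y !mxE; ring.
    rewrite cabsM l1 mul1r cabsM.
    rewrite cabs_real gtr0_norm// /t.
    apply: (@le_lt_trans _ _ (rho / (2 * D z) * D z)).
      rewrite ler_wpM2l ?(ltW t0)// /D (bigD1 i)//= addrCA lerDl addr_ge0//.
      by rewrite sumr_ge0// => j _; exact: cabs_ge0.
    rewrite invfM mulrA mulfVK ?gt_eqF// ltr_pdivrMr// ltr_pMr//.
    by rewrite ltr1n.
  have := le_trans (log_plus_le_extremal y n0 qn qK) yV.
  rewrite lee_fin /log_plus ler_pdivrMl ?ltr0n// mulr1 => h.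
  apply: (@le_trans _ _ (Num.max 1 (cabs (peval q y)))); first by rewrite le_max lexx orbT.
  by rewrite -expRM_natl mulr1 -ler_ln ?posrE ?expR_gt0 ?lt_max ?ltr01// expRK.
have e0 : 0 < expR 1 ^+ n :> R by rewrite exprn_gt0// expR_gt0.
have := poly_growth (t^-1)%:C%C (leq_trans Qn qn) e0 QM.
rewrite QE scalerA -rmorphM mulVf ?gt_eqF// rmorph1 scale1r addrC subrK.
rewrite cabs_real gtr0_norm ?invr_gt0// -exprMn => /le_trans; apply.
by rewrite /t invf_div mulrAC.
Qed.

(** The convergence at the points [w r] and the geometric growth of the basis
    bound the extremal function at these points, locally uniformly; by density
    and continuity it is finite at every point. *)
Lemma regular_extremal_finite d (K : set 'rV[R[i]]_d)
  (p : nat -> mpoly d R[i]) :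
  regular_set K -> (forall j, (supnorm K (p j) <= 1)%E) -> p 0%N = 1 ->
  (forall n (j : 'I_(poly_dim d n)), (msize (p j) <= n.+1)%N) ->
  (forall n, (0 < poly_dim d n)%N) ->
  (exists (Y0 : nat -> nat) (w : nat -> 'rV[R[i]]_d),
       [/\ {homo Y0 : m n / (m < n)%N}, dense (range w) &
         forall r : nat,
           (let n := (Y0 k) in ((2 * n%:R)^-1 * ln (sq_sum p n (w r)))%:E)
             @[k --> \oo] --> extremal_function K (w r)]) ->
  exists2 v : 'rV[R[i]]_d -> R, continuous v &
    forall z, extremal_function K z = (v z)%:E.
Proof.
move=> regK pK p0 pn dim0 [Y [w [Yinc wd wV]]].
have [F [x0 [c [c0 FE]]] Fp] := poly_geometric_bound regK.
have F1 z : 1 <= F z.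
  rewrite FE -[leLHS]mulr1 ler_pM//; first by rewrite -expR0 ler_expR.
  rewrite lerDl mulr_ge0 ?(ltW c0)// addr_ge0// sumr_ge0// => i _.
  exact: cabs_ge0.
have F0 z : 0 < F z by exact: lt_le_trans (F1 z).
have Vw r : (extremal_function K (w r) <= (d%:R + ln (F (w r)))%:E)%E.
  apply: cvge_to_le (wV r) _.
  exists 1%N => // k /= k0; rewrite lee_fin.
  have Yk : (0 < Y k)%N.
    by case: k k0 => // k _; rewrite (leq_ltn_trans _ (Yinc k k.+1 _)).
  move: (Y k) Yk => n n0.
  have n0' : 0 < n%:R :> R by rewrite ltr0n.
  rewrite ler_pdivrMl ?mulr_gt0//.
  have B0 : 0 < sq_sum p n (w r).
    rewrite /sq_sum (bigD1 (Ordinal (dim0 n)))//= p0 /peval meval1 Normc.normc1.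
    by rewrite expr1n ltr_pwDl// sumr_ge0// => j _; rewrite sqr_ge0.
  apply: (@le_trans _ _ (ln ((n.+1 ^ d)%:R * F (w r) ^+ (2 * n)))).
    rewrite ler_ln ?posrE ?mulr_gt0 ?exprn_gt0 ?ltr0n ?expn_gt0//.
    apply: (@le_trans _ _ (\sum_(j < poly_dim d n) F (w r) ^+ (2 * n))).
      apply: ler_sum => j _; rewrite mulnC exprM lerXn2r ?nnegrE ?cabs_ge0//.
        by rewrite exprn_ge0// ltW.
      exact: Fp.
    rewrite sumr_const card_ord -[leLHS]mulr_natl ler_wpM2r ?exprn_ge0 ?(ltW (F0 _))//.
    by rewrite ler_nat poly_dim_le.
  rewrite lnM ?posrE ?exprn_gt0 ?ltr0n ?expn_gt0// mulrDr lerD//.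
    rewrite natrX lnXn ?ltr0n// -[leLHS]mulr_natr ler_wpM2r//.
    rewrite -natr1 addrC (le_trans (le_ln1Dx _))//.
      by rewrite (@lt_le_trans _ _ 0)// oppr_lt0.
    by rewrite ler_peMl// ler1n.
  by rewrite lnXn// -[leLHS]mulr_natl natrM.
have Vfin z : (extremal_function K z \is a fin_num).
  rewrite ge0_fin_numE ?extremal_ge0// ltNge; apply/negP; rewrite leye_eq => /eqP Vy.
  pose M := d%:R + ln (expR 1 * (1 + c * (1 + \sum_(i < d) (1 + cabs (z ord0 i - x0 ord0 i))))).
  have : nbhs (extremal_function K z) [set y : \bar R | (M%:E < y)%E].
    by apply: open_nbhs_nbhs; split; [exact: open_ereal_gt_ereal|rewrite /= Vy ltry].
  move=> /(proj2 regK) /nbhs_Cd[rho rho0 rhoV].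
  have := @dense_nbhs _ (range w) z [set y : 'rV[R[i]]_d | forall i, cabs (y ord0 i - z ord0 i) < Num.min 1 rho] wd.
  case.
    by apply/nbhs_Cd; exists (Num.min 1 rho) => //; rewrite lt_min ltr01.
  move=> _ [r _ <-] /= wz.
  have : (M%:E < extremal_function K (w r))%E.
    by apply: rhoV => i; have := wz i; rewrite lt_min => /andP[].
  move=> /lt_le_trans /(_ (Vw r)); rewrite lte_fin /M ltNge => /negP; apply.
  rewrite lerD2l ler_ln ?posrE//; last first.
    rewrite mulr_gt0 ?expR_gt0// ltr_pwDl// mulr_ge0 ?(ltW c0)// addr_ge0// sumr_ge0// => i _.
    by rewrite addr_ge0 ?cabs_ge0.
  rewrite FE ler_pM2l ?expR_gt0// lerD2l ler_pM2l// lerD2l; apply: ler_sum => i _.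
  have := cabsD (w r ord0 i - z ord0 i) (z ord0 i - x0 ord0 i).
  rewrite addrA subrK => /le_trans; apply; rewrite lerD2r ltW//.
  by have := wz i; rewrite lt_min => /andP[].
exists (fun z => fine (extremal_function K z)); last by move=> z; rewrite fineK.
move=> z; have H : extremal_function K y @[y --> z] --> (fine (extremal_function K z))%:E.
  by rewrite fineK//; exact: (proj2 regK).
exact: (fine_cvg H).
Qed.

End extremal.

(** * Rigid motions of the plane *)
Section measure_preserving.
Context d (T : measurableType d) {R : realType}.
Implicit Types (mu : {measure set T -> \bar R}) (f g : T -> T).

Definition measure_preserving mu f :=
  measurable_fun setT f /\
  forall A, measurable A -> mu (f @^-1` A) = mu A.

Lemma measure_preserving_comp mu f g :
  measure_preserving mu f -> measure_preserving mu g ->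
  measure_preserving mu (f \o g).
Proof.
move=> [mf f_mu] [mg g_mu]; split; first exact: measurableT_comp.
move=> A mA; rewrite comp_preimage g_mu ?f_mu//.
by rewrite -[X in measurable X]setTI; exact: mf.
Qed.

Lemma ge0_integral_measure_preserving mu f (h : T -> \bar R) :
  measure_preserving mu f -> measurable_fun setT (h : T -> \bar R) -> (forall x, 0 <= h x)%E ->
  (\int[mu]_x h (f x) = \int[mu]_x h x)%E.
Proof.
move=> [mf f_mu] mh h0.
have := @ge0_integral_pushforward _ _ _ _ R f mf mu setT h measurableT mh.
rewrite preimage_setT => <-; last by move=> y _; exact: h0.
apply: (@eq_measure_integral _ _ _ _ mu
  (measure_function_pushforward__canonical__measure_function_Measure mu mf)).
by move=> A mA _; rewrite /= /pushforward f_mu.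
Qed.

End measure_preserving.

Section shears.
Context {R : realType}.
Local Notation lambda := (@lebesgue_measure R).
Local Notation T1 := (measurableTypeR R).
Local Notation T2 := (measurableTypeR R * measurableTypeR R)%type.
Local Notation lambda2 := (product_measure lambda lambda).

Lemma lebesgue_shift (c : R) : measure_preserving lambda (fun x : T1 => x + c).
Proof.
have mf : measurable_fun setT (fun x : T1 => (x : R) + c : T1).
  by apply: measurable_funD => //; exact: measurable_cst.
split=> // A mA; apply/esym.
apply: (@lebesgue_measure_unique R
  (measure_function_pushforward__canonical__measure_function_Measure lambda mf)) => //.
move=> _ [[a b] _ <-] /=; rewrite /pushforward.
have -> : (fun x : T1 => (x : R) + c : T1) @^-1` `]a, b]%classic = `]a - c, b - c]%classic.
  by apply/seteqP; split=> x /=; rewrite !in_itv/= ltrBlDr lerBrDr.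
rewrite !lebesgue_measure_itv/= !lte_fin ltrD2r.
by case: ifP => // _; rewrite -!EFinD; congr EFin; ring.
Qed.

Lemma shear_snd (h : R -> R) : measurable_fun setT h ->
  measure_preserving lambda2 (fun x : T2 => (x.1, (x.2 : R) + h x.1) : T2).
Proof.
move=> mh.
have mf : measurable_fun setT (fun x : T2 => (x.1, (x.2 : R) + h x.1) : T2).
  apply: measurable_fun_pair => //; apply: measurable_funD => //.
  exact: measurableT_comp.
split=> // A mA; rewrite /product_measure /product_measure1.
apply: eq_integral => x _ /=.
rewrite -[RHS](proj2 (lebesgue_shift (h x))); last exact: measurable_xsection.
by congr lebesgue_measure; apply/seteqP; split=> y; rewrite /xsection/= !inE.
Qed.

Lemma shear_fst (h : R -> R) : measurable_fun setT h ->
  measure_preserving lambda2 (fun x : T2 => ((x.1 : R) + h x.2, x.2) : T2).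
Proof.
move=> mh.
have mf : measurable_fun setT (fun x : T2 => ((x.1 : R) + h x.2, x.2) : T2).
  apply: measurable_fun_pair => //; apply: measurable_funD => //.
  exact: measurableT_comp.
split=> // A mA.
have E B : measurable B -> lambda2 B = (lambda \x^ lambda)%E B.
  move=> mB; rewrite /product_measure.
  by apply: product_measure_unique => // B1 B2 mB1 mB2; rewrite /= product_measure2E.
refine (etrans (E _ _) (etrans _ (esym (E _ mA)))).
  by rewrite -[X in measurable X]setTI; exact: mf.
rewrite /product_measure2; apply: eq_integral => y _ /=.
rewrite -[RHS](proj2 (lebesgue_shift (h y))); last exact: measurable_ysection.
by congr lebesgue_measure; apply/seteqP; split=> x; rewrite /ysection/= !inE.
Qed.

(** A rotation other than the half-turn is a product of three shears, each of
    which preserves area by Fubini's theorem. *)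
Lemma shear_decomposition (c s u v : R) : c ^+ 2 + s ^+ 2 = 1 -> c != - 1 ->
  measure_preserving lambda2
    (fun x : T2 => ((u + (c * x.1 - s * x.2))%R, (v + (s * x.1 + c * x.2))%R) : T2).
Proof.
move=> cs c1; have c10 : 1 + c != 0 by rewrite addrC addr_eq0.
pose k := s / (1 + c).
have mM (a : R) : measurable_fun setT (fun x : R => a * x).
  by apply: measurable_funM => //; exact: measurable_cst.
have mC (a : R) : measurable_fun setT (fun _ : R => a) by exact: measurable_cst.
have := measure_preserving_comp (shear_fst (mC u)) (measure_preserving_comp (shear_snd (mC v))
  (measure_preserving_comp (shear_fst (mM (- k)))
  (measure_preserving_comp (shear_snd (mM s)) (shear_fst (mM (- k)))))).
set f := (f in measure_preserving _ f -> _); set g := (g in _ -> measure_preserving _ g).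
suff -> : f = g by [].
apply/funext => -[x y]; rewrite /f /g /=.
have s2 : s ^+ 2 = (1 - c) * (1 + c).
  have -> : s ^+ 2 = 1 - c ^+ 2 by rewrite -cs; ring.
  by ring.
have ks : s * k = 1 - c by rewrite /k mulrA -expr2 s2 mulfK.
have kc : k * (1 + c) = s by rewrite /k mulfVK.
congr pair.
- have -> : x + - k * y + - k * (y + s * (x + - k * y)) + u =
    u + x - (s * k) * x - k * (1 + (1 - s * k)) * y by ring.
  have -> : u + x - s * k * x - k * (1 + (1 - s * k)) * y =
    u + (1 - s * k) * x - k * (1 + (1 - s * k)) * y by ring.
  have -> : 1 - s * k = c by rewrite ks; ring.
  by rewrite kc; ring.
- have -> : y + s * (x + - k * y) + v = v + s * x + (1 - s * k) * y by ring.
  by rewrite ks; ring.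
Qed.

Lemma rigid_motion_preserving (c s u v : R) : c ^+ 2 + s ^+ 2 = 1 ->
  measure_preserving lambda2
    (fun x : T2 => ((u + (c * x.1 - s * x.2))%R, (v + (s * x.1 + c * x.2))%R) : T2).
Proof.
move=> cs; have [c1|c1] := eqVneq c (- 1); last exact: shear_decomposition.
have s0 : s = 0.
  by apply/eqP; rewrite -sqrf_eq0; apply/eqP; move: cs; rewrite c1 sqrrN expr1n; lra.
have q0 : (0 : R) ^+ 2 + 1 ^+ 2 = 1 by rewrite expr0n expr1n add0r.
have q1 : (0 : R) != - 1 by rewrite eq_sym oppr_eq0 oner_eq0.
(* The half-turn is the square of the quarter-turn. *)
have := measure_preserving_comp (shear_decomposition u v q0 q1) (shear_decomposition 0 0 q0 q1).
set f := (f in measure_preserving _ f -> _); set g := (g in _ -> measure_preserving _ g).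
suff -> : f = g by [].
by apply/funext => -[x y]; rewrite /f /g /= c1 s0; congr pair; ring.
Qed.

End shears.

(** * Product measures and the coordinates of C^d *)
Section tuple_preserving.
Context d (T : measurableType d) {R : realType}.
Variable mu : {sigma_finite_measure set T -> \bar R}.

Definition tuple_map2 n (f : 'I_n -> T -> T) (t : n.-tuple T) : n.-tuple T :=
  [tuple f i (tnth t i) | i < n].

Lemma measurable_tuple_map2 n (f : 'I_n -> T -> T) :
  (forall i, measurable_fun setT (f i)) -> measurable_fun setT (tuple_map2 f).
Proof.
move=> mf; apply/measurable_fun_tnthP => i.
rewrite (_ : _ \o _ = f i \o (fun t => tnth t i)); last first.
  by apply/funext => t /=; rewrite tnth_mktuple.
by apply: measurableT_comp; [exact: mf|exact: measurable_tnth].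
Qed.

Lemma product_preserving d' (T' : measurableType d')
    (nu : {sigma_finite_measure set T' -> \bar R}) (f : T -> T) (g : T' -> T') :
  measure_preserving mu f -> measure_preserving nu g ->
  forall A : set (T * T'), measurable A ->
  (mu \x nu)%E ((fun x => (f x.1, g x.2)) @^-1` A) = (mu \x nu)%E A.
Proof.
move=> f_mu [mg g_nu] A mA; rewrite /product_measure1.
rewrite -[RHS](ge0_integral_measure_preserving f_mu); first last.
- by move=> x /=; exact: measure_ge0.
- exact: measurable_fun_xsection.
apply: eq_integral => x _ /=.
rewrite -[RHS]g_nu; last exact: measurable_xsection.
by congr (nu _); apply/seteqP; split=> y; rewrite /xsection/= !inE.
Qed.

Lemma tuple_preserving n (f : 'I_n -> T -> T) :
  (forall i, measure_preserving mu (f i)) ->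
  measure_preserving (tuple_measure mu n) (tuple_map2 f).
Proof.
elim: n f => [|n IH] f fmu.
  split; first by apply: measurable_tuple_map2 => i; exact: (proj1 (fmu i)).
  move=> A mA; have -> : tuple_map2 f = id.
    by apply/funext => t; rewrite [LHS]tuple0 [RHS]tuple0.
  by rewrite preimage_id.
have mf : measurable_fun setT (tuple_map2 f).
  by apply: measurable_tuple_map2 => i; exact: (proj1 (fmu i)).
split=> // A mA /=.
have := @product_preserving _ _ (tuple_measure mu n) (f ord0)
  (tuple_map2 (fun i => f (lift ord0 i))) (fmu ord0) _
  (@tuple_cons _ _ n @^-1` A).
have -> : (fun x : T * n.-tuple T => (f ord0 x.1, tuple_map2 (fun i => f (lift ord0 i)) x.2)) @^-1`
    (@tuple_cons _ _ n @^-1` A) = @tuple_cons _ _ n @^-1` (tuple_map2 f @^-1` A).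
  suff E xt : tuple_map2 f (@tuple_cons _ _ n xt) = @tuple_cons _ _ n
      (f ord0 xt.1, tuple_map2 (fun i => f (lift ord0 i)) xt.2).
    by apply/seteqP; split=> xt; rewrite /preimage/= E.
  apply: eq_from_tnth => i; rewrite tnth_mktuple.
  case: xt => x t; case: (unliftP ord0 i) => [j ->|->] //=.
  by rewrite !tnthS tnth_mktuple.
apply; first by apply: IH => i; exact: fmu.
by rewrite -[X in measurable X]setTI; exact: measurable_tuple_cons.
Qed.

Lemma measurable_tuple_box n (A : 'I_n -> set T) :
  (forall i, measurable (A i)) ->
  measurable [set t : n.-tuple T | forall i, A i (tnth t i)].
Proof.
move=> mA; rewrite (_ : [set t | _] = \bigcap_(i in setT) ((fun t : n.-tuple T => tnth t i) @^-1` A i)).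
  apply: fin_bigcap_measurable => // i _.
  by rewrite -[X in measurable X]setTI; exact: measurable_tnth.
by apply/seteqP; split=> t /= h i; [move=> _; exact: h|exact: (h i)].
Qed.

Lemma tuple_measure_box n (A : 'I_n -> set T) :
  (forall i, measurable (A i)) ->
  tuple_measure mu n [set t | forall i, A i (tnth t i)] = (\prod_(i < n) mu (A i))%E.
Proof.
elim: n A => [|n IH] A mA.
  rewrite big_ord0 /= diracE mem_set//= => -[]//.
rewrite big_ord_recl -IH//= /tuple_measureS /pushforward.
rewrite -product_measure1E//; last exact: (@measurable_tuple_box n (fun i => A (lift ord0 i))).
congr ((mu \x _)%E _); apply/seteqP; split=> [[x t]|[x t]] /=.
  move=> h; split; first by have := h ord0.
  by move=> i; have := h (lift ord0 i); rewrite tnthS.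
move=> [Ax At] i; case: (unliftP ord0 i) => [j ->|->]//.
by rewrite tnthS; exact: At.
Qed.

End tuple_preserving.

Section coordinates.
Context {R : realType}.
Local Notation T2 := (measurableTypeR R * measurableTypeR R)%type.

(** An open set is the union of the cells of rational grids that it contains, and
    there are countably many of them. *)
Lemma measurable_of_coords_open n (U : set 'rV[R[i]]_n) : open U ->
  measurable (@of_coords R n @^-1` U : set (n.-tuple T2)).
Proof.
move=> oU.
pose I (k : nat) (g : int) : set R := `[g%:~R / k.+1%:R, (g + 1)%:~R / k.+1%:R[%classic.
pose cell (kg : nat * n.-tuple (int * int)) : set (n.-tuple T2) :=
  [set t | forall i, I kg.1 (tnth kg.2 i).1 (tnth t i).1 /\ I kg.1 (tnth kg.2 i).2 (tnth t i).2].
have mcell kg : measurable (cell kg).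
  apply: (@measurable_tuple_box _ T2 n (fun i =>
    I kg.1 (tnth kg.2 i).1 `*` I kg.1 (tnth kg.2 i).2)) => i.
  by apply: measurableX; exact: measurable_itv.
rewrite (_ : _ @^-1` U = \bigcup_m (if @choice.unpickle (nat * n.-tuple (int * int))%type m is Some kg then
    if `[< cell kg `<=` @of_coords R n @^-1` U >] then cell kg else set0 else set0)).
  apply: bigcupT_measurable => m; case: choice.unpickle => // kg.
  by case: ifP.
apply/seteqP; split=> [t Ut|t [m _]]; last first.
  by case: choice.unpickle => // kg; case: ifP => // /asboolP; exact.
have [rho rho0 rhoU] : exists2 rho : R, 0 < rho &
    forall y : 'rV_n, (forall i, cabs (y ord0 i - of_coords t ord0 i) < rho) -> U y.
  by apply/nbhs_Cd; apply: open_nbhs_nbhs; split.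
pose k := Num.truncn (2 / rho).
have krho : 2 / k.+1%:R < rho.
  rewrite ltr_pdivrMr ?ltr0n// mulrC -ltr_pdivrMr//.
  exact: truncnS_gt.
pose g : n.-tuple (int * int) := [tuple (Num.floor ((tnth t i).1 * k.+1%:R), Num.floor ((tnth t i).2 * k.+1%:R)) | i < n].
have Ifl (x : R) : I k (Num.floor (x * k.+1%:R)) x.
  rewrite /I /= in_itv/= ler_pdivrMr ?ltr0n// ltr_pdivlMr ?ltr0n//.
  exact: floor_itv.
have Idist (g' : int) (x y : R) : I k g' x -> I k g' y -> `|x - y| < k.+1%:R^-1.
  rewrite /I /= !in_itv/= => /andP[x1 x2] /andP[y1 y2].
  have gE : (g' + 1)%:~R = g'%:~R + 1 :> R by rewrite intrD.
  rewrite gE mulrDl mul1r in x2 y2.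
  have itv_dist (w e : R) : w <= x -> x < w + e -> w <= y -> y < w + e -> `|x - y| < e.
    by move=> *; rewrite ltr_norml; apply/andP; split; lra.
  exact: itv_dist x1 x2 y1 y2.
have tg : cell (k, g) t by move=> i; rewrite /= tnth_mktuple/=.
exists (choice.pickle (k, g)) => //; rewrite choice.pickleK.
case: ifP => // /asboolP[]; move=> y yg; apply: rhoU => i.
rewrite !mxE; have [y1 y2] := yg i; have [t1 t2] := tg i.
apply: le_lt_trans krho; apply: (le_trans (cabs_le_ReIm _)) => /=.
have -> : 2 / k.+1%:R = k.+1%:R^-1 + k.+1%:R^-1 :> R by rewrite mulrDl mul1r.
by apply: lerD; apply: ltW; [exact: Idist y1 t1|exact: Idist y2 t2].
Qed.

Lemma measurable_of_coords n (f : 'rV[R[i]]_n -> R) : continuous f ->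
  measurable_fun setT (fun x : n.-tuple T2 => f (of_coords x)).
Proof.
move=> cf; apply: (measurability _ (RGenOInfty.measurableE R)).
move=> _ [_ [a ->] <-]; rewrite setTI.
apply: (@measurable_of_coords_open _ (f @^-1` `]a, +oo[%classic)).
by apply: open_comp => // x _; exact: cf.
Qed.

End coordinates.

(** * Boxes *)
Section boxes.
Context {R : realType}.
Local Notation T2 := (measurableTypeR R * measurableTypeR R)%type.

Definition box d (x : 'rV[R[i]]_d) (s : R) : set 'rV[R[i]]_d :=
  [set z | forall i, `|Re (z ord0 i - x ord0 i)| <= s /\
                     `|Im (z ord0 i - x ord0 i)| <= s].

Lemma box_preimage d (x : 'rV[R[i]]_d) s :
  @of_coords R d @^-1` box x s = [set t : d.-tuple T2 | forall i,
    (`[Re (x ord0 i) - s, Re (x ord0 i) + s]%classic `*`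
     `[Im (x ord0 i) - s, Im (x ord0 i) + s]%classic) (tnth t i)].
Proof.
have E (a b : R) : (`|a - b| <= s) = (b - s <= a <= b + s).
  by rewrite ler_norml lerBrDr lerBlDr [- s + _]addrC [s + _]addrC.
by apply/seteqP; split=> t /= h i; have := h i; rewrite !mxE/=;
  case: (x ord0 i) => x1 x2 /=; rewrite !in_itv/= !E.
Qed.

Lemma measurable_box d (x : 'rV[R[i]]_d) s :
  measurable (@of_coords R d @^-1` box x s : set (d.-tuple T2)).
Proof.
rewrite box_preimage; apply: (@measurable_tuple_box _ T2 _ (fun i =>
    `[Re (x ord0 i) - s, Re (x ord0 i) + s]%classic `*`
     `[Im (x ord0 i) - s, Im (x ord0 i) + s]%classic)) => i.
by apply: measurableX; exact: measurable_itv.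
Qed.

Lemma volume_box d (x : 'rV[R[i]]_d) s : 0 < s ->
  lebesgue_R2d d (@of_coords R d @^-1` box x s) = ((2 * s) ^+ (2 * d))%:E.
Proof.
move=> s0; rewrite box_preimage /lebesgue_R2d.
rewrite (@tuple_measure_box _ T2 R _ _ (fun i =>
    `[Re (x ord0 i) - s, Re (x ord0 i) + s]%classic `*`
     `[Im (x ord0 i) - s, Im (x ord0 i) + s]%classic)); last first.
  by move=> i; apply: measurableX; exact: measurable_itv.
have L (u : R) : @lebesgue_measure R `[u - s, u + s]%classic = (2 * s)%:E.
  rewrite lebesgue_measure_itv/= lte_fin ifT; last lra.
  by rewrite -EFinD; congr EFin; lra.
rewrite (eq_bigr (fun=> ((2 * s) ^+ 2)%:E)); last first.
  move=> i _; rewrite /product_measure.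
  set A := `[Re _ - s, _]%classic; set B := `[Im _ - s, _]%classic.
  transitivity (@lebesgue_measure R A * @lebesgue_measure R B)%E.
    by apply: product_measure1E; exact: measurable_itv.
  by rewrite !L -EFinM expr2.
by rewrite prodEFin prodr_const card_ord exprM.
Qed.

End boxes.

(** * Circle means and volume integrals *)
Section rotations.
Context {R : realType}.
Local Notation T2 := (measurableTypeR R * measurableTypeR R)%type.

Definition expi (t : R) : R[i] := Complex (cos t) (sin t).

Lemma circle_point01 t : circle_point 0 1 t = expi t.
Proof. by rewrite /circle_point /expi add0r mul1r. Qed.

Lemma continuous_expi : continuous expi.
Proof.
move=> t P /nbhs_C[rho rho0 rhoP].
have r2 : 0 < rho / 2 by rewrite divr_gt0.
have := @continuous_cos R t; move=> /cvgrPdist_lt /(_ _ r2).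
have := @continuous_sin R t; move=> /cvgrPdist_lt /(_ _ r2).
apply: filterS2 => u s1 c1; apply: rhoP.
apply: (le_lt_trans (cabs_le_ReIm _)) => /=.
by rewrite (splitr rho) distrC [X in _ + X]distrC ltrD.
Qed.

Definition rotate d (z0 : 'rV[R[i]]_d) (t : R) : d.-tuple T2 -> d.-tuple T2 :=
  tuple_map2 (fun i (x : T2) =>
    ((Re (z0 ord0 i) + (cos t * x.1 - sin t * x.2))%R,
     (Im (z0 ord0 i) + (sin t * x.1 + cos t * x.2))%R) : T2).

Lemma of_coords_rotate d (z0 : 'rV[R[i]]_d) t b :
  of_coords (rotate z0 t b) = z0 + expi t *: of_coords b.
Proof.
apply/rowP => i; rewrite !mxE tnth_mktuple.
case: (z0 ord0 i) => x y; case: (tnth b i) => u v.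
by apply/eqP; rewrite eq_complex /= [sin t * u + _]addrC !eqxx.
Qed.

Lemma rotate_preserving d (z0 : 'rV[R[i]]_d) t :
  measure_preserving (lebesgue_R2d d) (rotate z0 t).
Proof.
apply: tuple_preserving => i; apply: rigid_motion_preserving.
exact: cos2Dsin2.
Qed.

Lemma integral_mul_indic dd (T : measurableType dd)
    (mu : {measure set T -> \bar R}) (D : set T) (f : T -> R) :
  (\int[mu]_(x in D) (f x)%:E = \int[mu]_x (\1_D x * f x)%:E)%E.
Proof.
rewrite integral_mkcond; apply: eq_integral => x _.
by rewrite patchE indicE; case: ifP => _; rewrite ?mul1r ?mul0r.
Qed.

(** The heart of Hartogs' lemma: a bound on the means over the circles centred
    at [z0] is turned into a bound on a volume integral, since Lebesgue measure
    is invariant under [b |-> z0 + expi t *: b].  The constant 3 exceeds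
    [2 * sqrt 2]. *)
Lemma circle_mean_volume d (f : 'rV[R[i]]_d -> R) (x : 'rV[R[i]]_d) (s : R) (z0 : 'rV[R[i]]_d) (eta : R) :
  continuous f -> (forall z, 0 <= f z) -> 0 < s -> box x s z0 -> 0 <= eta ->
  (forall b, box 0 (3 * s) b -> circle_mean (fun t => f (z0 + expi t *: b)) <= eta) ->
  (\int[lebesgue_R2d d]_(y in @of_coords R d @^-1` box x s) (f (of_coords y))%:E
    <= (eta * (6 * s) ^+ (2 * d))%:E)%E.
Proof.
move=> cf f0 s0 z0x eta0 meanf.
set mu := lebesgue_R2d d.
set B := @of_coords R d @^-1` box x s.
pose Q := @of_coords R d @^-1` box 0 (3 * s).
pose C : set (measurableTypeR R) := `[0, 2 * pi]%classic.
have mB : measurable B by exact: measurable_box.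
have mQ : measurable Q by exact: measurable_box.
have mC : measurable C by exact: measurable_itv.
have mf := measurable_of_coords cf.
have pi20 : 0 < 2 * pi :> R by rewrite mulr_gt0// pi_gt0.
have clb b : continuous (fun t => f (z0 + expi t *: b)).
  move=> t; apply: (@continuous_comp _ _ _ expi (fun l => f (z0 + l *: b))).
    exact: continuous_expi.
  apply: (@continuous_comp _ _ _ (fun l : R[i] => z0 + l *: b) f).
    exact: continuous_line.
  exact: cf.
pose F (ty : measurableTypeR R * d.-tuple T2) : R :=
  \1_C ty.1 * (\1_Q ty.2 * f (of_coords (rotate z0 ty.1 ty.2))).
have F0 ty : 0 <= F ty by rewrite /F !mulr_ge0// ?indicE ?ler0n.
have mF : measurable_fun setT F.
  apply: measurable_funM.
    by apply: measurableT_comp => //; exact: measurable_indic.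
  apply: measurable_funM.
    by apply: measurableT_comp => //; exact: measurable_indic.
  pose Phi (ty : measurableTypeR R * d.-tuple T2) := rotate z0 ty.1 ty.2.
  have mPhi : measurable_fun setT Phi.
    apply/measurable_fun_tnthP => i.
    rewrite (_ : _ \o _ = fun ty : measurableTypeR R * d.-tuple T2 =>
      ((Re (z0 ord0 i) + (cos ty.1 * (tnth ty.2 i).1 - sin ty.1 * (tnth ty.2 i).2))%R,
     (Im (z0 ord0 i) + (sin ty.1 * (tnth ty.2 i).1 + cos ty.1 * (tnth ty.2 i).2))%R) : T2); last first.
      by apply/funext => ty /=; rewrite tnth_mktuple.
    have mt : measurable_fun setT (fun ty : measurableTypeR R * d.-tuple T2 => tnth ty.2 i).
      by apply: (measurableT_comp (measurable_tnth i)).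
    have mt1 := measurableT_comp measurable_fst mt.
    have mt2 := measurableT_comp measurable_snd mt.
    have mc : measurable_fun setT (fun ty : measurableTypeR R * d.-tuple T2 => cos ty.1).
      apply: measurableT_comp => //; apply: continuous_measurable_fun.
      exact: continuous_cos.
    have ms : measurable_fun setT (fun ty : measurableTypeR R * d.-tuple T2 => sin ty.1).
      apply: measurableT_comp => //; apply: continuous_measurable_fun.
      exact: continuous_sin.
    apply: measurable_fun_pair; apply: measurable_funD; try exact: measurable_cst.
      by apply: measurable_funB; apply: measurable_funM.
    by apply: measurable_funD; apply: measurable_funM.
  exact: (measurableT_comp mf mPhi).
pose I := (\int[mu]_(y in B) (f (of_coords y))%:E)%E.
have I0 : (0 <= I)%E by apply: integral_ge0 => y _; rewrite lee_fin.
have IJ t : C t -> (I <= \int[mu]_y (F (t, y))%:E)%E.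
  move=> Ct; rewrite /I integral_mul_indic.
  rewrite -(ge0_integral_measure_preserving (rotate_preserving z0 t)); first last.
  - by move=> y; rewrite lee_fin mulr_ge0// indicE ler0n.
  - by apply/measurable_EFinP; apply: measurable_funM => //; exact: measurable_indic.
  apply: ge0_le_integral => //.
  - by move=> y _; rewrite lee_fin mulr_ge0// indicE ler0n.
  - apply/measurable_EFinP; apply: measurable_funM.
      by apply: measurableT_comp; [exact: measurable_indic|exact: (proj1 (rotate_preserving z0 t))].
    exact: (measurableT_comp mf (proj1 (rotate_preserving z0 t))).
  - by apply/measurable_EFinP; apply: (measurableT_comp mF); exact: measurable_fun_pair.
  move=> b _; rewrite lee_fin /F /=.
  have -> : \1_C t = 1 :> R by rewrite indicE mem_set.
  rewrite mul1r ler_wpM2r// !indicE ler_nat; case: (boolP (_ \in B)) => // /set_mem; rewrite /B /= of_coords_rotate => bB.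
  rewrite lt0b; apply/mem_set; rewrite /Q /= => i.
  rewrite (_ : (0 : 'rV[R[i]]_d) ord0 i = 0) ?subr0; last by rewrite mxE.
  have [B1 B2] := bB i; have [z1 z2] := z0x i.
  have w2 : cabs (expi t * of_coords b ord0 i) ^+ 2 <= (3 * s) ^+ 2.
    rewrite sqr_cabs -[Re _ ^+ 2]real_normK ?num_real// -[Im _ ^+ 2]real_normK ?num_real//.
    set w := expi t * _ in B1 B2 *.
    have -> : w = ((z0 + expi t *: of_coords b) ord0 i - x ord0 i) - (z0 ord0 i - x ord0 i).
      by rewrite 2!mxE /w; ring.
    have n1 : `|Re (((z0 + expi t *: of_coords b) ord0 i - x ord0 i) - (z0 ord0 i - x ord0 i))| <= 2 * s.
      by rewrite raddfB (le_trans (ler_normB _ _))// mulr_natl mulr2n lerD.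
    have n2 : `|Im (((z0 + expi t *: of_coords b) ord0 i - x ord0 i) - (z0 ord0 i - x ord0 i))| <= 2 * s.
      by rewrite raddfB (le_trans (ler_normB _ _))// mulr_natl mulr2n lerD.
    rewrite -(@ler_pXn2r _ 2)// ?nnegrE ?mulr_ge0 ?(ltW s0)// in n1.
    rewrite -(@ler_pXn2r _ 2)// ?nnegrE ?mulr_ge0 ?(ltW s0)// in n2.
    by apply: (le_trans (lerD n1 n2)); nra.
  have e1 : cabs (expi t) = 1.
    by have := circle_point_bound (0 : R[i]) t (@ler01 R); rewrite subr0 circle_point01.
  rewrite cabsM e1 mul1r ler_pXn2r ?nnegrE ?cabs_ge0 ?mulr_ge0 ?(ltW s0)// in w2.
  by split; apply: le_trans w2; [exact: Re_le_cabs|exact: Im_le_cabs].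
have K : ((2 * pi)%:E * I <= (2 * pi * eta * (6 * s) ^+ (2 * d))%:E)%E.
  apply: (@le_trans _ _ (\int[lebesgue_measure]_(t in C) \int[mu]_y (F (t, y))%:E)%E).
    rewrite (_ : ((2 * pi)%:E * I)%E = (\int[lebesgue_measure]_(t in C) cst I t)%E); last first.
      rewrite integral_cst// muleC; congr (_ * _)%E; apply/esym.
      transitivity (@lebesgue_measure R C) => //.
      by rewrite /C lebesgue_measure_itv/= lte_fin pi20 -EFinD subr0.
    apply: ge0_le_integral => //.
    have mm : measurable_fun setT (fun t => \int[mu]_y (F (t, y))%:E)%E.
      have := @measurable_fun_fubini_tonelli_F _ _ _ _ R mu (EFin \o F).
      by apply=> //; exact/measurable_EFinP.
    exact: (measurable_funS measurableT (@subsetT _ _) mm).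
  rewrite integral_mkcond.
  rewrite (_ : (\int[_]_t _)%E = (\int[lebesgue_measure]_t \int[mu]_y (F (t, y))%:E)%E); last first.
    apply: eq_integral => t _; rewrite patchE; case: ifPn => // tC.
    rewrite integral0_eq// => y _; rewrite /F /= indicE.
    by rewrite (negbTE tC) mul0r.
  have := @fubini_tonelli _ _ _ _ R lebesgue_measure mu (EFin \o F).
  move=> /(_ _ _)/= ->; last 2 first.
  - exact/measurable_EFinP.
  - by move=> ty; rewrite lee_fin.
  apply: (@le_trans _ _ (\int[mu]_y (\1_Q y * (2 * pi * eta))%:E)%E).
    apply: ge0_le_integral => //.
    - by move=> y _; apply: integral_ge0 => t _; rewrite lee_fin.
    - have := @measurable_fun_fubini_tonelli_G _ _ _ _ R lebesgue_measure (EFin \o F).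
      by apply=> //; exact/measurable_EFinP.
    - apply/measurable_EFinP; apply: measurable_funM; first exact: measurable_indic.
      exact: measurable_cst.
    move=> y _.
    have -> : (\int[lebesgue_measure]_t (F (t, y))%:E =
       (\1_Q y)%:E * \int[lebesgue_measure]_(t in C) (f (z0 + expi t *: of_coords y))%:E)%E.
      rewrite [in RHS]integral_mul_indic -ge0_integralZl_EFin//; last 2 first.
      - by move=> t _; rewrite lee_fin mulr_ge0// indicE ler0n.
      - apply/measurable_EFinP; apply: measurable_funM; first exact: measurable_indic.
        exact: continuous_measurable_fun (clb _).
      by apply: eq_integral => t _; rewrite /F /= of_coords_rotate -EFinM mulrCA.
    rewrite indicE; case: (boolP (y \in Q)) => [/set_mem yQ|_]; last by rewrite mul0e mul0r.
    rewrite mul1e mul1r.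
    have := circle_meanE (clb (of_coords y)).
    move=> /(congr1 (fun x => (2 * pi)%:E * x)%E).
    rewrite muleA -EFinM mulfV ?gt_eqF// mul1e => ->.
    by rewrite -EFinM lee_fin ler_pM2l//; exact: meanf.
  have muQ : mu Q = ((2 * (3 * s)) ^+ (2 * d))%:E by apply: volume_box; rewrite mulr_gt0.
  rewrite -integral_mul_indic.
  have -> : (\int[mu]_(y in Q) (2 * pi * eta)%:E = (2 * pi * eta)%:E * mu Q)%E.
    exact: (integral_cst mu mQ (2 * pi * eta)%:E).
  rewrite muQ -EFinM.
  have -> : 2 * (3 * s) = 6 * s by ring.
  by [].
rewrite -(lee_pmul2l _ (_ : 0 < (2 * pi)%:E)%E)//.
by rewrite -EFinM mulrA.
Qed.

End rotations.

(** * Hartogs' lemma *)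
Section hartogs.
Context {R : realType}.
Local Notation T2 := (measurableTypeR R * measurableTypeR R)%type.

Lemma continuous_addR (T : topologicalType) (f g : T -> R) :
  continuous f -> continuous g -> continuous (fun z => f z + g z).
Proof. by move=> cf cg z; apply: (@cvgD R R^o); [exact: cf|exact: cg]. Qed.

(** At a zero of the polynomial, where [x = 0], the limit is [+oo]. *)
Lemma gap_trunc_cvg (x y c : R) : 0 < c -> 0 <= x ->
  (y - c * ln (Num.max k.+1%:R^-1 x))%:E @[k --> \oo] -->
    (y%:E - c%:E * lne x%:E)%E.
Proof.
move=> c0; rewrite le_eqVlt => /predU1P[<-|x0].
  rewrite le0_lneNy// gt0_muleNy ?lte_fin//= addey//.
  apply/cvgeyPge => A; near=> k; rewrite lee_fin.
  have k0 : (0 : R) < k.+1%:R^-1 by rewrite invr_gt0 ltr0n.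
  rewrite max_l ?(ltW k0)// lnV ?posrE ?ltr0n// mulrN opprK -lerBlDl.
  rewrite -ler_pdivrMl// -ler_expR lnK ?posrE ?ltr0n//.
  near: k; exists (Num.truncn (expR (c^-1 * (A - y)))) => // k /= hk.
  by apply: (le_trans (ltW (truncnS_gt _))); rewrite ler_nat ltnS.
rewrite lne_EFin// -EFinM -EFinB.
apply: cvg_near_cst; near=> k; congr (_ - c * ln _)%:E.
apply/max_r; near: k; exists (Num.truncn x^-1) => // k /= hk.
rewrite invf_ple ?posrE ?ltr0n//.
by apply: (le_trans (ltW (truncnS_gt _))); rewrite ler_nat ltnS.
Unshelve. all: by end_near. Qed.

(** The gap [v + c - ln |q| / n] is nonnegative, and it is at most [a + c] at [z0].
    By the submean property of [ln |q|] on the complex lines through [z0], its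
    means over circles centred at [z0] exceed its value there by at most the
    oscillation [e] of [v]; a nonnegative function with small circle means has a
    small volume integral.  The logarithm is truncated at [k.+1^-1] for this
    argument, and monotone convergence removes the truncation. *)
Lemma hartogs d (q : mpoly d R[i]) n (v : 'rV[R[i]]_d -> R) (c e a s : R)
    (x z0 : 'rV[R[i]]_d) :
  (0 < n)%N -> continuous v -> (forall z, 0 <= v z) -> 0 <= c ->
  (forall z, cabs (peval q z) <= expR (n%:R * (v z + c))) ->
  0 < s -> box x s z0 -> (forall z, box z0 (6 * s) z -> v z <= v z0 + e) ->
  expR (n%:R * (v z0 - a)) <= cabs (peval q z0) -> 0 <= e + c + a ->
  (\int[lebesgue_R2d d]_(y in @of_coords R d @^-1` box x s)
     ((v (of_coords y) + c)%:E - (n%:R^-1)%:E * lne (cabs (peval q (of_coords y)))%:E)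
   <= ((e + c + a) * (6 * s) ^+ (2 * d))%:E)%E.
Proof.
move=> n0 cv v0 c0 qv s0 z0x osc low eca.
have n0' : 0 < n%:R :> R by rewrite ltr0n.
have nV0 : 0 < n%:R^-1 :> R by rewrite invr_gt0.
pose del k : R := k.+1%:R^-1.
have del0 k : 0 < del k by rewrite invr_gt0 ltr0n.
have del1 k : del k <= 1 by rewrite invf_le1 ?ltr0n// ler1n.
pose g k z := v z + c - n%:R^-1 * ln (Num.max (del k) (cabs (peval q z))).
have cl k := @continuous_trunc R d q _ (del0 k).
have cg k : continuous (g k).
  have h1 := @continuous_scaleR _ _ (- n%:R^-1) _ (cl k).
  have -> : g k = (fun z => (v z + c) + (- n%:R^-1) * ln (Num.max (del k) (cabs (peval q z)))).
    by apply/funext => z; rewrite /g mulNr.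
  apply: continuous_addR h1; apply: continuous_addR => // z.
  exact: cst_continuous.
have g0 k z : 0 <= g k z.
  rewrite /g subr_ge0 ler_pdivrMl// -ler_expR lnK ?posrE ?lt_max ?del0//.
  rewrite ge_max qv andbT (le_trans (del1 k))// -expR0 ler_expR mulr_ge0 ?(ltW n0')//.
  by rewrite addr_ge0.
have I k : (\int[lebesgue_R2d d]_(y in @of_coords R d @^-1` box x s)
    (g k (of_coords y))%:E <= ((e + c + a) * (6 * s) ^+ (2 * d))%:E)%E.
  (* Points of [z0 + expi t *: box 0 (3 s)] lie in [box z0 (6 s)]. *)
  apply: (circle_mean_volume (cg k) (g0 k) s0 z0x eca) => b bs.
  have [Q _ QE] := line_poly q z0 b.
  have ccl := @continuous_trunc_circle R Q 0 1 _ (del0 k).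
  have cvl : continuous (fun t => v (z0 + expi t *: b)).
    move=> t; apply: (@continuous_comp _ _ _ expi (fun l => v (z0 + l *: b))).
      exact: continuous_expi.
    apply: (@continuous_comp _ _ _ (fun l : R[i] => z0 + l *: b) v).
      exact: continuous_line.
    exact: cv.
  have ccs := @continuous_scaleR _ _ (- n%:R^-1) _ ccl.
  rewrite (@eq_circle_mean _ _ (fun t => (v (z0 + expi t *: b) + c) +
     (- n%:R^-1) * ln (Num.max (del k) (cabs Q.[circle_point 0 1 t])))); last first.
    by move=> t; rewrite /g circle_point01 QE mulNr.
  have cvc : continuous (fun t => v (z0 + expi t *: b) + c).
    by apply: continuous_addR => // t; exact: cst_continuous.
  rewrite circle_meanD//.
  have h1 : circle_mean (fun t => v (z0 + expi t *: b) + c) <= v z0 + e + c.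
    rewrite -[leRHS]circle_mean_cst; apply: le_circle_mean => //.
      by move=> t; exact: cst_continuous.
    move=> t; rewrite lerD2r; apply: osc => i.
    have e1 : cabs (expi t) = 1.
      by have := circle_point_bound (0 : R[i]) t (@ler01 R); rewrite subr0 circle_point01.
    have wb : cabs ((z0 + expi t *: b) ord0 i - z0 ord0 i) <= 6 * s.
      have -> : (z0 + expi t *: b) ord0 i - z0 ord0 i = expi t * b ord0 i.
        by rewrite 2!mxE; ring.
      rewrite cabsM e1 mul1r (le_trans (cabs_le_ReIm _))//.
      have [] := bs i; rewrite (_ : (0 : 'rV[R[i]]_d) ord0 i = 0) ?subr0; last by rewrite mxE.
      by move=> b1 b2; lra.
    by split; apply: le_trans wb; [exact: Re_le_cabs|exact: Im_le_cabs].
  have h2 : circle_mean (fun t => (- n%:R^-1) * ln (Num.max (del k) (cabs Q.[circle_point 0 1 t])))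
      <= - (v z0 - a).
    rewrite /circle_mean RintegralZl//=; last exact: continuous_integrable.
    rewrite mulrCA mulNr lerN2 ler_pdivlMl//.
    apply: le_trans (trunc_submean Q 0 ltr01 (del0 k)).
    rewrite -ler_expR lnK ?posrE ?lt_max ?del0// QE scale0r addr0.
    by rewrite le_max low orbT.
  by apply: (le_trans (lerD h1 h2)); lra.
have mg k : measurable_fun (@of_coords R d @^-1` box x s) (fun y : d.-tuple T2 => (g k (of_coords y))%:E).
  apply: (measurable_funS measurableT (@subsetT _ _)); apply/measurable_EFinP.
  exact: measurable_of_coords.
have nd y : {homo (fun k => (g k (of_coords y))%:E) : k l / (k <= l)%N >-> (k <= l)%E}.
  move=> k l kl; rewrite lee_fin lerD2l lerN2 ler_pM2l// ler_ln ?posrE ?lt_max ?del0//.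
  rewrite ge_max !le_max lexx orbT andbT; apply/orP; left.
  by rewrite lef_pV2 ?posrE ?ltr0n// ler_nat ltnS.
have := @cvg_monotone_convergence _ _ R (lebesgue_R2d d) _ (measurable_box x s) _ mg
  (fun k y _ => g0 k (of_coords y)) (fun y _ => nd y).
set J := (X in _ --> X).
have -> : J = (\int[lebesgue_R2d d]_(y in @of_coords R d @^-1` box x s)
     ((v (of_coords y) + c)%:E - (n%:R^-1)%:E * lne (cabs (peval q (of_coords y)))%:E))%E.
  apply: eq_integral => y _; apply/cvg_lim => //.
  exact: gap_trunc_cvg (cabs_ge0 _).
by move=> /cvge_to_le; apply; near=> k; exact: I.
Unshelve. all: by end_near. Qed.

End hartogs.

(** * Revealing independent coordinates *)
Section resampling.
Context {R : realFieldType} (I G : finType).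
Variable (pi : I -> G -> R).
Hypothesis pi_ge0 : forall i g, 0 <= pi i g.
Hypothesis pi_sum1 : forall i, \sum_g pi i g = 1.

Let wt (k : {ffun I -> G}) : R := \prod_i pi i (k i).

Definition update (k : {ffun I -> G}) i g : {ffun I -> G} :=
  [ffun j => if j == i then g else k j].

Let wt_update k i g : wt k * pi i g = wt (update k i g) * pi i (k i).
Proof.
rewrite /wt (bigD1 i)//= [in RHS](bigD1 i)//= ffunE eqxx.
rewrite (eq_bigr (fun j => pi j (update k i g j))); last first.
  by move=> j ji; rewrite ffunE (negbTE ji).
by rewrite mulrAC -mulrA mulrCA mulrA [RHS]mulrAC.
Qed.

(** The exchange of [k i] and [g] is a symmetry of the product weight. *)
Lemma resample i (h : {ffun I -> G} -> R) :
  \sum_k wt k * h k = \sum_k wt k * \sum_g pi i g * h (update k i g).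
Proof.
transitivity (\sum_k \sum_g wt k * pi i g * h k).
  apply: eq_bigr => k _; rewrite -mulr_suml -mulr_sumr.
  by rewrite pi_sum1 mulr1.
rewrite [RHS](eq_bigr (fun k => \sum_g wt k * pi i g * h (update k i g))); last first.
  by move=> k _; rewrite mulr_sumr; apply: eq_bigr => g _; rewrite mulrA.
rewrite !pair_big/=.
pose swap (kg : {ffun I -> G} * G) := (update kg.1 i kg.2, kg.1 i).
have swapK : involutive swap.
  case=> k g; rewrite /swap/=; congr pair; last by rewrite ffunE eqxx.
  by apply/ffunP => j; rewrite !ffunE; case: eqP => // ->.
rewrite (reindex_inj (inv_inj swapK))/=.
by apply: eq_bigr => -[k g] _ /=; rewrite -wt_update.
Qed.

(** Given the other coordinates, membership in [S] confines the coordinate that is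
    revealed last to a set of probability at most [q]; forgetting it, thanks to
    [resample], leaves a set of the same kind with one coordinate less. *)
Lemma nested_bound (rho : I -> G -> G -> Prop) (q : R) (s : seq I)
    (S : {set {ffun I -> G}}) : 0 <= q -> uniq s ->
  (forall i (D : {set G}) g0, (forall g, g \in D -> rho i g0 g) -> \sum_(g in D) pi i g <= q) ->
  (forall s1 i s2, s = s1 ++ i :: s2 -> forall k k', k \in S -> k' \in S ->
     (forall j, j \notin i :: s2 -> k j = k' j) -> rho i (k i) (k' i)) ->
  \sum_(k in S) wt k <= q ^+ size s.
Proof.
move=> q0 + rhoq; elim/last_ind: s S => [|s i IH] S.
  move=> _ _; rewrite expr0.
  have -> : 1 = \sum_k wt k.
    rewrite /wt -bigA_distr_bigA/=; apply/esym/big1 => i _; exact: pi_sum1.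
  rewrite [leRHS](bigID (mem S))/= lerDl sumr_ge0// => k _.
  by apply: prodr_ge0.
rewrite rcons_uniq => /andP[iNs us] nest.
(* [S'] forgets the coordinate revealed last. *)
pose S' : {set {ffun I -> G}} := [set k | [exists g, update k i g \in S]]%SET.
have H : \sum_(k in S') wt k <= q ^+ size s.
  apply: IH => // s1 j s2 sE k k'; rewrite !inE => /existsP[g kg] /existsP[g' kg'] kk'.
  have ji : j != i by apply: contraNneq iNs => <-; rewrite sE mem_cat mem_head orbT.
  have := nest s1 j (rcons s2 i) _ _ _ kg kg' _.
  rewrite !ffunE (negbTE ji); apply; first by rewrite sE rcons_cat.
  move=> l; rewrite inE mem_rcons inE !negb_or => /and3P[lj li ls2].
  by rewrite !ffunE (negbTE li) kk'// inE negb_or lj.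
rewrite size_rcons exprSr; apply: (@le_trans _ _ ((\sum_(k in S') wt k) * q)); last first.
  by rewrite ler_wpM2r.
rewrite big_mkcond/= (eq_bigr (fun k => wt k * (k \in S)%:R)); last first.
  by move=> k _; case: ifP; rewrite ?mulr1 ?mulr0.
rewrite (resample i) mulr_suml [leRHS]big_mkcond/=; apply: ler_sum => k _.
have w0 : 0 <= wt k by apply: prodr_ge0.
rewrite inE; case: ifPn => [/existsP [g0 kg0]|nS]; last first.
  rewrite big1 ?mulr0// => g _; move: nS; rewrite negb_exists => /forallP/(_ g).
  by move=> /negbTE ->; rewrite mulr0.
rewrite ler_wpM2l//.
rewrite (eq_bigr (fun g => if g \in [set g | update k i g \in S]%SET then pi i g else 0)); last first.
  by move=> g _; rewrite inE; case: ifP; rewrite ?mulr1 ?mulr0.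
rewrite -big_mkcond/=; apply: (rhoq i _ g0) => g; rewrite inE => kg.
have := nest s i [::] _ _ _ kg0 kg _; rewrite !ffunE eqxx; apply.
  by rewrite cats1.
by move=> l; rewrite inE => /negbTE li; rewrite !ffunE li.
Qed.

End resampling.

Section finite_valued.
Context d (T : measurableType d) {R : realType} (P : probability T R).

Lemma probability_fin_num (A : set T) : measurable A -> P A \is a fin_num.
Proof. by move=> mA; rewrite fin_num_measure. Qed.

Lemma probability_finite_valued (G : finType) (f : T -> G) (D : {set G}) :
  (forall g, measurable (f @^-1` [set g])) ->
  measurable (f @^-1` [set g | g \in D]) /\
  fine (P (f @^-1` [set g | g \in D])) = \sum_(g in D) fine (P (f @^-1` [set g])).
Proof.
move=> mf.
have E : f @^-1` [set g | g \in D] = \bigcup_(g in [set g | g \in D]) f @^-1` [set g].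
  by apply/seteqP; split=> [x fx|x [g gD /= fxg]]; [exists (f x)|rewrite /= fxg].
have mE : measurable (f @^-1` [set g | g \in D]).
  by rewrite E; apply: fin_bigcup_measurable.
split=> //.
rewrite sum_fine; last by move=> g _; exact: probability_fin_num.
congr fine; rewrite E measure_fin_bigcup//; last first.
  by apply/trivIsetP => g g' _ _ gg'; apply/seteqP; split=> x // [/= xg xg']; rewrite -xg -xg' eqxx in gg'.
rewrite (@fsbigE _ _ _ _ _ (enum D)) ?enum_uniq//=.
- rewrite big_enum_cond/=; apply: eq_bigl => g.
  by apply/andP/idP => [[]//|gD]; split=> //; exact/mem_set.
- by move=> g; rewrite /= mem_enum.
- by move=> g gD; rewrite mem_enum => /negP; rewrite gD.
Qed.

End finite_valued.

(** * Complex random variables *)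
Section borel_complex.
Context {R : realType}.

Lemma open_borelC (U : set R[i]) : open U -> measurable (U : set (borelC R)).
Proof. by move=> oU; exact: sub_sigma_algebra. Qed.

Lemma open_ReLt (c : R) : open [set z : R[i] | Re z < c].
Proof.
rewrite openE => z /= zc; apply/nbhs_C; exists (c - Re z); first by rewrite subr_gt0.
move=> y yz /=; have := le_lt_trans (Re_le_cabs _) yz.
by rewrite raddfB/= => /(le_lt_trans (ler_norm _)); rewrite ltrD2r.
Qed.

Lemma open_ImLt (c : R) : open [set z : R[i] | Im z < c].
Proof.
rewrite openE => z /= zc; apply/nbhs_C; exists (c - Im z); first by rewrite subr_gt0.
move=> y yz /=; have := le_lt_trans (Im_le_cabs _) yz.
by rewrite raddfB/= => /(le_lt_trans (ler_norm _)); rewrite ltrD2r.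
Qed.

Lemma open_cabs_gt (v : R[i]) (r : R) : open [set z : R[i] | r < cabs (z - v)].
Proof.
rewrite openE => z /= zr; apply/nbhs_C; exists (cabs (z - v) - r); first by rewrite subr_gt0.
move=> y yz /=; have := cabsD (z - y) (y - v).
by rewrite addrA subrK (cabsB z y); lra.
Qed.

Lemma measurable_cball (v : R[i]) (r : R) :
  measurable ([set z | cabs (z - v) <= r] : set (borelC R)).
Proof.
rewrite (_ : [set z | _] = ~` [set z | r < cabs (z - v)]).
  by apply: measurableC; apply: open_borelC; exact: open_cabs_gt.
by apply/seteqP; split=> z /=; rewrite leNgt => /negP.
Qed.

End borel_complex.

Section concentration.
Context d (T : measurableType d) {R : realType} (P : probability T R).
Implicit Types X : {RV P >-> borelC R}.

Lemma measurable_RV_preimage X (B : set (borelC R)) : measurable B ->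
  measurable (X @^-1` B).
Proof. by move=> mB; rewrite -[X in measurable X]setTI; exact: measurable_funP. Qed.

Definition concentrated X (r q : R) :=
  forall v : R[i], fine (P [set w | cabs (X w - v) <= r]) <= q.

Lemma measurable_RV_cball X v (r : R) : measurable [set w | cabs (X w - v) <= r].
Proof. exact: (measurable_RV_preimage X (measurable_cball v r)). Qed.

(** Otherwise there would be balls of radii tending to 0 whose complements have
    probabilities with an arbitrarily small sum; the intersection of these balls
    is a single point, which carries all the mass. *)
Lemma nondegenerate_not_concentrated X : nondegenerate_rv X ->
  exists r q, [/\ 0 < r, 0 <= q, q < 1 & concentrated X r q].
Proof.
move=> ndX; apply: contrapT => H.
have {}H (r q : R) : 0 < r -> 0 <= q -> q < 1 -> exists v : R[i], q < fine (P [set w | cabs (X w - v) <= r]).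
  move=> r0 q0 q1; apply: contrapT => nv; apply: H; exists r, q; split=> // v.
  by rewrite leNgt; apply/negP => qv; apply: nv; exists v.
have single K : exists u : R[i], ((1 - 2 ^- K)%:E <= P (X @^-1` [set u]))%E.
  pose eps : R := 2 ^- K.
  have eps0 : 0 < eps by rewrite invr_gt0 exprn_gt0.
  have eps1 : eps <= 1 by rewrite invf_le1 ?exprn_gt0// exprn_ege1// ler1n.
  pose dl (k : nat) : R := eps / (2 ^ k.+1)%:R.
  have dl0 k : 0 < dl k by rewrite divr_gt0// ltr0n expn_gt0.
  have dl1 k : dl k <= 1.
    by rewrite ler_pdivrMr ?ltr0n ?expn_gt0// mul1r (le_trans eps1)// ler1n expn_gt0.
  have /choice[v vP] : forall k : nat, exists v : R[i],
      1 - dl k < fine (P [set w | cabs (X w - v) <= k.+1%:R^-1]).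
    move=> k; apply: H; rewrite ?invr_gt0 ?ltr0n// ?subr_ge0//.
    by rewrite gtrBl.
  pose B k := [set w | cabs (X w - v k) <= k.+1%:R^-1].
  have mB k : measurable (B k) by exact: measurable_RV_cball.
  pose A := \bigcap_k B k.
  have mA : measurable A by exact: bigcapT_measurable.
  have PA : ((1 - eps)%:E <= P A)%E.
    have PAC : (P (~` A) <= eps%:E)%E.
      rewrite /A setC_bigcap.
      apply: (le_trans (measure_sigma_subadditive P _ _ (@subset_refl _ _))).
      - by move=> k; exact: measurableC.
      - by apply: bigcupT_measurable => k; exact: measurableC.
      apply: le_trans (epsilon_trick0 xpredT (ltW eps0)).
      apply: lee_nneseries => k _; first by [].
      rewrite /= probability_setC// -[P (B k)]fineK ?probability_fin_num// -EFinB lee_fin.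
      by rewrite lerBlDr -lerBlDl; exact: (ltW (vP k)).
    have := probability_setC P mA; rewrite -[P A]fineK ?probability_fin_num//.
    by move=> E; move: PAC; rewrite E -EFinB !lee_fin; lra.
  have [A0|/set0P[w0 Aw0]] := eqVneq A set0.
    have eps1' : 1 - eps <= 0 by move: PA; rewrite A0 measure0 lee_fin.
    exists 0; apply: (@le_trans _ _ 0%E) => //.
  exists (X w0); apply: (le_trans PA); apply: le_measure; rewrite ?inE//.
    apply: measurable_RV_preimage.
    rewrite (_ : [set X w0] = [set z | cabs (z - X w0) <= 0]); first exact: measurable_cball.
    apply/seteqP; split=> z /=; first by move=> ->; rewrite subrr Normc.normc0.
    move=> z0; apply/eqP; rewrite -subr_eq0 -cabs_eq0 eq_le z0/=; exact: cabs_ge0.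
  move=> w Aw /=; apply/eqP; rewrite -subr_eq0 -cabs_eq0 eq_le cabs_ge0 andbT.
  apply/ler_addgt0Pr => e e0; rewrite add0r.
  pose k := Num.truncn (2 / e).
  have ke : 2 / k.+1%:R <= e.
    by rewrite ler_pdivrMr ?ltr0n// mulrC -ler_pdivrMr// ltW// truncnS_gt.
  apply: le_trans ke; have := Aw k I; have := Aw0 k I; rewrite /B /= => h0 h.
  have := cabsD (X w - v k) (v k - X w0); rewrite addrA subrK (cabsB (v k)) => /le_trans; apply.
  by rewrite [2 / _]mulrDl mul1r lerD.
(* Two distinct points cannot both carry more than half of the mass, so that
   the point does not depend on [K]. *)
have [u0 Pu0] := single 2%N.
have m1 (u : R[i]) : measurable ([set u] : set (borelC R)).
  rewrite (_ : [set u] = [set z | cabs (z - u) <= 0]); first exact: measurable_cball.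
  apply/seteqP; split=> z /=; first by move=> ->; rewrite subrr Normc.normc0.
  move=> z0; apply/eqP; rewrite -subr_eq0 -cabs_eq0 eq_le z0/=; exact: cabs_ge0.
have mX (u : R[i]) : measurable (X @^-1` [set u]) by exact: measurable_RV_preimage.
have all K : (2 <= K)%N -> ((1 - 2 ^- K)%:E <= P (X @^-1` [set u0]))%E.
  move=> K2; have [u Pu] := single K; have [->//|uu0] := eqVneq u0 u.
  exfalso; have : (P (X @^-1` [set u]) <= P (~` (X @^-1` [set u0])))%E.
    apply: le_measure; rewrite ?inE//; first exact: measurableC.
    by move=> w /= xu xu0; rewrite -xu -xu0 eqxx in uu0.
  rewrite probability_setC//.
  rewrite -[P (X @^-1` [set u0])]fineK ?probability_fin_num//.
  rewrite -[P (X @^-1` [set u])]fineK ?probability_fin_num//.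
  rewrite -[P (X @^-1` [set u0])]fineK ?probability_fin_num// lee_fin in Pu0.
  rewrite -[P (X @^-1` [set u])]fineK ?probability_fin_num// lee_fin in Pu.
  rewrite -EFinB lee_fin.
  have : (2 ^- K : R) <= 2 ^- 2.
    by rewrite lef_pV2 ?posrE ?exprn_gt0// ler_weXn2l// ler1n.
  have : (2 ^- 2 : R) = 4^-1 by rewrite -natrX.
  move: Pu0 Pu => /=; move: (2 ^- 2) (2 ^- K) => x y; lra.
have /negP := ndX u0; apply; rewrite /distribution /= /pushforward.
rewrite eq_le probability_le1//=.
rewrite -[P _]fineK ?probability_fin_num// lee_fin; apply/ler_addgt0Pr => e e0.
pose K := (Num.truncn e^-1).+2.
have : (2 ^- K : R) <= e.
  rewrite invf_ple ?posrE ?exprn_gt0//.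
  apply: (le_trans (ltW (truncnS_gt _))); rewrite -natrX ler_nat.
  by apply: (leq_trans (ltnW (ltn_expl _ (isT : 1 < 2)%N))); rewrite leq_exp2l.
have := all K isT; rewrite -[P _]fineK ?probability_fin_num// lee_fin.
by move: (2 ^- K) => x; lra.
Qed.

End concentration.

(** * A small ball estimate for linear forms *)
Section small_ball.
Context d (T : measurableType d) {R : realType} (P : probability T R).

Section cells.
Variables (M xi : R) (M0 : 0 < M) (xi0 : 0 < xi).

Let h := xi / 2.
Let N := (Num.truncn (2 * M / h)).+2.
Let thr (i : nat) : R := - M + i%:R * h.

(** A cell records on which side of each of finitely many thresholds of mesh
    [xi / 2] the real and the imaginary part lie. *)
Definition cell_type : finType := (bool * {ffun 'I_N -> bool} * {ffun 'I_N -> bool})%type.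

Definition cell (x : R[i]) : cell_type :=
  (cabs x <= M, [ffun i : 'I_N => thr i <= Re x], [ffun i : 'I_N => thr i <= Im x]).

Let h0 : 0 < h. Proof. by rewrite divr_gt0. Qed.

Let thr_close (u t : R) : u <= t -> - M <= u <= M ->
  (forall i : 'I_N, (thr i <= u) = (thr i <= t)) -> t - u <= h.
Proof.
move=> ut /andP[Mu uM] E; rewrite leNgt; apply/negP => hut.
pose i := (Num.truncn ((u + M) / h)).+1.
have uM0 : 0 <= (u + M) / h by rewrite divr_ge0 ?(ltW h0)//; lra.
have i1 : u + M < i%:R * h by rewrite -ltr_pdivrMr// truncnS_gt.
have i2 : (Num.truncn ((u + M) / h))%:R * h <= u + M.
  by rewrite -ler_pdivlMr// truncn_le.
have iN : (i < N)%N.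
  rewrite ltnS /i ltnS; apply: le_truncn.
  by rewrite ler_pM2r ?invr_gt0//; lra.
have := E (Ordinal iN); rewrite /thr /=.
have -> : (- M + i%:R * h <= u) = false by apply/negbTE; rewrite -ltNge; lra.
move/esym/negbT/negP; apply.
by rewrite /i -natr1 mulrDl mul1r; lra.
Qed.

Let thr_close' (u t : R) : - M <= u <= M -> - M <= t <= M ->
  (forall i : 'I_N, (thr i <= u) = (thr i <= t)) -> `|u - t| <= h.
Proof.
move=> uM tM E; have [ut|tu] := leP u t.
  by rewrite distrC ger0_norm ?subr_ge0//; exact: thr_close.
by rewrite gtr0_norm ?subr_gt0//; apply: thr_close => //; exact: ltW.
Qed.

Lemma cell_close x y : cell x = cell y -> cabs x <= M -> cabs y <= M ->
  cabs (x - y) <= xi.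
Proof.
move=> [_ /ffunP E1 /ffunP E2] xM yM.
apply: (le_trans (cabs_le_ReIm _)); rewrite !raddfB/= (splitr xi).
have RM z : cabs z <= M -> - M <= Re z <= M.
  by move=> zM; rewrite -ler_norml (le_trans (Re_le_cabs _)).
have IM z : cabs z <= M -> - M <= Im z <= M.
  by move=> zM; rewrite -ler_norml (le_trans (Im_le_cabs _)).
by apply: lerD; apply: thr_close'; rewrite ?RM ?IM// => i;
  [have := E1 i|have := E2 i]; rewrite !ffunE.
Qed.

Lemma measurable_cell g : measurable (cell @^-1` [set g] : set (borelC R)).
Proof.
have mb (A : set (borelC R)) (b : bool) : measurable A ->
    measurable ([set x | (x \in A) = b] : set (borelC R)).
  case: b => mA.
    by rewrite (_ : [set x | _] = A)//; apply/seteqP; split=> x /=; [move/set_mem|move/mem_set].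
  rewrite (_ : [set x | _] = ~` A); first exact: measurableC.
  by apply/seteqP; split=> x /=; [move=> xA Ax; rewrite mem_set in xA|exact: memNset].
have mRe c : measurable ([set z | c <= Re z] : set (borelC R)).
  rewrite (_ : [set z | _] = ~` [set z : R[i] | Re z < c]).
    by apply: measurableC; apply: open_borelC; exact: open_ReLt.
  by apply/seteqP; split=> z /=; rewrite leNgt => /negP.
have mIm c : measurable ([set z | c <= Im z] : set (borelC R)).
  rewrite (_ : [set z | _] = ~` [set z : R[i] | Im z < c]).
    by apply: measurableC; apply: open_borelC; exact: open_ImLt.
  by apply/seteqP; split=> z /=; rewrite leNgt => /negP.
case: g => -[b g1] g2.
rewrite (_ : _ @^-1` _ =
  [set x : borelC R | (x \in [set z | cabs (z - 0) <= M]) = b] `&`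
  (\bigcap_(i in [set: 'I_N]) [set x : borelC R | (x \in [set z | thr i <= Re z]) = g1 i] `&`
   \bigcap_(i in [set: 'I_N]) [set x : borelC R | (x \in [set z | thr i <= Im z]) = g2 i])).
  apply: measurableI; first by apply: mb; exact: measurable_cball.
  apply: measurableI; apply: fin_bigcap_measurable => // i _; exact: mb.
have inb (Q : R[i] -> bool) (x : R[i]) : (x \in [set z | Q z]) = Q x.
  by apply/idP/idP => [/set_mem//|Qx]; exact/mem_set.
apply/seteqP; split=> x.
  move=> [/= <- <- <-]; split; first by rewrite /= inb subr0.
  by split=> i _ /=; rewrite inb ffunE.
move=> [/= + [h1 h2]]; rewrite inb subr0 => xb; rewrite /cell xb.
congr (_, _, _); apply/ffunP => i; rewrite ffunE.
  by have := h1 i Logic.I; rewrite /= inb.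
by have := h2 i Logic.I; rewrite /= inb.
Qed.

End cells.

Lemma joint_law (G : finType) (f : borelC R -> G) m (a : nat -> {RV P >-> borelC R})
    (k : {ffun 'I_m -> G}) : mutually_independent a ->
  (forall g, measurable (f @^-1` [set g])) ->
  measurable ((fun w => [ffun j : 'I_m => f (a j w)]) @^-1` [set k]) /\
  fine (P ((fun w => [ffun j : 'I_m => f (a j w)]) @^-1` [set k])) =
  \prod_(j < m) fine (P ((fun w => f (a j w)) @^-1` [set k j])).
Proof.
move=> ind mf.
pose B (j : nat) : set (borelC R) := if insub j is Some o then f @^-1` [set k o] else setT.
have mB j : measurable (B j) by rewrite /B; case: insub.
pose J := seq_fset tt (iota 0 m).
have BE (j : 'I_m) : B j = f @^-1` [set k j] by rewrite /B valK.
have E : (fun w => [ffun j : 'I_m => f (a j w)]) @^-1` [set k] =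
    \bigcap_(j in [set` J]) (a j @^-1` B j).
  apply/seteqP; split=> w.
    move=> /= wk j; rewrite /= seq_fsetE mem_iota add0n /= => jm.
    by rewrite (BE (Ordinal jm)) /= -wk ffunE.
  move=> h; apply/ffunP => j; rewrite ffunE.
  have := h j; rewrite /= seq_fsetE mem_iota add0n ltn_ord => /(_ isT).
  by rewrite BE.
have mE : measurable ((fun w => [ffun j : 'I_m => f (a j w)]) @^-1` [set k]).
  rewrite E; apply: bigcap_measurableType => j _; exact: measurable_RV_preimage.
split=> //.
have PE : P ((fun w => [ffun j : 'I_m => f (a j w)]) @^-1` [set k]) =
    (\prod_(j < m) (fine (P (a j @^-1` B j)))%:E)%E.
  rewrite E ind// (perm_big _ (seq_fset_perm tt (iota 0 m)))/= undup_id ?iota_uniq//.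
  rewrite -{1}[m]subn0 -/(index_iota 0 m) big_mkord; apply: eq_bigr => j _.
  by rewrite fineK// probability_fin_num//; exact: measurable_RV_preimage.
rewrite PE prodEFin/=; apply: eq_bigr => j _.
by rewrite BE.
Qed.

(** The coordinates [a i], for [i] in [s], are revealed one after the other: on
    [E], each of them is determined up to the error [r] by the coordinates
    revealed before it, since those revealed after it contribute little to the
    linear form [c i].  Cutting the range of the variables into finitely many
    small cells makes the conditioning elementary. *)
Lemma small_ball m (a : nat -> {RV P >-> borelC R}) (r q M : R) (s : seq 'I_m)
    (c : 'I_m -> 'I_m -> R[i]) (E : set T) :
  mutually_independent a -> (forall j, concentrated (a j) r q) ->
  0 < r -> 0 <= q -> 0 < M -> uniq s ->
  (forall i, i \in s -> c i i = 1) ->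
  (forall w, E w -> forall j : 'I_m, cabs (a j w) <= M) ->
  (forall w, E w -> forall i, i \in s ->
     cabs (\sum_(j < m) c i j * a j w) <= r / 8) ->
  (forall s1 i s2, s = s1 ++ i :: s2 ->
     2 * M * \sum_(j <- s2) cabs (c i j) <= r / 4) ->
  exists E', [/\ measurable E', E `<=` E' & fine (P E') <= q ^+ size s].
Proof.
move=> ind conc r0 q0 M0 us cii EM Esum tail.
pose C := 1 + \sum_(i < m) \sum_(j < m) cabs (c i j).
have C0 : 0 < C.
  by rewrite ltr_pwDl// !sumr_ge0// => i _; rewrite sumr_ge0// => j _; exact: cabs_ge0.
have C1 : 1 <= C.
  by rewrite lerDl !sumr_ge0// => i _; rewrite sumr_ge0// => j _; exact: cabs_ge0.
pose xi := r / (8 * C).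
have xi0 : 0 < xi by rewrite divr_gt0// mulr_gt0.
have xir : xi <= r / 8.
  rewrite /xi ler_pM2l// lef_pV2 ?posrE ?mulr_gt0//.
  by rewrite -[leLHS]mulr1 ler_pM2l.
pose f := @cell M xi.
have mf := @measurable_cell M xi.
pose F w := [ffun j : 'I_m => f (a j w)].
pose S : {set {ffun 'I_m -> cell_type M xi}} := [set k | `[< exists2 w, E w & F w = k >]]%SET.
have law k := joint_law k ind mf.
have mF k : measurable (F @^-1` [set k]) := (law m k).1.
have [mS PS] := probability_finite_valued P S mF.
exists (F @^-1` [set k | k \in S]); split=> //.
  by move=> w Ew /=; rewrite inE; apply/asboolP; exists w.
rewrite PS (eq_bigr _ (fun k _ => (law m k).2)).
pose p (j : 'I_m) g := fine (P ((fun w => f (a j w)) @^-1` [set g])).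
have mfa (j : 'I_m) g : measurable ((fun w => f (a j w)) @^-1` [set g]).
  exact: (measurable_RV_preimage (a j) (mf g)).
(* Two cells are related when they contain values at distance at most
   [5 / 8 * r]; as the diameter of a cell is at most [r / 8], all cells related
   to a given one lie in a ball of radius [r]. *)
pose rho (i : 'I_m) g g' := exists x y, [/\ f x = g, f y = g',
  cabs x <= M, cabs y <= M & cabs (x - y) <= 5 / 8 * r].
apply: (@nested_bound R _ _ p _ _ rho) => //.
- by move=> i g; rewrite fine_ge0.
- move=> i; have [_] := probability_finite_valued P [set: cell_type M xi]%SET (mfa i).
  rewrite (_ : _ @^-1` _ = setT); last by apply/seteqP; split=> w //= _; rewrite inE.
  rewrite probability_setT/= => /esym; rewrite (eq_bigl predT)// => g.
  by rewrite inE.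
- move=> i D g0 Dg; have [mD PD] := probability_finite_valued P D (mfa i).
  rewrite -PD; have [D0|[g1 g1D]] := set_0Vmem D.
    rewrite (_ : _ @^-1` _ = set0) ?measure0//.
    by apply/seteqP; split=> w //=; rewrite D0 inE.
  have [x0 [_ [x0g _ x0M _ _]]] := Dg _ g1D.
  apply: le_trans (conc i x0); apply: fine_le.
  + by apply: probability_fin_num.
  + by apply: probability_fin_num; exact: measurable_RV_cball.
  apply: le_measure; rewrite ?inE//; first exact: measurable_RV_cball.
  move=> w /= wD; have [x [y [xg yg xM yM xy]]] := Dg _ wD.
  have wM : cabs (a i w) <= M.
    by move: yg => [<- _ _].
  have d1 := cell_close xi0 yg yM wM.
  have xx0 : f x = f x0 by rewrite xg.
  have d2 := cell_close xi0 xx0 xM x0M.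
  have := cabsD (a i w - y) (y - x0); rewrite addrA subrK.
  have := cabsD (y - x) (x - x0); rewrite addrA subrK.
  rewrite (cabsB (a i w)) (cabsB y x); move: d1 d2 xy xir; lra.
have SP k : k \in S -> exists2 w, E w & F w = k by rewrite inE => /asboolP.
move=> s1 i s2 sE k k' /SP[w Ew Fw] /SP[w' Ew' Fw'] ww'.
have iS : i \in s by rewrite sE mem_cat mem_head orbT.
rewrite /rho; exists (a i w); exists (a i w'); split; [by rewrite -Fw ffunE|by rewrite -Fw' ffunE|exact: EM|exact: EM|].
pose D j := a j w - a j w' : R[i].
have uis2 : uniq (i :: s2) by move: us; rewrite sE cat_uniq => /and3P[].
have e1 : cabs (\sum_(j < m) c i j * D j) <= r / 4.
  rewrite (eq_bigr (fun j : 'I_m => c i j * a j w - c i j * a j w')); last first.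
    by move=> j _; rewrite /D mulrBr.
  rewrite sumrB; apply: (le_trans (cabsD _ _)); rewrite cabsN.
  have := Esum _ Ew _ iS; have := Esum _ Ew' _ iS; lra.
rewrite (bigD1 i)//= cii// mul1r in e1.
have e2 : cabs (\sum_(j < m | j != i) c i j * D j) <= r / 8 + r / 4.
  apply: (le_trans (cabs_sum _ _ _)).
  rewrite (bigID (fun j => j \in s2))/= addrC; apply: lerD.
    apply: (@le_trans _ _ (\sum_(j < m) cabs (c i j) * xi)).
      rewrite big_mkcond/=; apply: ler_sum => j _.
      case: ifP => [/andP[ji js2]|_]; last by rewrite mulr_ge0 ?cabs_ge0 ?(ltW xi0).
      rewrite cabsM ler_wpM2l ?cabs_ge0//; apply: (@cell_close M xi xi0); [|exact: EM|exact: EM].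
      have := ww' j; rewrite inE negb_or ji js2 => /(_ isT).
      by rewrite -Fw -Fw' !ffunE.
    rewrite -mulr_suml /xi mulrC -mulrA ler_pM2l//.
    rewrite invfM -mulrA -[leRHS]mulr1 ler_pM2l ?invr_gt0// ler_pdivrMl// mulr1.
    rewrite /C [X in _ <= 1 + X](bigD1 i)//= addrCA lerDl addr_ge0// sumr_ge0// => j _.
    by rewrite sumr_ge0// => l _; exact: cabs_ge0.
  apply: le_trans (tail _ _ _ sE).
  rewrite mulr_sumr (eq_bigl (fun j => j \in s2)); last first.
    move=> j; case js2: (j \in s2); rewrite ?andbF// andbT.
    by apply: contraTneq js2 => ->; move: uis2 => /= /andP[].
  rewrite -big_uniq/=; last by move: uis2 => /andP[].
  apply: ler_sum => j _; rewrite cabsM mulrC ler_wpM2r ?cabs_ge0//.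
  apply: (le_trans (cabsD _ _)); rewrite cabsN mulr_natl mulr2n.
  by apply: lerD; exact: EM.
have := cabsD (D i + \sum_(j < m | j != i) c i j * D j) (- \sum_(j < m | j != i) c i j * D j).
rewrite addrK cabsN /D; lra.
Qed.

End small_ball.

(** * Zero polynomials and dual functionals *)
Section zero_polynomial.

Lemma base_expansion_inj N n (f g : nat -> nat) :
  (forall i, (i < n)%N -> (f i < N)%N /\ (g i < N)%N) ->
  (\sum_(i < n) f i * N ^ i = \sum_(i < n) g i * N ^ i)%N ->
  forall i, (i < n)%N -> f i = g i.
Proof.
elim: n f g => [//|n IH] f g fgN.
have [f0 g0] := fgN 0%N isT.
have shiftE (h : nat -> nat) :
    (\sum_(i < n.+1) h i * N ^ i = h 0 + N * \sum_(i < n) h i.+1 * N ^ i)%N.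
  rewrite big_ord_recl expn0 muln1; congr addn; rewrite big_distrr/=.
  by apply: eq_bigr => i _; rewrite expnS mulnCA.
rewrite !shiftE => E.
have N0 : (0 < N)%N by exact: leq_ltn_trans f0.
have e0 : f 0%N = g 0%N.
  have := congr1 (modn^~ N) E; rewrite /= ![(N * _)%N]mulnC ![(_ + _ * N)%N]addnC !modnMDl.
  by rewrite !modn_small.
case=> [//|i] iN; apply: (IH (f \o succn) (g \o succn)) => //.
  by move=> j jn; exact: fgN.
by move/eqP: E; rewrite e0 eqn_add2l eqn_pmul2l// => /eqP.
Qed.

(** Kronecker's substitution ['X_i |-> t ^ (N ^ i)] reduces the claim to one
    variable. *)
Lemma peval_eq0 (R : realType) d (q : mpoly d R[i]) :
  (forall z, peval q z = 0) -> q = 0.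
Proof.
move=> qz; pose N := (msize q).+1.
pose e (m : multinom d) := (\sum_(i < d) m i * N ^ i)%N.
pose Q : {poly R[i]} := \sum_(m <- msupp q) (mcoeff m q) *: 'X^(e m).
have Qt t : Q.[t] = 0.
  rewrite -(qz (\row_i t ^+ (N ^ i))) /peval mevalE horner_sum.
  apply: eq_bigr => m _; rewrite hornerZ hornerXn; congr (_ * _).
  rewrite /e expr_sum; apply: eq_bigr => i _.
  by rewrite mxE -exprM mulnC.
have Q0 : Q = 0.
  apply: (@roots_geq_poly_eq0 _ _ [seq (k%:R : R[i]) | k <- iota 0 (size Q)]).
  - by apply/allP => t _; apply/eqP; exact: Qt.
  - rewrite map_inj_uniq ?iota_uniq// => x y /eqP.
    by rewrite eqr_nat => /eqP.
  - by rewrite size_map size_iota.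
apply/eqP; apply: contraT => qn0.
have /hasP[m mq _] : has predT (msupp q).
  by rewrite has_predT lt0n size_eq0 msupp_eq0.
have mlt (m' : multinom d) i : m' \in msupp q -> (m' i < N)%N.
  move=> m'q; rewrite ltnS ltnW//; apply: leq_ltn_trans (msize_mdeg_lt m'q).
  by rewrite mdegE (bigD1 i)//= leq_addr.
have einj m' : m' \in msupp q -> e m' = e m -> m' = m.
  move=> m'q em; apply/mnmP => i.
  pose ext (m0 : multinom d) j := if insub j is Some i0 then m0 (i0 : 'I_d) else 0%N.
  have extE (m0 : multinom d) (i0 : 'I_d) : ext m0 i0 = m0 i0 by rewrite /ext valK.
  rewrite -!extE; apply: (@base_expansion_inj N d) => // [j jd|].
    by rewrite -[j]/(val (Ordinal jd)) !extE !mlt.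
  have sumE m0 : (\sum_(i < d) ext m0 i * N ^ i = e m0)%N.
    by apply: eq_bigr => j _; rewrite extE.
  by rewrite !sumE.
have := congr1 (fun p : {poly R[i]} => p`_(e m)) Q0.
rewrite /= coef0 coef_sum (bigD1_seq m mq (msupp_uniq q))/=.
rewrite coefZ coefXn eqxx mulr1 big_seq_cond big1 ?addr0.
  by move=> /eqP; rewrite mcoeff_eq0 mq.
move=> m' /andP[m'q m'm]; rewrite coefZ coefXn.
case: eqP => [em|]; last by rewrite mulr0.
by rewrite (einj m' m'q) ?eqxx// in m'm.
Qed.

(** On the complex line through [x] and a given point, the polynomial vanishes on
    a circle, hence everywhere by [poly_growth]. *)
Lemma peval_box_eq0 (R : realType) d (q : mpoly d R[i]) x (s : R) : 0 < s ->
  (forall z, box x s z -> peval q z = 0) -> q = 0.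
Proof.
move=> s0 qbox; apply: peval_eq0 => z.
pose D := 1 + \sum_(i < d) cabs (z ord0 i - x ord0 i).
have D0 : 0 < D by rewrite ltr_pwDl// sumr_ge0// => i _; exact: cabs_ge0.
pose t := s / D; have t0 : 0 < t by rewrite divr_gt0.
have [Q _ QE] := line_poly q x ((t%:C%C : R[i]) *: (z - x)).
have Q1 l : cabs l = 1 -> Q.[l] = 0.
  move=> l1; rewrite QE; apply: qbox => i.
  have h : cabs ((x + l *: (t%:C%C *: (z - x))) ord0 i - x ord0 i) <= s.
    have -> : (x + l *: (t%:C%C *: (z - x))) ord0 i - x ord0 i =
      l * (t%:C%C * (z ord0 i - x ord0 i)) by rewrite !mxE; ring.
    rewrite cabsM l1 mul1r cabsM cabs_real gtr0_norm// /t mulrAC ler_pdivrMr//.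
    rewrite ler_pM2l// /D (bigD1 i)//= addrCA lerDl addr_ge0// sumr_ge0// => j _.
    exact: cabs_ge0.
  by split; apply: le_trans h; [exact: Re_le_cabs|exact: Im_le_cabs].
have -> : peval q z = Q.[(t^-1)%:C%C].
  by rewrite QE scalerA -rmorphM mulVf ?gt_eqF// rmorph1 scale1r addrC subrK.
apply/eqP; rewrite -cabs_eq0 eq_le cabs_ge0 andbT; apply/ler_addgt0Pr => e e0.
rewrite add0r.
set l := (t^-1)%:C%C; pose n := size Q.
have l0 : 0 < (1 + cabs l) ^+ n by rewrite exprn_gt0// ltr_pwDl// cabs_ge0.
have e'0 : 0 < e / (1 + cabs l) ^+ n by rewrite divr_gt0.
have := @poly_growth R Q n _ l (leqnSn _) e'0.
rewrite mulfVK ?gt_eqF//; apply => y y1.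
by rewrite Q1// Normc.normc0 ltW.
Qed.

End zero_polynomial.

Section dual_functionals.
Context {R : realType} (X : Type) (B : set X).

(** Such functionals recover coefficients of a combination of the [f j] from its
    values on [B], with an error controlled by its supremum there. *)
Definition bounded_functional (phi : (X -> R[i]) -> R[i]) :=
  (forall c f g, phi (fun z => c * f z + g z) = c * phi f + phi g) /\
  exists2 C : R, 0 <= C &
    forall f l, (forall z, B z -> cabs (f z) <= l) -> cabs (phi f) <= C * l.

Lemma bounded_functional0 phi : bounded_functional phi -> phi (fun=> 0) = 0.
Proof.
move=> [lin _]; have := lin (-1) (fun=> 0) (fun=> 0).
by under [X in phi X = _]eq_fun do rewrite mulr0 addr0; rewrite mulN1r addNr.
Qed.

Lemma bounded_functional_sum phi (I : Type) (s : seq I) (c : I -> R[i]) (f : I -> X -> R[i]) :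
  bounded_functional phi ->
  phi (fun z => \sum_(i <- s) c i * f i z) = \sum_(i <- s) c i * phi (f i).
Proof.
move=> bphi; elim: s => [|i s IH].
  by under [X in phi X = _]eq_fun do rewrite big_nil; rewrite big_nil bounded_functional0.
under [X in phi X = _]eq_fun do rewrite big_cons.
by rewrite (proj1 bphi) IH big_cons.
Qed.

Lemma bounded_functional_eval x : B x -> bounded_functional (fun f => f x).
Proof. by move=> Bx; split=> //; exists 1 => // f l fl; rewrite mul1r fl. Qed.

Lemma bounded_functional_lin phi psi c : bounded_functional phi ->
  bounded_functional psi -> bounded_functional (fun f => c * phi f + psi f).
Proof.
move=> [lphi [C1 C10 bphi]] [lpsi [C2 C20 bpsi]]; split.
  by move=> e f g; rewrite lphi lpsi; ring.
exists (cabs c * C1 + C2); first by rewrite addr_ge0// mulr_ge0// cabs_ge0.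
move=> f l fl; apply: (le_trans (cabsD _ _)); rewrite cabsM mulrDl lerD//; last exact: bpsi.
by rewrite -mulrA ler_wpM2l ?cabs_ge0//; exact: bphi.
Qed.

Lemma bounded_functional_sumf (I : Type) (s : seq I) (c : I -> R[i]) phi :
  (forall i, bounded_functional (phi i)) ->
  bounded_functional (fun f => \sum_(i <- s) c i * phi i f).
Proof.
move=> bphi; elim: s => [|i s IH].
  under eq_fun do rewrite big_nil; split; first by move=> *; rewrite mulr0 addr0.
  by exists 0 => // f l _; rewrite mul0r Normc.normc0.
by under eq_fun do rewrite big_cons; exact: bounded_functional_lin.
Qed.

(** By induction: since [f L] is independent of the previous functions on [B], it
    differs at some point [z0] of [B] from the combination of these that the
    previous functionals prescribe; evaluation at [z0], corrected by the previous
    functionals, is the new one, and it is subtracted from the others. *)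
Lemma dual_functionals (f : nat -> X -> R[i]) L :
  (forall b : 'I_L -> R[i], (forall z, B z -> \sum_(j < L) b j * f j z = 0) ->
     forall j, b j = 0) ->
  exists phi : 'I_L -> (X -> R[i]) -> R[i],
    (forall i, bounded_functional (phi i)) /\
    (forall i j : 'I_L, phi i (f j) = (i == j)%:R).
Proof.
elim: L => [|L IH] indep; first by exists (fun _ _ => 0); split=> -[].
have [|phi [bphi dphi]] := IH.
  move=> b bz j.
  pose b' (j : 'I_L.+1) := if unlift ord_max j is Some j' then b j' else 0.
  have b'E (j' : 'I_L) : b' (widen_ord (leqnSn L) j') = b j'.
    rewrite /b'; have -> : widen_ord (leqnSn L) j' = lift ord_max j'.
      by apply: val_inj; rewrite /= /bump leqNgt ltn_ord.
    by rewrite liftK.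
  rewrite -b'E; apply: indep => z Bz; rewrite big_ord_recr/= {2}/b' unlift_none mul0r addr0.
  by rewrite -[RHS](bz z Bz); apply: eq_bigr => j' _; rewrite b'E.
pose g z := f L z - \sum_(j < L) phi j (f L) * f j z.
have [z0 Bz0 gz0] : exists2 z, B z & g z != 0.
  apply: contrapT => ng.
  pose b (j : 'I_L.+1) := if unlift ord_max j is Some j' then - phi j' (f L) else 1.
  have : b ord_max = 0.
    apply: indep => z Bz; rewrite big_ord_recr/= {2}/b unlift_none mul1r.
    have gz0 : g z = 0 by apply/eqP; apply: contrapT => /negP gz; apply: ng; exists z.
    rewrite -[RHS]gz0 /g addrC -sumrN; congr (_ + _); apply: eq_bigr => j _.
    rewrite /b; have -> : widen_ord (leqnSn L) j = lift ord_max j.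
      by apply: val_inj; rewrite /= /bump leqNgt ltn_ord.
    by rewrite liftK mulNr.
  by rewrite /b unlift_none => /eqP; rewrite oner_eq0.
pose psi (h : X -> R[i]) := (g z0)^-1 * h z0 + \sum_(j < L) (- (g z0)^-1 * f j z0) * phi j h.
have bpsi : bounded_functional psi.
  apply: bounded_functional_lin; first exact: bounded_functional_eval.
  exact: bounded_functional_sumf.
have psiE h : psi h = (g z0)^-1 * (h z0 - \sum_(j < L) f j z0 * phi j h).
  rewrite /psi mulrBr; congr (_ + _); rewrite mulr_sumr -sumrN.
  by apply: eq_bigr => j _; rewrite mulNr mulNr mulrA.
have psif (j : 'I_L) : psi (f j) = 0.
  rewrite psiE (bigD1 j)//= dphi eqxx mulr1 big1 ?addr0 ?subrr ?mulr0// => k kj.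
  by rewrite dphi (negbTE kj) mulr0.
have psiL : psi (f L) = 1.
  rewrite psiE.
  have -> : f L z0 - \sum_(j < L) f j z0 * phi j (f L) = g z0.
    by rewrite /g; congr (_ - _); apply: eq_bigr => j _; rewrite mulrC.
  by rewrite mulVf.
exists (fun i => if unlift ord_max i is Some i' then
    (fun h => (- phi i' (f L)) * psi h + phi i' h) else psi).
split.
  by move=> i; case: unliftP => [i' _|_]//; exact: bounded_functional_lin.
have liftE (j : 'I_L) : f (lift ord_max j) = f j.
  by rewrite /= /bump leqNgt ltn_ord.
move=> i j; case: (unliftP ord_max i) => [i' ->|->]; case: (unliftP ord_max j) => [j' ->|->].
- by rewrite liftE psif mulr0 add0r dphi (inj_eq lift_inj).
- by rewrite psiL mulr1 addNr eq_sym (negbTE (neq_lift _ _)).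
- by rewrite liftE psif (negbTE (neq_lift _ _)).
- by rewrite psiL eqxx.
Qed.

End dual_functionals.

(** * Growth of the basis *)
Section growth_of_basis.
Context {R : realType} (d : nat).
Variables (d_gt0 : (0 < d)%N) (K : set 'rV[R[i]]_d).
Variables (p : nat -> mpoly d R[i]) (p0 : p 0%N = 1).
Hypothesis p_le1 : forall j, (supnorm K (p j) <= 1)%E.
Hypothesis p_basis : forall n,
     basis_of_set (poly_space d n) (fun j : 'I_(poly_dim d n) => p j).
Hypothesis Bn_cvg : forall Y : nat -> nat, {homo Y : m n / (m < n)%N} ->
     exists (Y0 : nat -> nat) (w : nat -> 'rV[R[i]]_d),
       [/\ {homo Y0 : m n / (m < n)%N}, dense (range w) &
         forall r : nat,
           (let n := Y (Y0 k) in ((2 * n%:R)^-1 * ln (sq_sum p n (w r)))%:E)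
             @[k --> \oo] --> extremal_function K (w r)].
Variable v : 'rV[R[i]]_d -> R.
Hypothesis vE : forall z, extremal_function K z = (v z)%:E.

Lemma ln_sublinear_nat (c : R) : 0 < c ->
  exists N, forall n, (N <= n)%N -> ln n.+1%:R <= c * n%:R.
Proof.
move=> c0; exists (Num.truncn (8 / c ^+ 2)).+1 => n Nn.
have n1 : (1 <= n)%N by exact: leq_trans Nn.
have n1' : 1 <= n%:R :> R by rewrite ler1n.
have hn : 8 / c ^+ 2 <= n%:R.
  by apply: (le_trans (ltW (truncnS_gt _))); rewrite ler_nat.
rewrite ler_pdivrMr ?exprn_gt0// in hn.
have S0 : (0 : R) < Num.sqrt n.+1%:R by rewrite sqrtr_gt0 ltr0n.
have -> : ln n.+1%:R = 2 * ln (Num.sqrt n.+1%:R) :> R.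
  by rewrite mulr_natl -lnXn// sqr_sqrtr// ler0n.
apply: (@le_trans _ _ (2 * Num.sqrt n.+1%:R)).
  rewrite ler_pM2l//; apply: ltW; exact: ln_sublinear.
rewrite -(@ler_pXn2r _ 2)// ?nnegrE ?mulr_ge0 ?(ltW c0) ?sqrtr_ge0//.
rewrite !exprMn sqr_sqrtr ?ler0n// -natr1.
by nra.
Qed.

Lemma poly_dim_gt0 n : (0 < poly_dim d n)%N.
Proof.
rewrite /poly_dim; apply/card_gt0P.
have h : (mdeg (mnm0 : multinom d) < n.+1)%N by rewrite mdeg0.
by exists (BMultinom h).
Qed.

Lemma poly_dim_ge n : (n < poly_dim d n)%N.
Proof.
rewrite /poly_dim -[X in (X <= _)%N]card_ord.
have h (j : 'I_n.+1) : (mdeg (mnm_muln (mnm1 (Ordinal d_gt0)) j) < n.+1)%N.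
  by rewrite mdegMn mdeg1 mul1n.
apply: (@leq_card _ _ (fun j : 'I_n.+1 => BMultinom (h j))) => j j' /(congr1 (fun m => bmnm m (Ordinal d_gt0))).
by rewrite /= !mulmnE mnm1E eqxx !mul1n => /ord_inj.
Qed.

Lemma poly_dim_mono m n : (m <= n)%N -> (poly_dim d m <= poly_dim d n)%N.
Proof.
move=> mn; rewrite /poly_dim.
have h (k : bmultinom d m.+1) : (mdeg (bmnm k) < n.+1)%N.
  by rewrite (leq_trans (bmdeg k))// ltnS.
apply: (@leq_card _ _ (fun k => BMultinom (h k))) => k k' /(congr1 (@bmnm _ _)) /= kk'.
exact: val_inj.
Qed.

Lemma basis_degree n (j : 'I_(poly_dim d n)) : (msize (p j) <= n.+1)%N.
Proof. by have [+ _ _] := p_basis n; exact. Qed.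

(** The Bernstein-Walsh inequality: [ln (max 1 |p j|) / n] is a competitor in the
    definition of the extremal function. *)
Lemma basis_le_expR n j z : (0 < n)%N -> (j < poly_dim d n)%N ->
  cabs (peval (p j) z) <= expR (n%:R * v z).
Proof.
move=> n0 jn; have := log_plus_le_extremal z n0 (basis_degree (Ordinal jn)) (p_le1 j).
rewrite vE lee_fin /log_plus ler_pdivrMl ?ltr0n// => h.
apply: (@le_trans _ _ (Num.max 1 (cabs (peval (p j) z)))).
  by rewrite le_max lexx orbT.
by rewrite -ler_ln ?posrE ?expR_gt0 ?lt_max ?ltr01// expRK.
Qed.

Lemma sq_sum_gt0 n z : 0 < sq_sum p n z.
Proof.
rewrite /sq_sum (bigD1 (Ordinal (poly_dim_gt0 n)))//= p0 /peval meval1 Normc.normc1.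
by rewrite expr1n ltr_pwDl// sumr_ge0// => j _; rewrite sqr_ge0.
Qed.

(** The hypothesis on subsequences amounts to a lower bound that holds for all
    large degrees: otherwise it would fail along a subsequence. *)
Lemma eventually_large_basis x (s e : R) : 0 < s -> 0 < e ->
  exists N, forall n, (N <= n)%N -> exists2 z, box x s z &
    exists2 j, (j < poly_dim d n)%N &
      expR (n%:R * (v z - e)) <= cabs (peval (p j) z).
Proof.
move=> s0 e0; apply: contrapT => noN.
have {}noN N : exists n, (N <= n)%N /\ forall z j, box x s z -> (j < poly_dim d n)%N ->
    cabs (peval (p j) z) < expR (n%:R * (v z - e)).
  apply: contrapT => H; apply: noN; exists N => n Nn; apply: contrapT => H2.
  apply: H; exists n; split=> // z j zb jn; rewrite ltNge; apply/negP => le.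
  by apply: H2; exists z => //; exists j.
(* A strictly increasing sequence of degrees at which the bound fails. *)
have [f fP] := choice noN.
pose Y := fix Y k := if k is k'.+1 then f (Y k').+1 else f 1%N.
have Ylt k : (Y k < Y k.+1)%N by exact: (proj1 (fP _)).
have Yinc : {homo Y : m n / (m < n)%N}.
  exact: (homo_ltn ltn_trans Ylt).
have Yfail k z j : box x s z -> (j < poly_dim d (Y k))%N ->
    cabs (peval (p j) z) < expR ((Y k)%:R * (v z - e)).
  by case: k => [|k]; exact: (proj2 (fP _)).
have Ygek k : (k < Y k)%N.
  elim: k => [|k IH]; first exact: (proj1 (fP _)).
  exact: leq_ltn_trans (Ylt k).
have [Y0 [w [Y0inc wd wV]]] := Bn_cvg Yinc.
have [_ [r _ <-] wbox] : exists2 y, range w y & box x s y.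
  apply: (@dense_nbhs _ _ x _ wd).
  apply/nbhs_Cd; exists s => // y yx i.
  by split; apply/ltW; apply: le_lt_trans (yx i); [exact: Re_le_cabs|exact: Im_le_cabs].
have := wV r; rewrite vE => /fine_cvgP[_]; rewrite /= => cw.
have de0 : 0 < e / (2 * d%:R + 1).
  by rewrite divr_gt0// addr_gt0// mulr_gt0// ltr0n.
have [N HN] := ln_sublinear_nat de0.
have Y0ge k : (k <= Y0 k)%N.
  elim: k => [//|k IH]; exact: leq_ltn_trans (Y0inc k k.+1 (ltnSn k)).
have : v (w r) <= v (w r) - e / 2.
  apply: (cvgr_to_le cw).
  exists N => // k /= Nk.
  set n := Y (Y0 k).
  have Nn : (N <= n)%N.
    by rewrite (leq_trans Nk)// (leq_trans (Y0ge k))// ltnW// Ygek.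
  have n0 : (0 < n)%N by exact: leq_ltn_trans (Ygek _).
  have n0' : 0 < n%:R :> R by rewrite ltr0n.
  rewrite ler_pdivrMl ?mulr_gt0//.
  have B : sq_sum p n (w r) <= (n.+1 ^ d)%:R * expR (n%:R * (v (w r) - e)) ^+ 2.
    apply: (@le_trans _ _ (\sum_(j < poly_dim d n) expR (n%:R * (v (w r) - e)) ^+ 2)).
      apply: ler_sum => j _; rewrite lerXn2r ?nnegrE ?cabs_ge0 ?expR_ge0//.
      by apply: ltW; exact: Yfail.
    rewrite sumr_const card_ord -[leLHS]mulr_natl ler_wpM2r ?exprn_ge0 ?expR_ge0//.
    by rewrite ler_nat poly_dim_le.
  apply: (@le_trans _ _ (ln ((n.+1 ^ d)%:R * expR (n%:R * (v (w r) - e)) ^+ 2))).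
    have pos : 0 < (n.+1 ^ d)%:R * expR (n%:R * (v (w r) - e)) ^+ 2.
      by rewrite mulr_gt0 ?ltr0n ?expn_gt0// exprn_gt0// expR_gt0.
    by rewrite ler_ln ?posrE ?sq_sum_gt0.
  rewrite lnM ?posrE ?exprn_gt0 ?expR_gt0 ?ltr0n ?expn_gt0//.
  rewrite lnXn ?expR_gt0// expRK natrX lnXn ?ltr0n//.
  have := HN n Nn; set l := ln n.+1%:R => hl.
  rewrite -[l *+ d]mulr_natl -[_ *+ 2]mulr_natl.
  have : d%:R * l <= n%:R * e.
    apply: (@le_trans _ _ (d%:R * (e / (2 * d%:R + 1) * n%:R))).
      by rewrite ler_wpM2l// ler0n.
    rewrite mulrA mulrC ler_wpM2l ?ler0n// mulrCA -[leRHS]mulr1 ler_wpM2l ?(ltW e0)//.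
    have d0 : 0 < d%:R :> R by rewrite ltr0n.
    by rewrite ler_pdivrMr; lra.
  move: (v (w r)) => u; nra.
by move: (v (w r)) => u; lra.
Qed.

End growth_of_basis.

(** * Rarity of small values on a box *)
Lemma expR_small (R : realType) (c k : R) : 0 < c -> 0 < k ->
  exists N, forall n, (N <= n)%N -> expR (- (c * n%:R)) <= k.
Proof.
move=> c0 k0; exists (Num.truncn (k^-1 / c)).+1 => n Nn.
have hn : k^-1 / c <= n%:R.
  by apply: (le_trans (ltW (truncnS_gt _))); rewrite ler_nat.
rewrite ler_pdivrMr// in hn.
rewrite expRN invf_ple ?posrE ?expR_gt0//.
by apply: le_trans (expR_ge1Dx _); lra.
Qed.

Lemma index_lt_uniq (T : eqType) (s1 s2 : seq T) x y :
  uniq (s1 ++ x :: s2) -> y \in s2 ->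
  (index x (s1 ++ x :: s2) < index y (s1 ++ x :: s2))%N.
Proof.
rewrite cat_uniq => /and3P[us1 h us2] ys2.
have xs1 : x \notin s1 by apply: contra h => xs1; apply/hasP; exists x => //; exact: mem_head.
have ys1 : y \notin s1 by apply: contra h => ys1; apply/hasP; exists y => //; rewrite inE ys2 orbT.
rewrite !index_cat (negbTE xs1) (negbTE ys1) /= eqxx addn0.
case: eqP => [yx|_]; last by rewrite addnS ltnS leq_addr.
by move: us2; rewrite /= yx ys2.
Qed.

Lemma leq_sub_half (k n N : nat) : (2 * k <= n)%N -> (2 * N <= n)%N -> (N <= n - k)%N.
Proof. lia. Qed.

Lemma half_lt (k n : nat) : (2 * k <= n)%N -> (0 < n)%N -> (k < n)%N.
Proof. lia. Qed.

Section box_small_ball.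
Context {R : realType} (d : nat).
Variables (d_gt0 : (0 < d)%N) (K : set 'rV[R[i]]_d).
Variables (p : nat -> mpoly d R[i]) (p0 : p 0%N = 1).
Hypothesis p_le1 : forall j, (supnorm K (p j) <= 1)%E.
Hypothesis p_basis : forall n,
     basis_of_set (poly_space d n) (fun j : 'I_(poly_dim d n) => p j).
Hypothesis Bn_cvg : forall Y : nat -> nat, {homo Y : m n / (m < n)%N} ->
     exists (Y0 : nat -> nat) (w : nat -> 'rV[R[i]]_d),
       [/\ {homo Y0 : m n / (m < n)%N}, dense (range w) &
         forall r : nat,
           (let n := Y (Y0 k) in ((2 * n%:R)^-1 * ln (sq_sum p n (w r)))%:E)
             @[k --> \oo] --> extremal_function K (w r)].
Variable v : 'rV[R[i]]_d -> R.
Hypothesis vE : forall z, extremal_function K z = (v z)%:E.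
Context d0 (T : measurableType d0) (P : probability T R).
Variables (a : nat -> {RV P >-> borelC R}) (a_indep : mutually_independent a).
Variables (r q : R) (r_gt0 : 0 < r) (q_ge0 : 0 <= q).
Hypothesis a_conc : forall j, concentrated (a j) r q.

(** The supremum over the box need not be measurable as it stands, hence the
    measurable cover [E']. *)
Definition rare_below (x : 'rV[R[i]]_d) (s e : R) (L : nat) (eta : R) (n : nat) :=
  exists E', [/\ measurable E', fine (P E') <= q ^+ L & forall w,
    (forall j : 'I_(poly_dim d n), cabs (a j w) <= expR (eta * n%:R)) ->
    (forall z, box x s z ->
       cabs (poly_comb p (fun j => a j w) n z) < expR (n%:R * (v z - 3 * e))) ->
    E' w].

(** Where [v] is small, the first [L] polynomials suffice: their linear
    independence on the box provides a dual family of functionals. *)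
Lemma rare_below_small (x : 'rV[R[i]]_d) (s e : R) L : 0 < s -> 0 < e ->
  (forall z, box x s z -> v z <= 2 * e) ->
  exists N, forall n, (N <= n)%N -> rare_below x s e L 1 n.
Proof.
move=> s0 e0 v2e.
have [phi [bphi dphi]] : exists phi : 'I_L -> ('rV[R[i]]_d -> R[i]) -> R[i],
    (forall i, bounded_functional (box x s) (phi i)) /\
    (forall i j : 'I_L, phi i (peval (p j)) = (i == j)%:R).
  apply: (@dual_functionals R _ (box x s) (fun j => peval (p j))) => b bz j.
  have LL : (L <= poly_dim d L)%N by apply: ltnW; exact: poly_dim_ge.
  have [_ indep _] := p_basis L.
  pose b' (k : 'I_(poly_dim d L)) : R[i] := if insub (k : nat) is Some k' then b k' else 0.
  have bE (k : 'I_L) : b' (widen_ord LL k) = b k by rewrite /b' valK.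
  rewrite -bE; apply: indep; apply: (peval_box_eq0 s0 (x := x)) => z zb.
  rewrite -[RHS](bz z zb) /peval raddf_sum/=.
  rewrite (bigID (fun k : 'I_(poly_dim d L) => (k < L)%N))/= [X in _ + X]big1 ?addr0; last first.
    by move=> k kL; rewrite mevalZ /b' insubN// mul0r.
  rewrite (big_ord_narrow LL)/=; apply: eq_bigr => k _.
  by rewrite mevalZ bE.
have /choice[C CP] : forall i, exists C : R, 0 <= C /\
    forall f l, (forall z, box x s z -> cabs (f z) <= l) -> cabs (phi i f) <= C * l.
  by move=> i; have [_ [C C0 h]] := bphi i; exists C.
pose D := 1 + \sum_(i < L) C i.
have D0 : 0 < D by rewrite ltr_pwDl// sumr_ge0// => i _; exact: (CP i).1.
have CD i : C i <= D.
  rewrite /D (bigD1 i)//= addrCA lerDl addr_ge0// sumr_ge0// => j _; exact: (CP j).1.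
have k0 : 0 < r / 8 / D by rewrite !divr_gt0.
have [N HN] := expR_small e0 k0.
exists (maxn N L) => n; rewrite geq_max => /andP[Nn Ln].
set m := poly_dim d n.
have Lm : (L <= m)%N by rewrite (leq_trans Ln)// ltnW// poly_dim_ge.
pose S := [seq widen_ord Lm i | i <- enum 'I_L].
pose c (J j : 'I_m) : R[i] := if insub (J : nat) is Some i then phi i (peval (p j)) else 0.
have cE (i : 'I_L) j : c (widen_ord Lm i) j = phi i (peval (p j)) by rewrite /c valK.
have uS : uniq S.
  by rewrite map_inj_uniq ?enum_uniq// => i j /(congr1 val)/= ij; exact: val_inj.
pose E := [set w | (forall j : 'I_m, cabs (a j w) <= expR (1 * n%:R)) /\
  forall z, box x s z -> cabs (poly_comb p (fun j => a j w) n z) < expR (n%:R * (v z - 3 * e))].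
have [||||E' [mE' EE' PE']] := @small_ball _ _ _ P m a r q (expR (1 * n%:R)) S c E a_indep a_conc r_gt0 q_ge0 (expR_gt0 _) uS.
- by move=> _ /mapP[i _ ->]; rewrite cE dphi eqxx.
- by move=> w [].
- move=> w [_ Ew] _ /mapP[i _ ->].
  have -> : \sum_(j < m) c (widen_ord Lm i) j * a j w =
      phi i (poly_comb p (fun j => a j w) n).
    rewrite /poly_comb.
    rewrite (@bounded_functional_sum R _ (box x s) (phi i) _ _ (fun j : 'I_m => a j w : R[i]) (fun j : 'I_m => peval (p j)))//.
    by apply: eq_bigr => j _; rewrite cE mulrC.
  apply: (@le_trans _ _ (C i * expR (- (e * n%:R)))).
    apply: (CP i).2 => z zb; apply: (le_trans (ltW (Ew z zb))).
    rewrite ler_expR; have := v2e z zb; have := ler0n R n.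
    by move: (v z) (n%:R : R) => u k; nra.
  apply: (@le_trans _ _ (D * expR (- (e * n%:R)))).
    by rewrite ler_wpM2r ?expR_ge0.
  by have := HN n Nn; rewrite ler_pdivlMr// mulrC.
- move=> s1 J s2 SE; rewrite big_seq big1 ?mulr0 ?divr_ge0 ?(ltW r_gt0)// => J' J's2.
  have JS : J \in S by rewrite SE mem_cat mem_head orbT.
  have J'S : J' \in S by rewrite SE mem_cat inE J's2 !orbT.
  have JJ' : J != J'.
    move: uS; rewrite SE cat_uniq => /and3P[_ _ /= /andP[Js2 _]].
    by apply: contraNneq Js2 => ->.
  move: JS J'S JJ' => /mapP[i _ ->] /mapP[i' _ ->] ii'.
  rewrite cE dphi; case: eqP => [ii|]; last by rewrite Normc.normc0.
  by rewrite ii eqxx in ii'.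
exists E'; split=> //; first by move: PE'; rewrite size_map size_enum_ord.
by move=> w h1 h2; apply: EE'.
Qed.

(** Where [v] is bounded below, basis elements of degrees about
    [(1 - i * dl) n], for [i < L], that are nearly extremal at some point of the
    box have widely separated sizes there. *)
Lemma rare_below_large (x : 'rV[R[i]]_d) (s e Vm : R) L : 0 < s -> 0 < e ->
  (forall z, box x s z -> e <= v z <= Vm) ->
  exists2 eta, 0 < eta & exists N, forall n, (N <= n)%N -> rare_below x s e L eta n.
Proof.
move=> s0 e0 veVm.
have Vm0 : e <= Vm.
  have /andP[h1 h2] : e <= v x <= Vm.
    by apply: veVm => i; rewrite subrr/= normr0 ltW.
  exact: le_trans h2.
have Vm1 : 0 < Vm + 1 by lra.
have L1 : 0 < L%:R + 1 :> R by rewrite ltr_wpDl// ler0n.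
(* Lowering the degree from [n] to [(1 - L dl) n] costs at most a factor
   [expR (e / 8 * n)] in the size of the polynomials on the box. *)
pose dl := e / (8 * (L%:R + 1) * (Vm + 1)).
have den0 : 0 < 8 * (L%:R + 1) * (Vm + 1) by rewrite !mulr_gt0.
have dl0 : 0 < dl by rewrite divr_gt0.
have dlL : (L%:R + 1) * dl * (Vm + 1) = e / 8.
  by rewrite /dl; field; apply/andP; split; rewrite gt_eqF.
have dlL' : (L%:R + 1) * dl <= 1 / 8.
  rewrite -(ler_pM2r Vm1) dlL; lra.
have L0 : 0 <= L%:R :> R by rewrite ler0n.
have LdlV : L%:R * dl * Vm <= e / 8.
  rewrite -dlL; have h1 : 0 <= L%:R * dl by rewrite mulr_ge0// ltW.
  have h2 : 0 <= dl * Vm by rewrite mulr_ge0// ?(ltW dl0)// (le_trans (ltW e0)).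
  by lra.
have dl1 : dl <= 1 by nra.
have Ldl : L%:R * dl <= 1 / 8 by nra.
pose e2 := dl * e / 8; have e20 : 0 < e2 by rewrite /e2 divr_gt0// mulr_gt0.
have e2e : e2 <= e / 8 by rewrite /e2; nra.
have [N1 HN1] := eventually_large_basis d_gt0 p0 Bn_cvg vE x s0 e20.
have r8 : 0 < r / 8 by rewrite divr_gt0.
have [N2 HN2] := expR_small e0 r8.
have rL : 0 < r / (8 * (L%:R + 1)) by rewrite divr_gt0// mulr_gt0.
have de4 : 0 < dl * e / 4 by rewrite divr_gt0// mulr_gt0.
have [N3 HN3] := expR_small de4 rL.
pose N4 := (Num.truncn (2 / dl)).+1.
exists e2 => //; exists (maxn (maxn (2 * N1) N2) (maxn N3 N4)) => n.
rewrite !geq_max => /andP[/andP[nN1 nN2] /andP[nN3 nN4]].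
have n0 : (0 < n)%N by exact: leq_trans nN4.
have n0' : 0 < n%:R :> R by rewrite ltr0n.
have dn2 : 2 <= dl * n%:R.
  rewrite -ler_pdivrMl// mulrC; apply: (le_trans (ltW (truncnS_gt _))).
  by rewrite ler_nat.
pose t := Num.truncn (dl * n%:R).
have t1 : t%:R <= dl * n%:R by rewrite truncn_le// mulr_ge0// ltW.
have t2 : dl * n%:R / 2 <= t%:R.
  have := truncnS_gt (dl * n%:R); rewrite -/t -natr1; lra.
pose nn (i : nat) := (n - i * t)%N.
have itn (i : 'I_L) : (2 * (i * t) <= n)%N.
  rewrite -(ler_nat R) natrM natrM.
  have iL : (i%:R : R) <= L%:R by rewrite ler_nat ltnW.
  have : i%:R * t%:R <= L%:R * (dl * n%:R) by apply: ler_pM; rewrite ?ler0n.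
  have : L%:R * dl * n%:R <= 1 / 8 * n%:R by rewrite ler_pM2r.
  rewrite mulrA; lra.
have nnE (i : 'I_L) : (nn i)%:R = n%:R - i%:R * t%:R :> R.
  rewrite /nn natrB ?natrM// (leq_trans _ (itn i))// leq_pmull//.
have nnN1 (i : 'I_L) : (N1 <= nn i)%N by exact: leq_sub_half (itn i) nN1.
have nnn i : (nn i <= n)%N by exact: leq_subr.
have nn0 (i : 'I_L) : (0 < nn i)%N.
  by rewrite /nn subn_gt0; apply: half_lt (itn i) n0.
have /choice[zj zjP] : forall i : 'I_L, exists zj : 'rV[R[i]]_d * nat,
    [/\ box x s zj.1, (zj.2 < poly_dim d (nn i))%N &
      expR ((nn i)%:R * (v zj.1 - e2)) <= cabs (peval (p zj.2) zj.1)].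
  move=> i; have [z zb [j jn h]] := HN1 _ (nnN1 i).
  by exists (z, j).
set m := poly_dim d n.
have jm (i : 'I_L) : ((zj i).2 < m)%N.
  by have [_ h _] := zjP i; apply: (leq_trans h); exact: poly_dim_mono.
pose J (i : 'I_L) : 'I_m := Ordinal (jm i).
have pJ0 i : 0 < cabs (peval (p (J i)) (zj i).1).
  by have [_ _ h] := zjP i; apply: lt_le_trans h; exact: expR_gt0.
(* At the point chosen for the degree [nn i], where [J i] is nearly extremal,
   elements of degree at most [nn i - t] are exponentially smaller, since [v] is
   at least [e] there. *)
have ratio (i i' : 'I_L) : (i < i')%N ->
    cabs (peval (p (J i')) (zj i).1) / cabs (peval (p (J i)) (zj i).1) <=
    expR (- (3 / 8 * (dl * e) * n%:R)).
  move=> ii'; rewrite ler_pdivrMr//.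
  have [zb _ low] := zjP i; have [_ jn' _] := zjP i'.
  have up := basis_le_expR p_le1 p_basis vE (zj i).1 (nn0 i') jn'.
  apply: (le_trans up).
  apply: (@le_trans _ _ (expR (- (3 / 8 * (dl * e) * n%:R)) * expR ((nn i)%:R * (v (zj i).1 - e2)))); last first.
    by rewrite ler_wpM2l ?expR_ge0.
  rewrite -expRD ler_expR !nnE.
  have /andP[ve _] := veVm _ zb.
  have ii'R : (i%:R : R) + 1 <= i'%:R by rewrite natr1 ler_nat.
  have it0 : 0 <= (i%:R : R) * t%:R by rewrite mulr_ge0// ler0n.
  have tt : (i%:R + 1) * t%:R * v (zj i).1 <= i'%:R * t%:R * v (zj i).1 :> R.
    rewrite ler_wpM2r ?(le_trans (ltW e0) ve)// ler_wpM2r ?ler0n//.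
  have tv : dl * n%:R / 2 * e <= t%:R * v (zj i).1.
    apply: ler_pM => //; last exact: ltW.
    by rewrite divr_ge0// mulr_ge0// ltW.
  have e2n : 0 <= i%:R * t%:R * e2 by rewrite mulr_ge0// ltW.
  have e2E : n%:R * e2 = n%:R * (dl * e) / 8 by rewrite /e2; field.
  move: tt tv e2n e2E; move: (v (zj i).1) (t%:R : R) (n%:R : R) (i%:R : R) (i'%:R : R) => u t' n' k k'.
  by lra.
have ratio1 (i i' : 'I_L) : (i < i')%N -> J i != J i'.
  move=> ii'; apply/eqP => JJ; have := ratio i i' ii'.
  rewrite -JJ divff ?gt_eqF// leNgt => /negP; apply.
  rewrite expR_lt1 oppr_lt0; apply: mulr_gt0 => //; apply: mulr_gt0; first lra.
  exact: mulr_gt0.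
have Jinj : injective J.
  move=> i i' JJ; apply: val_inj; case: (ltngtP i i') => // ii'.
    by have := ratio1 _ _ ii'; rewrite JJ eqxx.
  by have := ratio1 _ _ ii'; rewrite JJ eqxx.
pose S := [seq J i | i <- enum 'I_L].
have uS : uniq S by rewrite map_inj_uniq ?enum_uniq.
(* Evaluation of the polynomial at the chosen point, divided by the value of the
   nearly extremal element. *)
pose c (I j : 'I_m) : R[i] := if [pick i | J i == I] is Some i
  then peval (p j) (zj i).1 / peval (p (J i)) (zj i).1 else 0.
have cE (i : 'I_L) j : c (J i) j = peval (p j) (zj i).1 / peval (p (J i)) (zj i).1.
  rewrite /c; case: pickP => [i' /eqP/Jinj -> //|/(_ i)]; by rewrite eqxx.
have cV (z : R[i]) : cabs z^-1 = (cabs z)^-1 by exact: Normc.normcV.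
pose M := expR (e2 * n%:R).
pose E := [set w | (forall j : 'I_m, cabs (a j w) <= M) /\
  forall z, box x s z -> cabs (poly_comb p (fun j => a j w) n z) < expR (n%:R * (v z - 3 * e))].
have [||||E' [mE' EE' PE']] := @small_ball _ _ _ P m a r q M S c E a_indep a_conc r_gt0 q_ge0 (expR_gt0 _) uS.
- by move=> _ /mapP[i _ ->]; rewrite cE divff// -cabs_eq0 gt_eqF.
- by move=> w [].
- move=> w [_ Ew] _ /mapP[i _ ->].
  have -> : \sum_(j < m) c (J i) j * a j w =
      poly_comb p (fun j => a j w) n (zj i).1 / peval (p (J i)) (zj i).1.
    rewrite /poly_comb mulr_suml; apply: eq_bigr => j _; rewrite cE.
    by rewrite mulrAC [_ * a j w]mulrC.
  have [zb _ low] := zjP i.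
  rewrite cabsM cV ler_pdivrMr//; apply: (le_trans (ltW (Ew _ zb))).
  apply: (@le_trans _ _ (expR (- (e * n%:R)) * expR ((nn i)%:R * (v (zj i).1 - e2)))); last first.
    by apply: ler_pM; rewrite ?expR_ge0//; exact: HN2.
  rewrite -expRD ler_expR nnE.
  have /andP[ve vVm] := veVm _ zb.
  have iL : (i%:R : R) <= L%:R by rewrite ler_nat ltnW.
  have h1 : i%:R * t%:R * v (zj i).1 <= L%:R * (dl * n%:R) * Vm :> R.
    apply: ler_pM => //; first exact: le_trans (ltW e0) ve.
    by apply: ler_pM; rewrite ?ler0n.
  have h2 : L%:R * dl * Vm * n%:R <= e / 8 * n%:R by rewrite ler_pM2r.
  have h3 : 0 <= i%:R * t%:R * e2 by rewrite mulr_ge0// ltW.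
  have h4 : e2 * n%:R <= e / 8 * n%:R by rewrite ler_pM2r.
  have h5 : 0 < e * n%:R by rewrite mulr_gt0.
  have h6 : L%:R * dl * Vm * n%:R = L%:R * (dl * n%:R) * Vm by ring.
  move: h1 h2 h3 h4 h5 h6; move: (v (zj i).1) (t%:R : R) (n%:R : R) (i%:R : R) => u t' n' k.
  by lra.
- move=> s1 I s2 SE.
  have IS : I \in S by rewrite SE mem_cat mem_head orbT.
  have [i _ IE] := mapP IS.
  have Jidx (k : 'I_L) : index (J k) S = k by rewrite index_map// index_enum_ord.
  apply: (@le_trans _ _ (2 * M * \sum_(j <- s2) expR (- (3 / 8 * (dl * e) * n%:R)))).
    apply: ler_wpM2l; first by rewrite mulr_ge0// expR_ge0.
    rewrite big_seq [leRHS]big_seq; apply: ler_sum => I' I's2.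
    have I'S : I' \in S by rewrite SE mem_cat inE I's2 !orbT.
    have [i' _ I'E] := mapP I'S.
    rewrite IE I'E cE cabsM cV; apply: ratio.
    by rewrite -(Jidx i) -(Jidx i') -IE -I'E SE index_lt_uniq// -SE.
  have sz : (size s2 <= L)%N.
    by have := congr1 size SE; rewrite size_map size_enum_ord size_cat /= => ->; rewrite addnS ltnW// ltnS leq_addl.
  rewrite big_const_seq count_predT iter_addr_0 -[_ *+ size s2]mulr_natl.
  apply: (@le_trans _ _ (2 * M * (L%:R * expR (- (3 / 8 * (dl * e) * n%:R))))).
    apply: ler_wpM2l; first by rewrite mulr_ge0// expR_ge0.
    by apply: ler_wpM2r; rewrite ?expR_ge0// ler_nat.
  have -> : 2 * M * (L%:R * expR (- (3 / 8 * (dl * e) * n%:R))) =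
      2 * L%:R * expR (- (dl * e / 4 * n%:R)).
    have -> : expR (- (dl * e / 4 * n%:R)) = M * expR (- (3 / 8 * (dl * e) * n%:R)).
      by rewrite /M -expRD; congr expR; rewrite /e2; field.
    ring.
  have := HN3 n nN3; set X := expR _ => HX.
  have X0 : 0 <= X by exact: expR_ge0.
  rewrite ler_pdivlMr ?mulr_gt0// in HX.
  nra.
exists E'; split=> //; first by move: PE'; rewrite size_map size_enum_ord.
by move=> w h1 h2; apply: EE'.
Qed.

(** Either [v] is at most [2 e] on the whole box, or it is at least [e] there. *)
Lemma rare_below_box (x : 'rV[R[i]]_d) (s e : R) L : 0 < s -> 0 < e ->
  (forall z z', box x s z -> box x s z' -> v z <= v z' + e) ->
  exists2 eta, 0 < eta & exists N, forall n, (N <= n)%N -> rare_below x s e L eta n.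
Proof.
move=> s0 e0 osc.
have xb : box x s x by move=> i; rewrite subrr/= normr0 ltW.
have [[z1 z1b vz1]|nsmall] := pselect (exists2 z, box x s z & v z < e).
  exists 1 => //; apply: rare_below_small => // z zb.
  by have := osc z z1 zb z1b; lra.
apply: (@rare_below_large x s e (v x + e)) => // z zb.
rewrite osc// andbT leNgt; apply/negP => vz; apply: nsmall; by exists z.
Qed.

End box_small_ball.

(** * Measurability of the distance to the limit *)
Lemma hausdorff_Cd (R : realType) d : hausdorff_space 'rV[R[i]]_d.
Proof.
move=> x y xy; apply/rowP => i; apply/eqP/negPn/negP => xyi.
have h0 : 0 < cabs (x ord0 i - y ord0 i) / 2.
  by rewrite divr_gt0// cabs_gt0 subr_eq0.
have B (z : 'rV[R[i]]_d) : nbhs z [set u : 'rV[R[i]]_d | cabs (u ord0 i - z ord0 i) < cabs (x ord0 i - y ord0 i) / 2].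
  by apply/nbhs_Cd; exists (cabs (x ord0 i - y ord0 i) / 2) => // u; exact.
have [z [/= zx zy]] := xy _ _ (B x) (B y).
have := cabsD (x ord0 i - z ord0 i) (z ord0 i - y ord0 i).
by rewrite addrA subrK (cabsB (x ord0 i)); lra.
Qed.

Lemma measurable_lne_EFin (R : realType) : measurable_fun setT (fun x : R => lne x%:E).
Proof.
apply: measurable_fun_ifT.
- exact: measurable_fun_ler.
- exact: measurable_cst.
- by apply/measurable_EFinP; exact: measurable_ln.
Qed.

Section measurability.
Context {R : realType} (d : nat).
Local Notation T2 := (measurableTypeR R * measurableTypeR R)%type.
Context d0 (T : measurableType d0) (P : probability T R).
Variables (a : nat -> {RV P >-> borelC R}) (p : nat -> mpoly d R[i]).

Lemma measurable_RV_Re (X : {RV P >-> borelC R}) : measurable_fun setT (fun w => Re (X w)).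
Proof.
apply: (measurability _ (RGenInftyO.measurableE R)) => _ [_ [c ->] <-]; rewrite setTI.
rewrite (_ : _ @^-1` _ = X @^-1` [set z | Re z < c]).
  by apply: measurable_RV_preimage; apply: open_borelC; exact: open_ReLt.
by apply/seteqP; split=> w /=; rewrite in_itv.
Qed.

Lemma measurable_RV_Im (X : {RV P >-> borelC R}) : measurable_fun setT (fun w => Im (X w)).
Proof.
apply: (measurability _ (RGenInftyO.measurableE R)) => _ [_ [c ->] <-]; rewrite setTI.
rewrite (_ : _ @^-1` _ = X @^-1` [set z | Im z < c]).
  by apply: measurable_RV_preimage; apply: open_borelC; exact: open_ImLt.
by apply/seteqP; split=> w /=; rewrite in_itv.
Qed.

Lemma continuous_Re : continuous (fun z : R[i] => Re z).
Proof.
move=> z A /nbhs_ballP[e /= e0 eA]; apply/nbhs_C; exists e => // y yz.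
apply: eA; rewrite -ball_normE/= distrC -raddfB.
exact: le_lt_trans (Re_le_cabs _) yz.
Qed.

Lemma continuous_Im : continuous (fun z : R[i] => Im z).
Proof.
move=> z A /nbhs_ballP[e /= e0 eA]; apply/nbhs_C; exists e => // y yz.
apply: eA; rewrite -ball_normE/= distrC -raddfB.
exact: le_lt_trans (Im_le_cabs _) yz.
Qed.

Lemma measurable_peval_Re (q : mpoly d R[i]) :
  measurable_fun setT (fun x : d.-tuple T2 => Re (peval q (of_coords x))).
Proof.
apply: (@measurable_of_coords R d (fun z => Re (peval q z))) => z.
by apply: continuous_comp; [exact: continuous_peval|exact: continuous_Re].
Qed.

Lemma measurable_peval_Im (q : mpoly d R[i]) :
  measurable_fun setT (fun x : d.-tuple T2 => Im (peval q (of_coords x))).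
Proof.
apply: (@measurable_of_coords R d (fun z => Im (peval q z))) => z.
by apply: continuous_comp; [exact: continuous_peval|exact: continuous_Im].
Qed.

Let pairT := (T * d.-tuple T2)%type.

Lemma measurable_random_poly n : measurable_fun setT (fun wx : pairT =>
  cabs (poly_comb p (fun j => a j wx.1) n (of_coords wx.2))).
Proof.
have mRe (j : nat) : measurable_fun setT (fun wx : pairT => Re (a j wx.1)).
  exact: (measurableT_comp (measurable_RV_Re (a j)) measurable_fst).
have mIm (j : nat) : measurable_fun setT (fun wx : pairT => Im (a j wx.1)).
  exact: (measurableT_comp (measurable_RV_Im (a j)) measurable_fst).
have mpRe (j : nat) : measurable_fun setT (fun wx : pairT => Re (peval (p j) (of_coords wx.2))).
  exact: (measurableT_comp (measurable_peval_Re (p j)) measurable_snd).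
have mpIm (j : nat) : measurable_fun setT (fun wx : pairT => Im (peval (p j) (of_coords wx.2))).
  exact: (measurableT_comp (measurable_peval_Im (p j)) measurable_snd).
pose hRe (wx : pairT) := \sum_(j < poly_dim d n)
  (Re (a j wx.1) * Re (peval (p j) (of_coords wx.2)) - Im (a j wx.1) * Im (peval (p j) (of_coords wx.2))).
pose hIm (wx : pairT) := \sum_(j < poly_dim d n)
  (Re (a j wx.1) * Im (peval (p j) (of_coords wx.2)) + Im (a j wx.1) * Re (peval (p j) (of_coords wx.2))).
have mhRe : measurable_fun setT hRe.
  apply: measurable_sum => j; apply: measurable_funB; exact: measurable_funM.
have mhIm : measurable_fun setT hIm.
  apply: measurable_sum => j; apply: measurable_funD; exact: measurable_funM.
rewrite (_ : (fun wx : pairT => _) = fun wx => Num.sqrt (hRe wx * hRe wx + hIm wx * hIm wx)).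
  apply: measurableT_comp.
    by apply: continuous_measurable_fun; exact: sqrt_continuous.
  by apply: measurable_funD; exact: measurable_funM.
apply/funext => wx; rewrite -[LHS]ger0_norm ?cabs_ge0// -sqrtr_sqr sqr_cabs.
congr (Num.sqrt _); rewrite /poly_comb !raddf_sum -!expr2.
congr (_ ^+ 2 + _ ^+ 2); apply: eq_bigr => j _;
  by case: (a j wx.1) (peval _ _) => [x1 y1] [x2 y2].
Qed.

Lemma measurable_of_coords_compact (C : set 'rV[R[i]]_d) : compact C ->
  measurable (@of_coords R d @^-1` C : set (d.-tuple T2)).
Proof.
move=> cC; rewrite (_ : _ @^-1` C = ~` (@of_coords R d @^-1` (~` C))); last first.
  by apply/seteqP; split=> x /= => [? //|/contrapT].
apply: measurableC; apply: measurable_of_coords_open; apply: closed_openC.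
exact: compact_closed (@hausdorff_Cd R d) cC.
Qed.

(** The integrand is jointly measurable in the outcome and the point, so that
    Tonelli's theorem applies. *)
Lemma measurable_L1dist_ge (n : nat) (c e : R) (C : set 'rV[R[i]]_d) (v : 'rV[R[i]]_d -> R) :
  compact C -> continuous v ->
  measurable [set w | (e%:E <= L1dist C (fun z => c%:E *
    lne (cabs (poly_comb p (fun j => a j w) n z))%:E) (fun z => (v z)%:E))%E].
Proof.
move=> cC cv.
pose D : set (d.-tuple T2) := @of_coords R d @^-1` C.
have mD : measurable D by exact: measurable_of_coords_compact.
pose h (wx : pairT) := `|c%:E * lne (cabs (poly_comb p (fun j => a j wx.1) n (of_coords wx.2)))%:E - (v (of_coords wx.2))%:E|%E.
have mh : measurable_fun setT h.
  apply: measurableT_comp; first exact: abse_measurable.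
  apply: emeasurable_funB.
    apply: measurable_funeM.
    exact: (measurableT_comp (@measurable_lne_EFin R) (measurable_random_poly n)).
  apply/measurable_EFinP.
  exact: (measurableT_comp (measurable_of_coords cv) measurable_snd).
pose hD := h \_ (setT `*` D).
have mhD : measurable_fun setT hD.
  apply/(measurable_restrictT _ _).1 => //; first exact: measurableX.
  exact: measurable_funS mh.
have hD0 wx : (0 <= hD wx)%E by rewrite /hD patchE; case: ifP => // _; exact: abse_ge0.
have := @measurable_fun_fubini_tonelli_F _ _ _ _ R (lebesgue_R2d d) hD mhD hD0.
move=> /(emeasurable_fun_c_infty measurableT) /(_ e%:E); rewrite setTI.
congr measurable; apply/funext => w /=; congr (_ <= _)%E.
rewrite /fubini_F /L1dist [RHS]integral_mkcond; apply: eq_integral => x _.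
rewrite /hD !patchE; congr (if _ then _ else _).
by rewrite in_setX mem_setT.
Qed.

End measurability.

(** * Compact sets, grids and bounds on boxes *)
Section compact_Cd.
Context {R : realType} (d : nat).

(** Uniform continuity up to points [z] outside [C], as boxes that meet [C] are not
    contained in it. *)
Lemma compact_uniform (C : set 'rV[R[i]]_d) (v : 'rV[R[i]]_d -> R) (e : R) :
  compact C -> continuous v -> 0 < e ->
  exists2 rho : R, 0 < rho & forall x z : 'rV[R[i]]_d, C x ->
    (forall i, cabs (z ord0 i - x ord0 i) < rho) -> `|v z - v x| <= e.
Proof.
move=> /compact_near_coveringP cC cv e0.
have := cC R 0^'+ (fun rho x => forall z : 'rV[R[i]]_d,
  (forall i, cabs (z ord0 i - x ord0 i) < rho) -> `|v z - v x| <= e) _.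
case.
  move=> x Cx; have e2 : 0 < e / 2 by rewrite divr_gt0.
  have /nbhs_Cd[rho rho0 H] : nbhs x (fun z => `|v z - v x| < e / 2).
    have /cvgrPdist_lt/(_ _ e2) := cv x.
    by apply: filterS => z; rewrite distrC.
  exists ([set y : 'rV[R[i]]_d | forall i, cabs (y ord0 i - x ord0 i) < rho / 2], [set r | r < rho / 2]).
    split=> /=.
      by apply/nbhs_Cd; exists (rho / 2); rewrite ?divr_gt0.
    by apply: nbhs_right_lt; rewrite divr_gt0.
  move=> [y r] /= [yx rr] z zy.
  have hy : `|v y - v x| < e / 2.
    by apply: H => i; apply: (lt_trans (yx i)); lra.
  have hz : `|v z - v x| < e / 2.
    apply: H => i; rewrite (_ : _ - _ = (z ord0 i - y ord0 i) + (y ord0 i - x ord0 i)).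
      by apply: (le_lt_trans (cabsD _ _)); have := zy i; have := yx i; lra.
    by rewrite addrA subrK.
  have -> : v z - v y = (v z - v x) - (v y - v x) by lra.
  by apply: (le_trans (ler_normB _ _)); lra.
move=> r /= r0 H; exists (r / 2); first by rewrite divr_gt0.
move=> x z Cx; apply: (H (r / 2)) => //=; last by rewrite divr_gt0.
by rewrite sub0r normrN gtr0_norm ?divr_gt0//; lra.
Qed.

Lemma compact_in_box (C : set 'rV[R[i]]_d) : compact C ->
  exists2 S : R, 0 < S & C `<=` box 0 S.
Proof.
move=> /compact_near_coveringP cC.
have := cC R +oo (fun S x => box 0 S x) _.
case.
  move=> x Cx.
  exists ([set y : 'rV[R[i]]_d | forall i, cabs (y ord0 i - x ord0 i) < 1],
    [set S | 1 + \sum_(i < d) cabs (x ord0 i) < S]).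
    split=> /=; first by apply/nbhs_Cd; exists 1.
    by apply: nbhs_pinfty_gt; exact: num_real.
  move=> [y S] /= [yx hS] i.
  have h : cabs (y ord0 i) <= S.
    have := cabsD (y ord0 i - x ord0 i) (x ord0 i); rewrite subrK.
    have := yx i; move: hS; rewrite (bigD1 i)//=.
    have : 0 <= \sum_(j < d | j != i) cabs (x ord0 j).
      by apply: sumr_ge0 => j _; exact: cabs_ge0.
    lra.
  by rewrite mxE subr0; split; apply: le_trans h; [exact: Re_le_cabs|exact: Im_le_cabs].
move=> S [_ H]; exists (`|S| + 1); first by rewrite ltr_wpDl.
by apply: H; rewrite ltr_pwDr// ler_norm.
Qed.

End compact_Cd.

Section grid.
Context {R : realType} (d : nat).

Definition grid_coord (S : R) N (j : 'I_N) : R := (2 * j%:R + 1) * (S / N%:R) - S.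

Lemma grid_coord_near (S : R) N x : (0 < N)%N -> 0 < S -> `|x| <= S ->
  exists j : 'I_N, `|x - grid_coord S j| <= S / N%:R.
Proof.
move=> N0 S0 xS; have N0' : 0 < N%:R :> R by rewrite ltr0n.
rewrite /grid_coord; set h := S / N%:R; have h0 : 0 < h by rewrite divr_gt0.
have SE : S = N%:R * h by rewrite /h mulrCA divff ?mulr1// gt_eqF.
move: xS; rewrite ler_norml => /andP[x1 x2].
pose u := (x + S) / (2 * h).
have uE : x + S = u * (2 * h) by rewrite /u divfK// gt_eqF// mulr_gt0.
have u0 : 0 <= u by rewrite divr_ge0//; lra.
have uN : u <= N%:R by rewrite /u ler_pdivrMr; [move: SE x2; lra|rewrite mulr_gt0].
have jN : (minn (Num.truncn u) N.-1 < N)%N by rewrite -[ltnRHS](prednK N0) ltnS geq_minr.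
exists (Ordinal jN) => /=.
have xE : x = u * (2 * h) - S by lra.
have [j1 j2] : ((minn (Num.truncn u) N.-1)%:R <= u) /\ (u <= (minn (Num.truncn u) N.-1)%:R + 1).
  case: leqP => hu.
    by split; [rewrite truncn_le|rewrite natr1; exact: ltW (truncnS_gt _)].
  split; last by rewrite natr1 prednK.
  by apply: (@le_trans _ _ (Num.truncn u)%:R); [rewrite ler_nat ltnW|rewrite truncn_le].
rewrite xE; move: j1 j2; move: (_%:R) => j j1 j2.
rewrite (_ : _ - _ = (2 * (u - j) - 1) * h); last by ring.
rewrite normrM (gtr0_norm h0) ler_piMl ?(ltW h0)// ler_norml; apply/andP; split; lra.
Qed.

Definition grid_point (S : R) N (k : {ffun 'I_d -> 'I_N * 'I_N}) : 'rV[R[i]]_d :=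
  \row_i Complex (grid_coord S (k i).1) (grid_coord S (k i).2).

Lemma grid_cover (S : R) N (z : 'rV[R[i]]_d) : (0 < N)%N -> 0 < S -> box 0 S z ->
  exists k : {ffun 'I_d -> 'I_N * 'I_N}, box (grid_point S k) (S / N%:R) z.
Proof.
move=> N0 S0 zS.
have /choice[f fP] : forall i : 'I_d, exists j : 'I_N * 'I_N,
    `|Re (z ord0 i) - grid_coord S j.1| <= S / N%:R /\
    `|Im (z ord0 i) - grid_coord S j.2| <= S / N%:R.
  move=> i; have := zS i; rewrite mxE subr0 => -[zR zI].
  have [j1 h1] := grid_coord_near N0 S0 zR.
  by have [j2 h2] := grid_coord_near N0 S0 zI; exists (j1, j2).
by exists [ffun i => f i] => i; rewrite mxE ffunE (raddfB (@complex.Re R)) (raddfB (@complex.Im R)); exact: fP.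
Qed.

End grid.

Section L1_bounds.
Context {R : realType}.
Local Open Scope ereal_scope.

Lemma ge0_integral_cover d0 (T : measurableType d0)
    (mu : {measure set T -> \bar R}) (I : finType) (A : pred I) (B : I -> set T)
    (C : set T) (f : T -> \bar R) :
  measurable_fun setT f -> (forall x, 0 <= f x) -> measurable C ->
  (forall k, measurable (B k)) ->
  (forall x, C x -> exists2 k, A k & B k x) ->
  \int[mu]_(x in C) f x <= \sum_(k | A k) \int[mu]_(x in B k) f x.
Proof.
move=> mf f0 mC mB CB.
rewrite integral_mkcond (eq_bigr (fun k => \int[mu]_x (f \_ (B k)) x)); last first.
  by move=> k _; rewrite integral_mkcond.
have mfB k : measurable_fun setT (f \_ (B k)).
  by apply/(measurable_restrictT _ _).1 => //; exact: measurable_funS mf.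
have fB0 k x : 0 <= (f \_ (B k)) x by rewrite patchE; case: ifP.
rewrite -big_filter -ge0_integral_sum//; apply: ge0_le_integral => //.
- by move=> x _; rewrite patchE; case: ifP.
- by apply/(measurable_restrictT _ _).1 => //; exact: measurable_funS mf.
- by apply: emeasurable_sum => k.
move=> x _; rewrite patchE; case: ifPn => [/set_mem Cx|_]; last by apply: sume_ge0 => k _.
have [k Ak Bkx] := CB x Cx.
rewrite big_filter (bigD1 k)//= patchE mem_set// leeDl//; by apply: sume_ge0 => j _.
Qed.

(** Since [F <= v + c] for the normalised logarithm [F], the deviation [|F - v|]
    exceeds the nonnegative gap [v + c - F] by at most [c]. *)
Lemma box_L1_bound d (q : mpoly d R[i]) n (v : 'rV[R[i]]_d -> R) (c e a s : R)
    (x z0 : 'rV[R[i]]_d) :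
  (0 < n)%N -> continuous v -> (forall z, (0 <= v z)%R) -> (0 <= c)%R ->
  (forall z, cabs (peval q z) <= expR (n%:R * (v z + c)))%R ->
  (0 < s)%R -> box x s z0 -> (forall z, box z0 (6 * s) z -> v z <= v z0 + e)%R ->
  (expR (n%:R * (v z0 - a)) <= cabs (peval q z0))%R -> (0 <= e + c + a)%R ->
  \int[lebesgue_R2d d]_(y in @of_coords R d @^-1` box x s)
     `|(n%:R^-1)%:E * lne (cabs (peval q (of_coords y)))%:E - (v (of_coords y))%:E|
   <= ((e + 2 * c + a) * (6 * s) ^+ (2 * d))%:E.
Proof.
move=> n0 cv v0 c0 qv s0 z0x osc low eca.
have H := hartogs n0 cv v0 c0 qv s0 z0x osc low eca.
have n0' : (0 < n%:R :> R)%R by rewrite ltr0n.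
pose F (y : d.-tuple (measurableTypeR R * measurableTypeR R)) :=
  (n%:R^-1)%:E * lne (cabs (peval q (of_coords y)))%:E.
have mF : measurable_fun setT F.
  apply: measurable_funeM.
  apply: (measurableT_comp (@measurable_lne_EFin R)).
  apply: (@measurable_of_coords R d (fun z => cabs (peval q z))) => z.
  by apply: continuous_comp; [exact: continuous_peval|exact: continuous_cabs].
have mv : measurable_fun setT (fun y : d.-tuple (measurableTypeR R * measurableTypeR R) => (v (of_coords y))%:E).
  by apply/measurable_EFinP; exact: measurable_of_coords.
have mvc : measurable_fun setT (fun y : d.-tuple (measurableTypeR R * measurableTypeR R) => (v (of_coords y) + c)%:E).
  by apply/measurable_EFinP; apply: measurable_funD => //; exact: measurable_of_coords.
have Fle y : F y <= (v (of_coords y) + c)%:E.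
  rewrite /F; have [h|h] := leP (cabs (peval q (of_coords y))) 0%R.
    by rewrite le0_lneNy ?lee_fin// gt0_muleNy ?leNye// lte_fin invr_gt0.
  rewrite lne_EFin// -EFinM lee_fin ler_pdivrMl// -ler_expR lnK ?posrE//; exact: qv.
have gap0 y : 0 <= (v (of_coords y) + c)%:E - F y.
  by have := Fle y; case: (F y) => [r h|//|_]; [rewrite -EFinB lee_fin subr_ge0 -lee_fin|rewrite /= addey].
pose B := @of_coords R d @^-1` box x s.
have mB : measurable B by exact: measurable_box.
apply: (@le_trans _ _ (\int[lebesgue_R2d d]_(y in B)
    (((v (of_coords y) + c)%:E - F y) + c%:E))).
  apply: ge0_le_integral => //.
  - by apply: measurable_funS (measurableT_comp _ (emeasurable_funB mF mv)) => //; exact: abse_measurable.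
  - apply: measurable_funS (emeasurable_funD (emeasurable_funB mvc mF) _) => //.
  move=> y _; have := Fle y; rewrite -/(F y).
  case: (F y) => [r h|//|_]; last by rewrite /= leey.
  move: h; rewrite -!EFinB -EFinD /= !lee_fin ler_norml => h; apply/andP; split; lra.
rewrite ge0_integralD//.
- rewrite integral_cst//= /B volume_box// -EFinM.
  apply: le_trans (leeD2r _ H) _; rewrite -EFinD lee_fin.
  have : ((2 * s) ^+ (2 * d) <= (6 * s) ^+ (2 * d))%R.
    by rewrite lerXn2r ?nnegrE; lra.
  by move/(ler_wpM2l c0); lra.
- by apply: measurable_funS (emeasurable_funB mvc mF).
Qed.

End L1_bounds.

(** * The coefficients and the grid *)
Lemma poly_dim_le_expR (R : realType) d (c : R) : 0 < c ->
  exists N, forall n, (N <= n)%N -> (poly_dim d n)%:R <= expR (c * n%:R).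
Proof.
move=> c0; have c' : 0 < c / d.+1%:R by rewrite divr_gt0// ltr0n.
have [N HN] := ln_sublinear_nat c'.
exists N => n Nn; apply: (@le_trans _ _ (n.+1%:R ^+ d)).
  by rewrite -natrX ler_nat poly_dim_le.
have n1 : 0 < n.+1%:R :> R by rewrite ltr0n.
rewrite -ler_ln ?posrE ?exprn_gt0 ?expR_gt0// expRK lnXn// -[ln _ *+ d]mulr_natl.
apply: (@le_trans _ _ (d%:R * (c / d.+1%:R * n%:R))).
  by rewrite ler_wpM2l ?ler0n// HN.
rewrite mulrA ler_wpM2r ?ler0n// mulrCA ler_piMr ?(ltW c0)//.
by rewrite ler_pdivrMr ?ltr0n// mul1r ler_nat.
Qed.

Section coefficients.
Context {R : realType} (d : nat).
Context d0 (T : measurableType d0) (P : probability T R).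
Variables (a : nat -> {RV P >-> borelC R}).
Hypothesis a_ident : identically_distributed a.
Hypothesis a_tail : t ^+ d * fine (P [set w | expR t < cabs (a 0%N w)]) @[t --> +oo] --> (0 : R).

(** The number of coefficients is at most [(n + 1) ^ d <= (2 n) ^ d], which is the
    order of magnitude that the tail compensates in the union bound. *)
Lemma coefficients_le_expR (eta del : R) : 0 < eta -> 0 < del ->
  exists N, forall n, (N <= n)%N -> exists B : set T,
    [/\ measurable B, fine (P B) <= del & forall w, ~ B w ->
      forall j : 'I_(poly_dim d n), cabs (a j w) <= expR (eta * n%:R)].
Proof.
move=> eta0 del0.
pose del' := del * (eta / 2) ^+ d.
have del'0 : 0 < del' by rewrite mulr_gt0// exprn_gt0// divr_gt0.
have /cvgrPdist_lt/(_ _ del'0)[M [_ HM]] := a_tail.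
exists (Num.truncn (M / eta)).+1 => n Mn.
have n0 : (0 < n)%N by exact: leq_trans Mn.
have n0' : 0 < n%:R :> R by rewrite ltr0n.
have Mt : M < eta * n%:R.
  rewrite mulrC -ltr_pdivrMr//; apply: (lt_le_trans (truncnS_gt _)).
  by rewrite ler_nat.
pose D j := [set w | expR (eta * n%:R) < cabs (a j w)].
have mE : measurable ([set z | expR (eta * n%:R) < cabs z] : set (borelC R)).
  apply: open_borelC; rewrite (_ : [set z | _] = [set z | expR (eta * n%:R) < cabs (z - 0)]).
    exact: open_cabs_gt.
  by apply/seteqP; split=> z /=; rewrite subr0.
have mD j : measurable (D j) by exact: (measurable_RV_preimage (a j) mE).
have PD j : P (D j) = P (D 0%N) by exact: a_ident mE.
exists (\big[setU/set0]_(j < poly_dim d n) D j); split.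
- exact: bigsetU_measurable.
- have := HM _ Mt; rewrite sub0r normrN ger0_norm; last first.
    by rewrite mulr_ge0 ?exprn_ge0 ?fine_ge0 ?mulr_ge0// ltW.
  rewrite -/(D 0%N) => H.
  have U : (P (\big[setU/set0]_(j < poly_dim d n) D j) <= \sum_(j < poly_dim d n) P (D j))%E.
    exact: Boole_inequality.
  rewrite (eq_bigr (fun=> P (D 0%N))) // in U.
  have E0 : P (D 0%N) = (fine (P (D 0%N)))%:E by rewrite fineK// probability_fin_num.
  rewrite E0 sumEFin sumr_const card_ord in U.
  rewrite -lee_fin fineK ?probability_fin_num//; last exact: bigsetU_measurable.
  apply: (le_trans U); rewrite lee_fin -[_ *+ poly_dim d n]mulr_natl.
  set x := fine _ in H *.
  have x0 : 0 <= x by exact: fine_ge0.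
  have h : (poly_dim d n)%:R <= (2 * n%:R) ^+ d :> R.
    apply: (@le_trans _ _ (n.+1%:R ^+ d)); first by rewrite -natrX ler_nat poly_dim_le.
    rewrite lerXn2r ?nnegrE ?mulr_ge0 ?ler0n// -natr1.
    have : (1 : R) <= n%:R by rewrite ler1n.
    lra.
  apply: (@le_trans _ _ ((2 * n%:R) ^+ d * x)); first by rewrite ler_wpM2r.
  have e2 : 0 < (eta / 2) ^+ d by rewrite exprn_gt0// divr_gt0.
  rewrite -(ler_pM2r e2) mulrAC -exprMn.
  by rewrite (_ : 2 * _ * _ = eta * n%:R) ?(ltW H)//; field.
- move=> w nB j; rewrite leNgt; apply/negP => h; apply: nB.
  by rewrite -bigcup_mkord; exists (j : nat) => //=.
Qed.

End coefficients.

Section grid_bound.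
Context {R : realType} (d : nat).

(** The bound is independent of [N]: there are [N ^ (2 d)] boxes, of volume
    proportional to [N ^ (- 2 d)]. *)
Lemma L1dist_grid_bound (q : mpoly d R[i]) n (v : 'rV[R[i]]_d -> R) (e S : R) N
    (C : set 'rV[R[i]]_d) :
  (0 < n)%N -> (0 < N)%N -> continuous v -> (forall z, 0 <= v z) -> 0 <= e -> 0 < S ->
  compact C -> C `<=` box 0 S ->
  (forall z, cabs (peval q z) <= expR (n%:R * (v z + 2 * e))) ->
  (forall k : {ffun 'I_d -> 'I_N * 'I_N},
     (exists2 y, C y & box (grid_point S k) (S / N%:R) y) ->
     exists z0, [/\ box (grid_point S k) (S / N%:R) z0,
       (forall z, box z0 (6 * (S / N%:R)) z -> v z <= v z0 + e) &
       expR (n%:R * (v z0 - 3 * e)) <= cabs (peval q z0)]) ->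
  (L1dist C (fun z => (n%:R^-1)%:E * lne (cabs (peval q z))%:E) (fun z => (v z)%:E)
   <= (8 * e * (6 * S) ^+ (2 * d))%:E)%E.
Proof.
move=> n0 N0 cv v0 e0 S0 cC CS up low.
have N0' : 0 < N%:R :> R by rewrite ltr0n.
set s := S / N%:R; have s0 : 0 < s by rewrite divr_gt0.
pose A (k : {ffun 'I_d -> 'I_N * 'I_N}) := `[< exists2 y, C y & box (grid_point S k) s y >].
pose F (y : d.-tuple (measurableTypeR R * measurableTypeR R)) :=
  `|(n%:R^-1)%:E * lne (cabs (peval q (of_coords y)))%:E - (v (of_coords y))%:E|%E.
have mF : measurable_fun setT F.
  apply: measurableT_comp; first exact: abse_measurable.
  apply: emeasurable_funB; last by apply/measurable_EFinP; exact: measurable_of_coords.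
  apply: measurable_funeM.
  apply: (measurableT_comp (@measurable_lne_EFin R)).
  apply: (@measurable_of_coords R d (fun z => cabs (peval q z))) => z.
  by apply: continuous_comp; [exact: continuous_peval|exact: continuous_cabs].
have := @ge0_integral_cover R _ _ (lebesgue_R2d d) _ A
  (fun k => @of_coords R d @^-1` box (grid_point S k) s) (@of_coords R d @^-1` C) F mF.
rewrite /L1dist -/(F _) => H; apply: le_trans (H _ _ _ _) _.
- by move=> x; exact: abse_ge0.
- exact: measurable_of_coords_compact.
- by move=> k; exact: measurable_box.
- move=> y Cy; have [k yk] := grid_cover N0 S0 (CS _ Cy).
  by exists k => //; apply/asboolP; exists (of_coords y).
apply: (@le_trans _ _ (\sum_(k : {ffun 'I_d -> 'I_N * 'I_N}) (8 * e * (6 * s) ^+ (2 * d))%:E)%E).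
  rewrite big_mkcond/=; apply: lee_sum => k _.
  case: ifPn => [/asboolP Ak|_]; last first.
    by rewrite lee_fin !mulr_ge0// exprn_ge0// mulr_ge0// ltW.
  have [z0 [z0b osc lz0]] := low k Ak.
  have e2 : 0 <= 2 * e by rewrite mulr_ge0.
  have h6 : 0 <= e + 2 * e + 3 * e by lra.
  have := box_L1_bound n0 cv v0 e2 up s0 z0b osc lz0 h6.
  by rewrite (_ : e + 2 * (2 * e) + 3 * e = 8 * e)//; ring.
rewrite sumEFin sumr_const card_ffun card_prod !card_ord lee_fin.
rewrite -[leLHS]mulr_natr -[leLHS]mulrA ler_wpM2l ?mulr_ge0//.
rewrite mulnn -expnM natrX -exprMn -mulrA divfK// gt_eqF//.
Qed.

End grid_bound.

(** * Convergence in probability *)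
Lemma probability_bigsetU (R : realType) d0 (T : measurableType d0)
    (P : probability T R) (I : finType) (E : I -> set T) (b : R) :
  (forall k, measurable (E k)) -> (forall k, fine (P (E k)) <= b) ->
  measurable (\big[setU/set0]_k E k) /\
  (P (\big[setU/set0]_k E k) <= (#|I|%:R * b)%:E)%E.
Proof.
move=> mE Eb; split; first exact: bigsetU_measurable.
rewrite mulr_natl -sumr_const -sumEFin.
pose Q (A : set T) (x : \bar R) := measurable A /\ (P A <= x)%E.
suff : Q (\big[setU/set0]_k E k) (\sum_(k : I) b%:E)%E by case.
apply: (big_ind2 Q) => [|A x B y [mA Ax] [mB By]|k _].
- by split; rewrite ?measure0.
- split; first exact: measurableU.
  by apply: le_trans (measureU2 _ mA mB) _; exact: leeD.
- by split=> //; rewrite -(fineK (probability_fin_num P (mE k))) lee_fin.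
Qed.

(** The coordinates move by at most [2 s] inside the first box and by [6 s] more
    after that, for the real and for the imaginary part. *)
Lemma box_close (R : realType) d (x y z0 z : 'rV[R[i]]_d) (s : R) :
  0 < s -> box x s y -> box x s z0 -> box z0 (6 * s) z ->
  forall i, cabs (z ord0 i - y ord0 i) < 17 * s.
Proof.
move=> s0 xy xz0 z0z i; apply: (le_lt_trans (cabs_le_ReIm _)).
move: (xy i) (xz0 i) (z0z i).
move: (x ord0 i) (y ord0 i) (z0 ord0 i) (z ord0 i) => [x1 x2] [y1 y2] [w1 w2] [z1 z2] /=.
rewrite !ler_norml => -[/andP[? ?] /andP[? ?]] [/andP[? ?] /andP[? ?]] [/andP[? ?] /andP[? ?]].
have h1 : `|z1 - y1| <= 8 * s by rewrite ler_norml; apply/andP; split; lra.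
have h2 : `|z2 - y2| <= 8 * s by rewrite ler_norml; apply/andP; split; lra.
by lra.
Qed.

Theorem theorem3p6 (R : realType) (d : nat) (d_gt0 : (0 < d)%N)
  (K : set 'rV[R[i]]_d) (compactK : compact K) (regularK : regular_set K)
  (p : nat -> mpoly d R[i]) (p0 : p 0%N = 1)
  (p_le1 : forall j, (supnorm K (p j) <= 1)%E)
  (p_basis : forall n,
     basis_of_set (poly_space d n) (fun j : 'I_(poly_dim d n) => p j))
  (Bn_cvg : forall Y : nat -> nat, {homo Y : m n / (m < n)%N} ->
     exists (Y0 : nat -> nat) (w : nat -> 'rV[R[i]]_d),
       [/\ {homo Y0 : m n / (m < n)%N}, dense (range w) &
         forall r : nat,
           (let n := Y (Y0 k) in ((2 * n%:R)^-1 * ln (sq_sum p n (w r)))%:E)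
             @[k --> \oo] --> extremal_function K (w r)])
  (d0 : measure_display) (T : measurableType d0) (P : probability T R)
  (a : nat -> {RV P >-> borelC R})
  (a_indep : mutually_independent a) (a_ident : identically_distributed a)
  (a_nondeg : forall j, nondegenerate_rv (a j))
  (a_tail : forall j,
     t ^+ d * fine (P [set w | expR t < cabs (a j w)]) @[t --> +oo] --> (0 : R)) :
  cvg_in_probability_L1loc P
    (fun n w z =>
       (n%:R^-1)%:E * lne (cabs (poly_comb p (fun j => a j w) n z))%:E)%E
    (extremal_function K).
Proof.
have [v cv vE] := regular_extremal_finite regularK p_le1 p0 (basis_degree p_basis)
  (poly_dim_gt0 d) (Bn_cvg id (fun _ _ h => h)).
have v0 z : 0 <= v z by rewrite -lee_fin -vE extremal_ge0.
have [r [q [r0 q0 q1 conc0]]] := nondegenerate_not_concentrated (a_nondeg 0%N).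
have conc j : concentrated (a j) r q.
  move=> u; rewrite (_ : P _ = P [set w | cabs (a 0%N w - u) <= r])//.
  exact: a_ident (measurable_cball u r).
move=> C cC e e0.
have [S S0 CS] := compact_in_box cC.
have vol0 : 0 < (6 * S) ^+ (2 * d) by rewrite exprn_gt0// mulr_gt0.
pose eps := e / (16 * (6 * S) ^+ (2 * d)).
have eps0 : 0 < eps by rewrite divr_gt0// mulr_gt0.
have eps2 : 0 < eps / 2 by rewrite divr_gt0.
have [rho rho0 Hrho] := compact_uniform cC cv eps2.
pose N := (Num.truncn (17 * S / rho)).+1.
have N0 : 0 < N%:R :> R by rewrite ltr0n.
pose s := S / N%:R.
have s0 : 0 < s by rewrite divr_gt0.
have srho : 17 * s < rho.
  rewrite /s mulrA ltr_pdivrMr// [ltRHS]mulrC -ltr_pdivrMr//; exact: truncnS_gt.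
pose I : finType := {ffun 'I_d -> 'I_N * 'I_N}.
pose x (k : I) : 'rV[R[i]]_d := grid_point S k.
pose A (k : I) := exists2 y, C y & box (x k) s y.
have osc k : A k -> forall z0 z, box (x k) s z0 -> box z0 (6 * s) z -> v z <= v z0 + eps.
  move=> [y Cy yk] z0 z z0k z0z.
  have z0z0 : box z0 (6 * s) z0 by move=> i; rewrite subrr/= normr0 mulr_ge0// ltW.
  have h1 : `|v z - v y| <= eps / 2.
    by apply: Hrho => // i; apply: lt_trans srho; exact: box_close yk z0k z0z i.
  have h2 : `|v z0 - v y| <= eps / 2.
    by apply: Hrho => // i; apply: lt_trans srho; exact: box_close yk z0k z0z0 i.
  by move: h1 h2; rewrite !ler_norml => /andP[? ?] /andP[? ?]; lra.
have osc' k : A k -> forall z z', box (x k) s z -> box (x k) s z' -> v z <= v z' + eps.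
  move=> Ak z z' zk z'k; apply: (osc k) => // i.
  move: (zk i) (z'k i); move: (x k ord0 i) (z ord0 i) (z' ord0 i) => [x1 x2] [z1 z2] [w1 w2] /=.
  rewrite !ler_norml => -[/andP[? ?] /andP[? ?]] [/andP[? ?] /andP[? ?]].
  by split; apply/andP; split; lra.
pose event n := [set w | (e%:E <= L1dist C (fun z => (n%:R^-1)%:E *
    lne (cabs (poly_comb p (fun j => a j w) n z))%:E) (extremal_function K))%E].
have mevent n : measurable (event n).
  rewrite /event (_ : extremal_function K = fun z => (v z)%:E); last exact/funext.
  exact: measurable_L1dist_ge.
suff main del : 0 < del -> exists n0, forall n, (n0 <= n)%N -> fine (P (event n)) <= del.
  apply/fine_cvgP; split; first by near=> n; exact: (probability_fin_num P (mevent n)).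
  apply/cvgrPdist_le => del del0; have [n0 H] := main del del0.
  exists n0 => // n /= nn0; rewrite sub0r normrN ger0_norm ?fine_ge0//.
  exact: H.
move=> del0; have del2 : 0 < del / 2 by rewrite divr_gt0.
(* The number of boxes is fixed before the number [L] of coefficients that are
   used on each of them. *)
have [L HL] : exists L, #|I|%:R * q ^+ L <= del / 2.
  have I1 : 0 < #|I|%:R + 1 :> R by rewrite ltr_wpDl// ler0n.
  have dI : 0 < del / 2 / (#|I|%:R + 1) by rewrite divr_gt0.
  have /cvgrPdist_le/(_ _ dI)[L _ HL] : q ^+ k @[k --> \oo] --> (0 : R).
    by apply: cvg_expr; rewrite ger0_norm.
  exists L; have := HL L (leqnn L); rewrite sub0r normrN ger0_norm ?exprn_ge0//.
  rewrite ler_pdivlMr// => h; apply: le_trans h.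
  by rewrite mulrC ler_wpM2l ?exprn_ge0// lerDl.
have /choice[et etP] : forall k, exists en : R * nat, 0 < en.1 /\
    (A k -> forall n, (en.2 <= n)%N -> rare_below p v a q (x k) s eps L en.1 n).
  move=> k; have [Ak|nA] := pselect (A k); last by exists (1, 0%N).
  have [eta eta0 [n0 H]] := rare_below_box d_gt0 p0 p_le1 p_basis Bn_cvg vE
    a_indep r0 q0 conc L s0 eps0 (osc' k Ak).
  by exists (eta, n0).
pose eta := \big[Num.min/eps]_(k : I) (et k).1.
have eta0 : 0 < eta.
  rewrite /eta; elim/big_ind : _ => // [u w u0 w0|k _]; last exact: (etP k).1.
  by rewrite lt_min u0.
have etaeps : eta <= eps by exact: bigmin_le_id.
have etak k : eta <= (et k).1 by exact: bigmin_le_cond.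
have [N1 HN1] := coefficients_le_expR a_ident (a_tail 0%N) eta0 del2.
have [N2 HN2] := poly_dim_le_expR d eps0.
exists (maxn (maxn N1 N2) (maxn 1 (\max_(k : I) (et k).2))) => n.
rewrite !geq_max => /andP[/andP[nN1 nN2] /andP[n1 nk]].
have [B [mB PB HB]] := HN1 n nN1.
have /choice[E' E'P] : forall k, exists E' : set T, [/\ measurable E',
    fine (P E') <= q ^+ L & A k -> forall w,
      (forall j : 'I_(poly_dim d n), cabs (a j w) <= expR ((et k).1 * n%:R)) ->
      (forall z, box (x k) s z ->
         cabs (poly_comb p (fun j => a j w) n z) < expR (n%:R * (v z - 3 * eps))) ->
      E' w].
  move=> k; have [Ak|nA] := pselect (A k); last first.
    by exists set0; rewrite measure0 exprn_ge0.
  have kn : ((et k).2 <= n)%N by apply: leq_trans nk; exact: (leq_bigmax k).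
  by have [E' [mE' PE' H]] := (etP k).2 Ak n kn; exists E'.
have [mU PU] := probability_bigsetU (fun k => let: And3 h _ _ := E'P k in h)
  (fun k => let: And3 _ h _ := E'P k in h).
have sub : event n `<=` B `|` \big[setU/set0]_k E' k.
  move=> w; apply: contraPP => /not_orP[nB nU] /=.
  apply/negP; rewrite -ltNge.
  have cj := HB w nB.
  pose H : mpoly d R[i] := \sum_(j < poly_dim d n) (a j w : R[i]) *: p j.
  have HE z : poly_comb p (fun j => a j w) n z = peval H z.
    by rewrite /peval /H raddf_sum /=; apply: eq_bigr => j _; rewrite mevalZ.
  rewrite (_ : extremal_function K = fun z => (v z)%:E); last exact/funext.
  rewrite (_ : poly_comb p (fun j => a j w) n = peval H); last exact/funext.
  apply: le_lt_trans (L1dist_grid_bound n1 (ltn0Sn _ : (0 < N)%N) cv v0 (ltW eps0) S0 cC CS _ _) _.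
  - move=> z; rewrite -HE.
    apply: (le_trans (cabs_sum _ _ _)).
    apply: (@le_trans _ _ (\sum_(j < poly_dim d n) expR (eta * n%:R) * expR (n%:R * v z))).
      apply: ler_sum => j _; rewrite cabsM; apply: ler_pM; rewrite ?cabs_ge0//.
      exact: (basis_le_expR p_le1 p_basis vE).
    rewrite sumr_const card_ord -[leLHS]mulr_natl -expRD.
    apply: (@le_trans _ _ (expR (eps * n%:R) * expR (eta * n%:R + n%:R * v z))).
      by rewrite ler_wpM2r ?expR_ge0// HN2.
    rewrite -expRD ler_expR.
    have : eta * n%:R <= eps * n%:R by rewrite ler_wpM2r.
    by lra.
  - move=> k Ak; apply: contrapT => nz; apply: nU.
    rewrite (bigD1 k)//=; left; have [_ _ Ew] := E'P k; apply: Ew => //.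
      move=> j; apply: le_trans (cj j) _; rewrite ler_expR ler_wpM2r//.
    move=> z zk; rewrite ltNge; apply/negP => hz; apply: nz; exists z.
    by split=> //; [move=> z'; exact: (osc k Ak z z' zk)|rewrite -HE].
  have epsE : eps * (6 * S) ^+ (2 * d) = e / 16 by rewrite /eps; field; rewrite gt_eqF.
  by rewrite lte_fin -mulrA epsE; lra.
have mBU := measurableU _ _ mB mU.
rewrite -lee_fin fineK ?probability_fin_num//.
apply: (@le_trans _ _ (P (B `|` \big[setU/set0]_k E' k))).
  by apply: le_measure; rewrite ?inE.
apply: le_trans (measureU2 _ mB mU) _.
rewrite (_ : del = del / 2 + del / 2) ?EFinD; last by field.
rewrite -lee_fin fineK ?probability_fin_num// in PB; apply: (leeD PB).
by apply: le_trans PU _; rewrite lee_fin.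
Unshelve. all: by end_near.
Qed.
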